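(* Let $X$ be an infinite-dimensional complex Banach space and $T\in L(X)$. Write $\sigma_{\mathbf{gK}\mathcal M}$, $\sigma_{\mathbf{gD}\mathcal M}$ and $\sigma_{\mathbf{gD}\mathcal M\mathcal C}$ for the spectra defined in the context. Then: (i) the following inclusions hold: $$\partial\sigma_{\mathbf{gD}\mathcal M}(T)\subset\partial\sigma_{\mathbf{gD}\mathcal M\mathcal J}(T)\subset\partial\sigma_{\mathbf{gD}\mathcal M\mathcal W_+}(T)\subset\partial\sigma_{\mathbf{gD}\mathcal M\Phi_+}(T)\subset\partial\sigma_{\mathbf{gK}\mathcal M}(T),$$ $$\partial\sigma_{\mathbf{gD}\mathcal M}(T)\subset\partial\sigma_{\mathbf{gD}\mathcal M\mathcal W}(T)\subset\partial\sigma_{\mathbf{gD}\mathcal M\Phi}(T)\subset\partial\sigma_{\mathbf{gK}\mathcal M}(T),$$ $$\partial\sigma_{\mathbf{gD}\mathcal M}(T)\subset\partial\sigma_{\mathbf{gD}\mathcal M\mathcal S}(T)\subset\partial\sigma_{\mathbf{gD}\mathcal M\mathcal W_-}(T)\subset\partial\sigma_{\mathbf{gD}\mathcal M\Phi_-}(T)\subset\partial\sigma_{\mathbf{gK}\mathcal M}(T),$$ and moreover $$\partial\sigma_{\mathbf{gD}\mathcal M\mathcal W}(T)\subset\partial\sigma_{\mathbf{gD}\mathcal M\mathcal W_+}(T),\quad \partial\sigma_{\mathbf{gD}\mathcal M\mathcal W}(T)\subset\partial\sigma_{\mathbf{gD}\mathcal M\mathcal W_-}(T),$$ $$\partial\sigma_{\mathbf{gD}\mathcal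 M\Phi}(T)\subset\partial\sigma_{\mathbf{gD}\mathcal M\Phi_+}(T),\quad \partial\sigma_{\mathbf{gD}\mathcal M\Phi}(T)\subset\partial\sigma_{\mathbf{gD}\mathcal M\Phi_-}(T);$$ (ii) $\eta\,\sigma_{\mathbf{gD}\mathcal M}(T)=\eta\,\sigma_{\mathbf{gD}\mathcal M\mathcal C}(T)$ for each class $\mathcal C\in\{\mathcal J,\mathcal S,L(X)^{-1},\Phi_+,\Phi_-,\Phi,\mathcal W_+,\mathcal W_-,\mathcal W\}$; (iii) for each $\sigma_*\in\{\sigma_{\mathbf{gK}\mathcal M},\sigma_{\mathbf{gD}\mathcal M\mathcal W},\sigma_{\mathbf{gD}\mathcal M\Phi},\sigma_{\mathbf{gD}\mathcal M\mathcal W_+},\sigma_{\mathbf{gD}\mathcal M\Phi_+},\sigma_{\mathbf{gD}\mathcal M\mathcal J},\sigma_{\mathbf{gD}\mathcal M\mathcal W_-},\sigma_{\mathbf{gD}\mathcal M\Phi_-},\sigma_{\mathbf{gD}\mathcal M\mathcal S}\}$, the set $\sigma_{\mathbf{gD}\mathcal M}(T)$ consists of $\sigma_*(T)$ and possibly some holes in $\sigma_*(T)$; (iv) if one of the sets $\sigma_{\mathbf{gK}\mathcal M}(T)$, $\sigma_{\mathbf{gD}\mathcal M}(T)$, $\sigma_{\mathbf{gD}\mathcal M\mathcal W}(T)$, $\sigma_{\mathbf{gD}\mathcal M\Phi}(T)$, $\sigma_{\mathbf{gD}\mathcal M\mathcal W_+}(T)$, $\sigma_{\mathbf{gD}\mathcal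 M\Phi_+}(T)$, $\sigma_{\mathbf{gD}\mathcal M\mathcal J}(T)$, $\sigma_{\mathbf{gD}\mathcal M\mathcal W_-}(T)$, $\sigma_{\mathbf{gD}\mathcal M\Phi_-}(T)$, $\sigma_{\mathbf{gD}\mathcal M\mathcal S}(T)$ is finite (countable), then all of them are equal and hence finite (countable).
   Context: $L(X)$ is the algebra of bounded linear operators on $X$; $N(T)$, $R(T)$ are kernel and range; $\partial K$ is the boundary of $K\subset\mathbb C$. For compact $K\subset\mathbb C$, the connected hull $\eta K$ is the complement of the unbounded component of $\mathbb C\setminus K$; a hole in $K$ is a bounded component of $\mathbb C\setminus K$. (All the spectra below are compact.) $(M,N)\in Red(T)$ means that $M,N$ are closed $T$-invariant subspaces with $X=M\oplus N$; $T_M$, $T_N$ are the restrictions of $T$ viewed as operators on $M$, $N$. $T$ is Kato if $R(T)$ is closed and $N(T)\subset R(T^n)$ for every $n\in\mathbb N$. An operator is meromorphic if every non-zero point of its spectrum is a pole of its resolvent. $T$ admits a generalized Kato-meromorphic decomposition if there is $(M,N)\in Red(T)$ with $T_M$ Kato and $T_N$ meromorphic. Operator classes (defined likewise on any Banach space): $\mathcal J$ = bounded below; $\mathcal S$ = surjective; $L(X)^{-1}$ = invertible; $\Phi_+$ = upper semi-Fredholm (finite-dimensional kernel, closed range); $\Phi_-$ = lower semi-Fredholm (range of finite codimension); $\Phi$ = Fredholm; $\mathcal W_+$ = upper semi-Fredholm with index $\le 0$; $\mathcal W_-$ = lower semi-Fredholm with index $\ge 0$; $\mathcal W$ = Fredholm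 of index $0$; the index is $\dim N(T)-\mathrm{codim}\,R(T)$. For such a class $\mathcal C$, $\sigma_{\mathbf{gD}\mathcal M\mathcal C}(T)$ is the set of $\lambda\in\mathbb C$ for which there is no $(M,N)\in Red(T)$ with $(T-\lambda I)_M$ in $\mathcal C$ and $(T-\lambda I)_N$ meromorphic. $\sigma_{\mathbf{gD}\mathcal M}(T)=\sigma_{\mathbf{gD}\mathcal M L(X)^{-1}}(T)$; it equals the set of $\lambda$ such that $T-\lambda I$ is not generalized Drazin-meromorphic invertible, where $A\in L(X)$ is generalized Drazin-meromorphic invertible if there is $S\in L(X)$ with $AS=SA$, $SAS=S$, $ASA-A$ meromorphic. $\sigma_{\mathbf{gK}\mathcal M}(T)=\{\lambda\in\mathbb C:T-\lambda I\text{ does not admit a generalized Kato-meromorphic decomposition}\}$. *)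

(* Defs.v *)
From HB Require Import structures.
From mathcomp Require Import all_boot all_order all_algebra.
From mathcomp Require Import complex.
From mathcomp Require Import all_classical all_reals all_analysis.

Set Implicit Arguments.
Unset Strict Implicit.
Unset Printing Implicit Defensive.

Import Order.TTheory GRing.Theory Num.Theory.
Import numFieldNormedType.Exports.

Local Open Scope classical_set_scope.
Local Open Scope ring_scope.

HB.instance Definition _ (R : realType) := NormedModule.copy R[i] R[i]^o.

(* On normed spaces over [R[i]], a linear map is bounded iff it is continuous. *)
Record bounded_operator (K : numFieldType) (X : normedModType K) :=
  BoundedOperator {
    bop :> {linear X -> X} ;
    bop_continuous : continuous bop }.

Notation "''L' ( X )" := (bounded_operator X)
  (at level 8, format "''L' ( X )") : type_scope.

Section Shift.
Context {K : numFieldType} {X : normedModType K}.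
Implicit Types (T : 'L(X)) (l : K).

Definition shift_fun T l (x : X) : X := T x - l *: x.

Let shift_linear T l : linear (shift_fun T l).
Proof.
move=> a x y; rewrite /shift_fun linearP scalerDr scalerBr.
by rewrite !scalerA (mulrC l a) opprD addrACA.
Qed.

HB.instance Definition _ T l :=
  GRing.isLinear.Build K X X *:%R (shift_fun T l) (@shift_linear T l).

Let shift_continuous T l : continuous (shift_fun T l).
Proof.
move=> x; apply: cvgB; first exact: bop_continuous.
by apply: cvgZ; [exact: cvg_cst|exact: cvg_id].
Qed.

Definition shift T l : 'L(X) :=
  @BoundedOperator K X (shift_fun T l) (@shift_continuous T l).

End Shift.

Record closed_subspace (K : numFieldType) (X : normedModType K) :=
  ClosedSubspace {
    cs_set :> set X ;
    cs_zero : cs_set 0 ;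
    cs_lin : forall (a : K) (x y : X),
      cs_set x -> cs_set y -> cs_set (a *: x + y) ;
    cs_closed : closed cs_set }.

Section SubspaceType.
Context {K : numFieldType} {X : normedModType K}.
Implicit Types M : closed_subspace X.

Definition cs_pred M : {pred X} := fun x => x \in cs_set M.

Let cs_submod M : submod_closed (cs_pred M).
Proof.
split; first by apply/mem_set/cs_zero.
move=> a x y /set_mem Mx /set_mem My.
by apply/mem_set; apply: cs_lin.
Qed.

HB.instance Definition _ M :=
  GRing.isSubmodClosed.Build K X (cs_pred M) (@cs_submod M).

Record cs_type M := CsType { cs_val : X ; cs_valP : cs_val \in cs_pred M }.

HB.instance Definition _ M := [isSub for @cs_val M].
HB.instance Definition _ M := [Choice of cs_type M by <:].
HB.instance Definition _ M := [SubChoice_isSubLmodule of cs_type M by <:].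

Definition cs_norm M (x : cs_type M) : K := `|cs_val x|.

Let cs_normD M (x y : cs_type M) : cs_norm (x + y) <= cs_norm x + cs_norm y.
Proof. exact: ler_normD. Qed.

Let cs_normZ M (l : K) (x : cs_type M) : cs_norm (l *: x) = `|l| * cs_norm x.
Proof. exact: normrZ. Qed.

Let cs_norm_eq0 M (x : cs_type M) : cs_norm x = 0 -> x = 0.
Proof. by move=> /normr0_eq0 x0; apply: val_inj. Qed.

HB.instance Definition _ M :=
  @Lmodule_isNormed.Build K (cs_type M) (@cs_norm M)
    (@cs_normD M) (@cs_normZ M) (@cs_norm_eq0 M).


Lemma cs_val_continuous M : continuous (@cs_val M).
Proof.
move=> x; apply: (@cvgrPdist_lt K X _ _ (nbhs_filter (x : cs_type M)) _ _).2 => e e0.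
exact: (@nbhsx_ballx K (cs_type M) x e e0).
Qed.

End SubspaceType.

Section SubspaceComplete.
Context {K : numFieldType} {X : completeNormedModType K}.
Variable M : closed_subspace X.

Let cs_complete (F : set_system (cs_type M)) :
  ProperFilter F -> cauchy F -> cvg F.
Proof.
move=> FF Fc.
have cG : cauchy (@cs_val K X M @ F).
  apply/cauchy_ballP => e e0.
  have /(_ e e0) := (@cauchy_ballP K (cs_type M) F FF).2 Fc.
  move=> [[A B] /= [FA FB] AB].
  exists (@cs_val K X M @` A, @cs_val K X M @` B) => /=.
    by split; [apply: filterS FA|apply: filterS FB] => x Ax; exists x.
  move=> [_ _] /= [[x Ax <-] [y By <-]].
  by have := AB (x, y) (conj Ax By); rewrite /= -!ball_normE.
have /cvg_ex [l Gl] : cvg (@cs_val K X M @ F) by exact: cauchy_cvg.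
have Ml : cs_set M l.
  apply: (@closed_cvg _ _ F _ (@cs_val K X M) (cs_set M)) Gl.
  - exact: cs_closed.
  - by apply: nearW => -[x Mx]; exact: set_mem Mx.
apply/cvg_ex; exists (CsType (mem_set Ml) : cs_type M).
apply/cvgrPdist_lt => e e0.
by move/cvgrPdist_lt: Gl => /(_ e e0).
Qed.

HB.instance Definition _ := Uniform_isComplete.Build (cs_type M) cs_complete.

End SubspaceComplete.

Definition invariant_subspace (K : numFieldType) (X : normedModType K)
    (T : 'L(X)) (M : closed_subspace X) : Prop :=
  forall x, cs_set M x -> cs_set M (T x).

Lemma invariant_shift (K : numFieldType) (X : normedModType K)
    (T : 'L(X)) (M : closed_subspace X) (l : K) :
  invariant_subspace T M -> invariant_subspace (shift T l) M.
Proof.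
move=> TM x Mx; rewrite /= /shift_fun addrC -scaleNr.
by apply: cs_lin => //; exact: TM.
Qed.

Section Restriction.
Context {K : numFieldType} {X : normedModType K}.
Variables (T : 'L(X)) (M : closed_subspace X) (TM : invariant_subspace T M).

Definition restr_fun (x : cs_type M) : cs_type M :=
  CsType (mem_set (TM (set_mem (valP x)))).

Let restr_linear : linear restr_fun.
Proof. by move=> a x y; apply: val_inj; rewrite /= linearP. Qed.

HB.instance Definition _ :=
  GRing.isLinear.Build K (cs_type M) (cs_type M) *:%R restr_fun
    restr_linear.

Let restr_continuous : continuous restr_fun.
Proof.
move=> x.
apply: (@cvgrPdist_lt K (cs_type M) _ _ (nbhs_filter (x : cs_type M)) _ _).2.
move=> e e0.
have := @continuous_comp _ _ _ (@cs_val K X M) T x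
  (@cs_val_continuous K X M x) (@bop_continuous K X T _).
by move/(@cvgrPdist_lt K X _ _ (nbhs_filter (x : cs_type M)) _ _).1 => /(_ e e0).
Qed.

(* The operator [T_M] induced by [T] on the Banach space [M]. *)
Definition restr : 'L(cs_type M) :=
  @BoundedOperator K (cs_type M) restr_fun restr_continuous.

End Restriction.

Record Red (K : numFieldType) (X : normedModType K) (T : 'L(X))
    (M N : closed_subspace X) : Prop := MkRed {
  red_l : invariant_subspace T M ;
  red_r : invariant_subspace T N ;
  red_cap : cs_set M `&` cs_set N = [set 0] ;
  red_sum : forall x, exists y z, [/\ cs_set M y, cs_set N z & x = y + z] }.

Section Spectra.
Context {R : realType}.
Local Notation C := (R[i]).
Implicit Types (Y : completeNormedModType C).

Definition edim Y (V : set Y) : \bar R :=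
  ereal_sup [set n%:R%:E | n in [set n : nat | exists x : 'I_n -> Y,
    (forall i, V (x i)) /\
    (forall c : 'I_n -> C, \sum_i c i *: x i = 0 -> forall i, c i = 0)]].

(* Dimension of [Y / V]: largest size of a family independent modulo [V]. *)
Definition ecodim Y (V : set Y) : \bar R :=
  ereal_sup [set n%:R%:E | n in [set n : nat | exists x : 'I_n -> Y,
    forall c : 'I_n -> C, V (\sum_i c i *: x i) -> forall i, c i = 0]].

Definition nullspace Y (T : 'L(Y)) : set Y := [set x | T x = 0].

(* Only meaningful when [edim (nullspace T)] or [ecodim (range T)] is finite,
   since [+oo - +oo = -oo] in [\bar R]. *)
Definition op_index Y (T : 'L(Y)) : \bar R :=
  (edim (nullspace T) - ecodim (range T))%E.

Definition is_inverse Y (T S : 'L(Y)) : Prop := cancel T S /\ cancel S T.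

Definition invertible Y (T : 'L(Y)) : Prop := exists S : 'L(Y), is_inverse T S.

Definition bounded_below Y (T : 'L(Y)) : Prop :=
  exists2 c : C, 0 < c & forall x, c * `|x| <= `|T x|.

Definition op_surjective Y (T : 'L(Y)) : Prop := range T = setT.

Definition upper_semi_Fredholm Y (T : 'L(Y)) : Prop :=
  (edim (nullspace T) < +oo)%E /\ closed (range T).

Definition lower_semi_Fredholm Y (T : 'L(Y)) : Prop :=
  (ecodim (range T) < +oo)%E.

Definition Fredholm Y (T : 'L(Y)) : Prop :=
  upper_semi_Fredholm T /\ lower_semi_Fredholm T.

Definition upper_semi_Weyl Y (T : 'L(Y)) : Prop :=
  upper_semi_Fredholm T /\ (op_index T <= 0)%E.

Definition lower_semi_Weyl Y (T : 'L(Y)) : Prop :=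
  lower_semi_Fredholm T /\ (0 <= op_index T)%E.

Definition Weyl Y (T : 'L(Y)) : Prop := Fredholm T /\ op_index T = 0%E.

Inductive opclass : Type :=
  | CJ | CS | CInv | CPhiPlus | CPhiMinus | CPhi | CWPlus | CWMinus | CW.

Definition in_class (c : opclass) Y (T : 'L(Y)) : Prop :=
  match c with
  | CJ => bounded_below T
  | CS => op_surjective T
  | CInv => invertible T
  | CPhiPlus => upper_semi_Fredholm T
  | CPhiMinus => lower_semi_Fredholm T
  | CPhi => Fredholm T
  | CWPlus => upper_semi_Weyl T
  | CWMinus => lower_semi_Weyl T
  | CW => Weyl T
  end.

Definition Kato Y (T : 'L(Y)) : Prop :=
  closed (range T) /\ forall n, nullspace T `<=` range (iter n T).

Definition spectrum Y (T : 'L(Y)) : set C :=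
  [set l | ~ invertible (shift T l)].

Definition op_norm_cvg Y (S_ : nat -> Y -> Y) (S : 'L(Y)) : Prop :=
  forall e : C, 0 < e ->
    \forall n \near \oo, forall x, `|S_ n x - S x| <= e * `|x|.

(* [mu] is a pole of order [p >= 1] of the resolvent [l |-> (T - l I)^-1]:
   on a punctured neighbourhood of [mu] the resolvent is the sum of a Laurent
   series [\sum_(k >= 0) (l - mu)^(k - p) A_k] with [A_0 <> 0]. *)
Definition resolvent_pole Y (T : 'L(Y)) (mu : C) : Prop :=
  exists p : nat, (0 < p)%N /\ exists A : nat -> 'L(Y),
    (exists x, A 0%N x != 0) /\
    \forall l \near mu^', exists S : 'L(Y), is_inverse (shift T l) S /\
      op_norm_cvg
        (fun n x => \sum_(k < n) (l - mu) ^ (k%:Z - p%:Z) *: A k x) S.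

Definition meromorphic Y (T : 'L(Y)) : Prop :=
  forall mu, spectrum T mu -> mu != 0 -> resolvent_pole T mu.

Definition sigma_gDMC (c : opclass) Y (T : 'L(Y)) : set C :=
  [set l | ~ exists (M N : closed_subspace Y) (r : Red T M N),
     in_class c (restr (invariant_shift l (red_l r))) /\
     meromorphic (restr (invariant_shift l (red_r r)))].

Definition sigma_gDM Y (T : 'L(Y)) : set C := sigma_gDMC CInv T.

Definition gKM_decomposition Y (T : 'L(Y)) : Prop :=
  exists (M N : closed_subspace Y) (r : Red T M N),
    Kato (restr (red_l r)) /\ meromorphic (restr (red_r r)).

Definition sigma_gKM Y (T : 'L(Y)) : set C :=
  [set l | ~ gKM_decomposition (shift T l)].

Definition boundary (A : set C) : set C := closure A `\` A°.

(* For compact [A] the complement has exactly one unbounded component. *)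
Definition connected_hull (A : set C) : set C :=
  ~` [set z | ~ A z /\ ~ [bounded w | w in connected_component (~` A) z]].

Definition hole (A H : set C) : Prop :=
  (exists2 z, ~ A z & H = connected_component (~` A) z) /\
  [bounded w | w in H].

(* [B] consists of [A] and possibly some holes in [A]. *)
Definition with_some_holes (A B : set C) : Prop :=
  exists2 F : set (set C), F `<=` hole A & B = A `|` \bigcup_(H in F) H.

End Spectra.

(* Main.v *)
Require Import Defs.
From HB Require Import structures.
From mathcomp Require Import all_boot all_order all_algebra.
From mathcomp Require Import complex.
From mathcomp Require Import all_classical all_reals all_analysis.
From mathcomp Require Import ring lra zify.
Set Implicit Arguments.
Unset Strict Implicit.
Unset Printing Implicit Defensive.
Import Order.TTheory GRing.Theory Num.Theory.
Import numFieldNormedType.Exports.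
Local Open Scope classical_set_scope.
Local Open Scope ring_scope.
(* Imported again: [shift] must denote [Defs.shift], not the translation of
   MathComp-Analysis. *)
Require Import Defs.

(* If an operator A is Kato (semi-regular), then A - nu is Kato for all small nu,
   and dim N(A - nu) and codim R(A - nu) do not depend on nu.  All nine classes
   are determined, among operators with closed range, by these two numbers, and
   a semi-Fredholm operator is the direct sum of a Kato operator and a nilpotent
   one that contributes equally to both.  Hence every class is stable under
   small shifts; splitting off poles of the resolvent of the meromorphic part,
   one sees that the sets sigma_gDMC(T) are closed.  Moreover, if T - lambda has a
   generalized Kato-meromorphic decomposition and lambda is not interior to
   sigma_gDMC(T), then nearby shifts, chosen off the (nowhere dense) spectra of
   the meromorphic parts, put the Kato part of T - lambda in the class C, so that
   lambda is not in sigma_gDMC(T).  Thus the boundary of each sigma_gDMC(T) lies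
   in sigma_gKM(T), which is contained in all of them, and the rest is plane
   topology. *)

(** The summands of a decomposition live on different Banach spaces and are split and regrouped
    repeatedly. Decompositions are therefore similarities [sim A (dsum T1 T2)] with external direct
    sums; [Red] itself occurs only in the translation from and to the definitions.

    Stability of Kato operators rests on the hyperrange [Rinf A], the intersection of the ranges of
    all powers of [A]: a Kato operator maps it onto itself and is bounded below modulo it, and both
    properties survive small shifts. The dimension estimates obtained this way hold on a disc whose
    radius depends on the dimension [n] tested, whereas nullity and defect may be infinite;
    connectedness of segments yields one radius for all [n].

    A semi-Fredholm operator that is not Kato has a complemented Jordan block of nullity and defect
    1. Splitting off such blocks stops because one of the two numbers is finite, and it lowers both
    equally. At a pole, comparison of Laurent coefficients gives algebraic relations from which the
    spectral projection is built, without contour integrals. *)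

Section RealNorm.
Context {R : realType}.
Local Notation C := (R[i]).

(** Norms over [R[i]] take values in [R[i]], which is only partially ordered; the real-valued copy
    gives access to suprema and [lra]. *)
Definition nrm (V : normedZmodType C) (x : V) : R := complex.Re `|x|.

Lemma nrmE (V : normedZmodType C) (x : V) : `|x| = ((nrm x)%:C)%C.
Proof. by rewrite /nrm RRe_real // normr_real. Qed.

Lemma nrm_ge0 (V : normedZmodType C) (x : V) : 0 <= nrm x.
Proof. by rewrite -ler0c -nrmE. Qed.

Lemma nrm0 (V : normedZmodType C) : nrm (0 : V) = 0.
Proof. by rewrite /nrm normr0. Qed.

Lemma nrm_eq0 (V : normedZmodType C) (x : V) : nrm x = 0 -> x = 0.
Proof. by move=> h; apply: normr0_eq0; rewrite nrmE h. Qed.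

Lemma nrm_gt0 (V : normedZmodType C) (x : V) : x != 0 -> 0 < nrm x.
Proof.
move=> x0; rewrite lt_neqAle nrm_ge0 andbT eq_sym.
by apply: contra_neq x0 => /nrm_eq0.
Qed.

Lemma nrmN (V : normedZmodType C) (x : V) : nrm (- x) = nrm x.
Proof. by rewrite /nrm normrN. Qed.

Lemma nrmBC (V : normedZmodType C) (x y : V) : nrm (x - y) = nrm (y - x).
Proof. by rewrite -nrmN opprB. Qed.

Lemma nrmD (V : normedZmodType C) (x y : V) : nrm (x + y) <= nrm x + nrm y.
Proof. by rewrite -lecR rmorphD /= -!nrmE ler_normD. Qed.

Lemma nrmB (V : normedZmodType C) (x y : V) : nrm (x - y) <= nrm x + nrm y.
Proof. by rewrite -[nrm y]nrmN nrmD. Qed.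

Lemma nrm_dist (V : normedZmodType C) (y x z : V) :
  nrm (x - z) <= nrm (x - y) + nrm (y - z).
Proof. by rewrite (le_trans _ (nrmD _ _)) // addrA subrK. Qed.

Lemma nrmM (a b : C) : nrm (a * b) = nrm a * nrm b.
Proof. by apply: complexI; rewrite rmorphM /= -!nrmE normrM. Qed.

Lemma nrm1 : nrm (1 : C) = 1.
Proof. by apply: complexI; rewrite -nrmE normr1. Qed.

Lemma nrmX (a : C) n : nrm (a ^+ n) = nrm a ^+ n.
Proof. by elim: n => [|n IH]; rewrite ?nrm1 // !exprS nrmM IH. Qed.

Lemma nrmV (a : C) : nrm (a^-1) = (nrm a)^-1.
Proof. by apply: complexI; rewrite fmorphV /= -!nrmE normfV. Qed.

Lemma nrm_real (r : R) : nrm (r%:C)%C = `|r|.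
Proof. by rewrite /nrm normc_def /= expr0n /= addr0 sqrtr_sqr. Qed.

Lemma nrmZ (Y : normedModType C) (a : C) (x : Y) :
  nrm (a *: x) = nrm a * nrm x.
Proof. by apply: complexI; rewrite rmorphM /= -!nrmE normrZ. Qed.

Lemma nrm_sum (V : normedZmodType C) I (r : seq I) (P : pred I) (F : I -> V) :
  nrm (\sum_(i <- r | P i) F i) <= \sum_(i <- r | P i) nrm (F i).
Proof.
elim/big_ind2 : _ => //; first by rewrite nrm0.
by move=> x1 x2 y1 y2 h1 h2; rewrite (le_trans (nrmD _ _)) ?lerD.
Qed.

Lemma posC (e : C) : 0 < e -> exists2 d : R, 0 < d & e = (d%:C)%C.
Proof.
move=> e0; have eE : ((complex.Re e)%:C)%C = e.
  by apply: RRe_real; rewrite gtr0_real.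
by exists (complex.Re e) => //; rewrite -ltcR eE.
Qed.

Lemma nbhs_nrm (Y : normedModType C) (x : Y) (A : set Y) :
  nbhs x A <-> exists2 e : R, 0 < e & forall y, nrm (x - y) < e -> A y.
Proof.
split=> [/nbhs_normP[e /= e0 eA]|[e e0 eA]].
  have [d d0 ed] := posC e0; exists d => // y yd.
  by apply: eA; rewrite /= ed nrmE ltcR.
apply/nbhs_normP; exists (e%:C)%C; first by rewrite /= ltcR.
by move=> y /=; rewrite nrmE ltcR => /eA.
Qed.

Lemma closure_nrm (Y : normedModType C) (A : set Y) (x : Y) :
  closure A x <-> forall e : R, 0 < e -> exists2 y, A y & nrm (x - y) < e.
Proof.
split=> [xA e e0|xA B /nbhs_nrm[e e0 eB]].
  have [|y [Ay yB]] := xA [set y | nrm (x - y) < e].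
    by apply/(nbhs_nrm x); exists e.
  by exists y.
by have [y Ay /eB yB] := xA _ e0; exists y.
Qed.

Lemma closed_nrm (Y : normedModType C) (A : set Y) :
  closed A <->
  forall x, (forall e : R, 0 < e -> exists2 y, A y & nrm (x - y) < e) -> A x.
Proof.
split=> [Acl x xA|h x /closure_nrm]; last exact: h.
by apply: Acl; apply/closure_nrm.
Qed.

Lemma continuousP_nrm (Y W : normedModType C) (f : {linear Y -> W}) :
  continuous f <-> exists2 M : R, 0 < M & forall x, nrm (f x) <= M * nrm x.
Proof.
split=> [fc|[M M0 fM]].
  have /linear_boundedP : bounded_near f (nbhs (0 : Y)).
    exact: (@linear_bounded_continuous _ _ _ f).2.
  move=> /pinfty_ex_gt0[e e0 eM]; have [M M0 eE] := posC e0.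
  exists M => // x; have := eM x.
  by rewrite eE !nrmE -rmorphM lecR.
move=> x; apply/(@cvgrPdist_lt _ _ _ (nbhs x)) => _/posC[e e0 ->].
apply/nbhs_nrm; exists (e / M); first by rewrite divr_gt0.
move=> y; rewrite ltr_pdivlMr // mulrC => yx.
by rewrite -linearB nrmE ltcR (le_lt_trans (fM _)).
Qed.

Lemma cvg_nrm (Y : normedModType C) (u : nat -> Y) (l : Y) :
  u @ \oo --> l <->
  forall e : R, 0 < e -> exists N, forall n, (N <= n)%N -> nrm (l - u n) < e.
Proof.
split=> [/cvgrPdist_lt ul e e0|ul].
  have := ul (e%:C)%C; rewrite ltcR => /(_ e0)[N _ Nu].
  by exists N => n /Nu /=; rewrite nrmE ltcR.
apply/cvgrPdist_lt => _/posC[e e0 ->].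
have [N Nu] := ul _ e0; exists N => // n /= /Nu.
by rewrite nrmE ltcR.
Qed.

Lemma geo_lt (M q e : R) : 0 <= q < 1 -> 0 < e -> 0 <= M ->
  exists n, M * q ^+ n < e.
Proof.
move=> /andP[q0 q1] e0 M0.
have : q ^+ n @[n --> \oo] --> (0 : R).
  by apply: cvg_expr; rewrite ger0_norm.
move=> /cvgrPdist_lt /(_ (e / (M + 1))) []; first by rewrite divr_gt0 ?ltr_wpDl.
move=> n _ /(_ n (leqnn n)) /=; rewrite sub0r normrN ger0_norm ?exprn_ge0 //.
rewrite ltr_pdivlMr ?ltr_wpDl // => h; exists n; apply: le_lt_trans h.
by rewrite mulrC ler_wpM2l ?exprn_ge0 // lerDl.
Qed.

Lemma geo2_lt (M e : R) : 0 < e -> 0 <= M -> exists n, M * 2^-1 ^+ n < e.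
Proof. by move=> e0 M0; apply: geo_lt => //; apply/andP; split; lra. Qed.

Lemma geo_dist (V : normedZmodType C) (u : nat -> V) (M : R) :
  (forall n, nrm (u n.+1 - u n) <= M * 2^-1 ^+ n) ->
  forall n m, nrm (u (n + m)%N - u n) <= 2 * M * 2^-1 ^+ n.
Proof.
move=> uM n m.
(* The extra factor comes from the exact partial geometric sum and lets the induction on [m]
   close. *)
suff : nrm (u (n + m)%N - u n) <= 2 * M * 2^-1 ^+ n * (1 - 2^-1 ^+ m).
  move=> /le_trans; apply; rewrite ler_piMr ?mulr_ge0 ?exprn_ge0 // ?lerBlDr ?lerDl ?exprn_ge0 //.
  have := uM 0%N; rewrite expr0 mulr1.
  by have := nrm_ge0 (u 1%N - u 0%N); lra.
elim: m => [|m IH]; first by rewrite addn0 subrr nrm0 expr0 subrr mulr0.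
rewrite addnS; apply: le_trans (nrm_dist (u (n + m)%N) _ _) _.
apply: le_trans (lerD (uM _) IH) _.
rewrite exprD [in leRHS]exprS; set a := _ ^+ n; set b := _ ^+ m; lra.
Qed.

Lemma geo_complete (Y : completeNormedModType C) (u : nat -> Y) (M : R) :
  (forall n, nrm (u n.+1 - u n) <= M * 2^-1 ^+ n) ->
  exists l, forall n, nrm (l - u n) <= 2 * M * 2^-1 ^+ n.
Proof.
move=> uM; have M0 : 0 <= M.
  by have := uM 0%N; rewrite expr0 mulr1; apply: le_trans; exact: nrm_ge0.
have um := geo_dist uM.
have : cvg (u @ \oo).
  apply: cauchy_cvg; apply/cauchy_ballP => _/posC[e e0 ->].
  have [||n ne] := @geo2_lt (4 * M) e => //; first by rewrite mulr_ge0.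
  exists ([set u k | k in [set k | (n <= k)%N]],
          [set u k | k in [set k | (n <= k)%N]]) => /=.
    by split; exists n => // k /= nk; exists k.
  move=> [_ _] /= [[i ni <-] [j nj <-]].
  rewrite -ball_normE /= nrmE ltcR.
  apply: le_lt_trans ne; apply: le_trans (nrm_dist (u n) _ _) _.
  have /(_ (i - n)%N) := um n; rewrite subnKC // => h1.
  have /(_ (j - n)%N) := um n; rewrite subnKC // nrmBC => h2.
  by move: h1 h2; set a := _ ^+ n; lra.
move=> /cvg_ex[l /cvg_nrm ul]; exists l => n.
apply/ler_addgt0Pr => e e0; have [N Nu] := ul _ e0.
have := Nu (n + N)%N (leq_addl _ _); have := um n N => h1 h2.
by apply: le_trans (nrm_dist (u (n + N)%N) _ _) _; lra.
Qed.

End RealNorm.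

(** * Open mapping theorem and preimages with controlled norm *)

Section OpenMapping.
Context {R : realType}.
Local Notation C := (R[i]).

Definition mklin (U V : lmodType C) (f : U -> V) (lf : linear f) :
  {linear U -> V} :=
  HB.pack f (GRing.isLinear.Build C U V *:%R f lf).

Lemma nrm_geo0 (V : normedZmodType C) (z : V) (M : R) :
  (forall n, nrm z <= M * 2^-1 ^+ n) -> z = 0.
Proof.
move=> zM; apply: nrm_eq0; apply/eqP; rewrite eq_le nrm_ge0 andbT.
have M0 : 0 <= M.
  by have := zM 0%N; rewrite expr0 mulr1; apply: le_trans; exact: nrm_ge0.
apply/ler_addgt0Pr => e e0; rewrite add0r.
by have [n /ltW/(le_trans (zM _))] := geo2_lt e0 M0.
Qed.

(* Successive approximation: solving [f x = y] up to an error of half the size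
   of [y], with control of [x], yields an exact solution. *)
Lemma approx_lift (D : completeNormedModType C) (Y : normedModType C)
    (f : {linear D -> Y}) (E : set Y) (c : R) :
  continuous f ->
  (forall y, E y -> exists x,
    [/\ E (y - f x), nrm x <= c * nrm y & nrm (y - f x) <= nrm y / 2]) ->
  forall y, E y -> exists2 x, f x = y & nrm x <= 2 * c * nrm y.
Proof.
move=> /continuousP_nrm[M M0 fM] h y Ey.
have /choice[g gP] : forall y, exists x, E y ->
    [/\ E (y - f x), nrm x <= c * nrm y & nrm (y - f x) <= nrm y / 2].
  move=> z; have [Ez|nEz] := pselect (E z); last by exists 0 => /nEz.
  by have [x xP] := h z Ez; exists x.
have [c0|c0] := leP 0 c; last first.
  have [E1 h1 h2] := gP _ Ey; have h3 := nrm_ge0 y; have h4 := nrm_ge0 (g y).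
  have y0 : y = 0 by apply: nrm_eq0; nra.
  by exists 0; rewrite ?linear0 ?y0 // !nrm0 mulr0.
pose r n := iter n (fun z => z - f (g z)) y.
have rE n : E (r n) by elim: n => [//|n IH]; have [] := gP _ IH.
have rn n : nrm (r n) <= nrm y * 2^-1 ^+ n.
  elim: n => [|n IH]; first by rewrite expr0 mulr1.
  have [_ _ h3] := gP _ (rE n); apply: le_trans h3 _.
  by rewrite exprSr mulrA ler_wpM2r.
pose u n := \sum_(k < n) g (r k).
have ur n : y - f (u n) = r n.
  elim: n => [|n IH]; first by rewrite /u big_ord0 linear0 subr0.
  by rewrite /u big_ord_recr /= linearD opprD addrA IH.
have [l lu] : exists l, forall n, nrm (l - u n) <= 2 * (c * nrm y) * 2^-1 ^+ n.
  apply: geo_complete => n; rewrite /u big_ord_recr /= addrAC subrr add0r.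
  have [_ h2 _] := gP _ (rE n); apply: le_trans h2 _.
  by rewrite -mulrA ler_wpM2l.
exists l; last by have := lu 0%N; rewrite /u big_ord0 subr0 expr0 mulr1 mulrA.
apply/eqP; rewrite -subr_eq0; apply/eqP.
apply: (@nrm_geo0 _ _ (M * (2 * (c * nrm y)) + nrm y)) => n.
have -> : f l - y = f (l - u n) - r n by rewrite -ur linearB opprB addrA subrK.
apply: le_trans (nrmB _ _) _; rewrite mulrDl lerD //.
by apply: le_trans (fM _) _; rewrite -mulrA ler_wpM2l // ltW.
Qed.

(** If [f x = y] with control, then [x] solves the perturbed equation up to the error [g x], of norm
    at most [c * d * nrm y] and hence at most half of [nrm y]; [approx_lift] then applies. This
    serves as a Neumann series argument for surjective operators. *)
Lemma perturb_lift (D : completeNormedModType C) (Y : normedModType C)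
    (f g : {linear D -> Y}) (c d : R) :
  continuous f -> continuous g -> 0 <= c -> 0 <= d -> c * d <= 2^-1 ->
  (forall y, exists2 x, f x = y & nrm x <= c * nrm y) ->
  (forall x, nrm (g x) <= d * nrm x) ->
  forall y, exists2 x, f x + g x = y & nrm x <= 2 * c * nrm y.
Proof.
move=> /continuousP_nrm[M M0 fM] /continuousP_nrm[N N0 gN] c0 d0 cd fc gd y.
have lh : linear (fun x => f x + g x).
  by move=> a u v; rewrite !linearP scalerDr addrACA.
apply: (@approx_lift D Y (mklin lh) setT) => //=.
  apply/(continuousP_nrm (mklin lh)); exists (M + N); first exact: addr_gt0.
  move=> x /=; rewrite mulrDl; apply: le_trans (nrmD _ _) _.
  by rewrite lerD.
move=> z _; have [x fx xz] := fc z; exists x; split => //.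
rewrite -fx opprD addrA subrr add0r nrmN fx.
apply: le_trans (gd _) _; rewrite -fx in xz *.
have h1 := nrm_ge0 x; have h2 := nrm_ge0 (f x); nra.
Qed.

(** Baire's argument by hand: the images of the balls of integer radius cover [Y]. If none were
    dense in a ball, one could choose shrinking balls, the [n]-th step avoiding the image of the
    ball of radius [n]; a preimage of the limit of their centres would then have no norm bound. *)
Lemma baire_image (D Y : completeNormedModType C) (f : {linear D -> Y}) :
  (forall y, exists x, f x = y) ->
  exists n : nat, exists y0, exists2 r : R, 0 < r &
  forall y, nrm (y0 - y) < r ->
    forall e : R, 0 < e -> exists2 x, nrm x <= n%:R & nrm (y - f x) < e.
Proof.
move=> fs; apply: contrapT => nex.
have step (p : nat * (Y * R)) : exists q : Y * R, 0 < p.2.2 ->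
    [/\ 0 < q.2, q.2 <= p.2.2 / 2, nrm (q.1 - p.2.1) <= p.2.2 &
     forall x, nrm x <= p.1%:R -> 2 * q.2 < nrm (q.1 - f x)].
  case: p => n [y0 r] /=; have [r0|] := ltP 0 r; last by exists (y0, r).
  apply: contrapT => nq; apply: nex; exists n, y0, r => // y yr e e0.
  apply: contrapT => nx; apply: nq.
  (* [r / 2] makes the radii sum to at most twice the first one; [e / 3] leaves the image farther
     away than twice the new radius. *)
  exists (y, Num.min (r / 2) (e / 3)) => _ /=; split => //.
  - by rewrite lt_min !divr_gt0.
  - by rewrite ge_min lexx.
  - by rewrite nrmBC ltW.
  - move=> x xn; apply: (@lt_le_trans _ _ e).
      have : Num.min (r / 2) (e / 3) <= e / 3 by rewrite ge_min lexx orbT.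
      lra.
    by rewrite leNgt; apply/negP => xe; apply: nx; exists x.
have /choice[F FP] := step.
pose fix s n := if n is k.+1 then F (k, s k) else (0 : Y, 1 : R).
have s0 n : 0 < (s n).2.
  elim: n => [|n IH] /=; first exact: ltr01.
  by have [] := FP (n, s n) IH.
have sP n : [/\ (s n.+1).2 <= (s n).2 / 2,
    nrm ((s n.+1).1 - (s n).1) <= (s n).2 &
    forall x, nrm x <= n%:R -> 2 * (s n.+1).2 < nrm ((s n.+1).1 - f x)].
  by have [] := FP (n, s n) (s0 n).
have sr n m : (s (n + m)%N).2 <= (s n).2 * 2^-1 ^+ m.
  elim: m => [|m IH]; first by rewrite addn0 expr0 mulr1.
  rewrite addnS exprSr mulrA; have [h _ _] := sP (n + m)%N.
  by apply: le_trans h _; rewrite ler_wpM2r.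
have [l lP] : exists l, forall n, nrm (l - (s n).1) <= 2 * 1 * 2^-1 ^+ n.
  apply: geo_complete => n; have [_ h _] := sP n; apply: le_trans h _.
  by have := sr 0%N n; rewrite add0n.
(* The centres still move by at most the sum of the remaining radii; the factor 2 is the margin kept
   in [step]. *)
have ls n : nrm (l - (s n).1) <= 2 * (s n).2.
  apply/ler_addgt0Pr => e e0.
  have [||m me] := @geo2_lt _ (2 * 2^-1 ^+ n) e => //.
  apply: le_trans (nrm_dist (s (n + m)%N).1 _ _) _.
  rewrite addrC lerD //.
    have := @geo_dist _ _ (fun k => (s (n + k)%N).1) (s n).2 _ 0%N m.
    rewrite expr0 mulr1 /= add0n addn0; apply => k.
    rewrite addnS; have [_ h _] := sP (n + k)%N; exact: le_trans h (sr _ _).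
  apply: le_trans (lP _) (ltW _); apply: le_lt_trans me.
  by rewrite exprD mulr1 mulrA.
have [x fx] := fs l.
have := archi_boundP (nrm_ge0 x); set n := Num.bound _ => xn.
have [_ _ /(_ x (ltW xn))] := sP n.
by rewrite fx nrmBC => /lt_le_trans/(_ (ls _)); rewrite ltxx.
Qed.

Theorem open_mapping (D Y : completeNormedModType C) (f : {linear D -> Y}) :
  continuous f -> (forall y, exists x, f x = y) ->
  exists2 c : R, 0 < c & forall y, exists2 x, f x = y & nrm x <= c * nrm y.
Proof.
move=> fc fs; have [n [y0 [r r0 rP]]] := baire_image fs.
(* Approximate preimages of [y0] and [y0 + t z], of norm at most [n], differ by an approximate
   preimage of [t z] of norm at most [2 * n], where [t * nrm z = r / 2]. This gives [4 * n / r], and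
   [n.+1] keeps it positive. Two errors below [r / 8] add up to half of [r / 2]. *)
pose c := 4 * n.+1%:R / r.
have c0 : 0 < c by rewrite divr_gt0 ?mulr_gt0.
exists (2 * c); first by rewrite mulr_gt0.
move=> y; apply: (@approx_lift D Y f setT c) => // z _.
have [->|z0] := eqVneq z 0.
  by exists 0; rewrite linear0 subr0 !nrm0 mul0r mulr0.
have nz := nrm_gt0 z0.
pose t := r / (2 * nrm z).
have t0 : 0 < t by rewrite divr_gt0 ?mulr_gt0.
have tz : t * nrm z = r / 2 by rewrite /t; field; rewrite gt_eqF.
have nt (V : normedModType C) (v : V) : nrm ((t%:C)%C *: v) = t * nrm v.
  by rewrite nrmZ nrm_real gtr0_norm.
have [||x1 x1n x1e] := rP y0 _ (r / 8).
- by rewrite subrr nrm0.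
- by rewrite divr_gt0.
have [||x2 x2n x2e] := rP (y0 + (t%:C)%C *: z) _ (r / 8).
- by rewrite opprD addrA subrr add0r nrmN nt; lra.
- by rewrite divr_gt0.
pose x := ((t^-1)%:C)%C *: (x2 - x1).
have tC : ((t%:C)%C : C) != 0 by rewrite gt_eqF // ltcR.
have xt : (t%:C)%C *: x = x2 - x1.
  by rewrite /x scalerA fmorphV mulfV ?scale1r.
have nx : t * nrm x <= 2 * n%:R.
  by rewrite -nt xt; apply: le_trans (nrmB _ _) _; lra.
have nzx : t * nrm (z - f x) <= r / 4.
  rewrite -nt scalerBr -linearZ /= xt linearB /=.
  have -> : (t%:C)%C *: z - (f x2 - f x1) =
      (y0 + (t%:C)%C *: z - f x2) - (y0 - f x1).
    by rewrite !opprB !addrA [RHS](ACl ((1*5)*2*4*3))/= subrr add0r.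
  by apply: le_trans (nrmB _ _) _; lra.
exists x; split => //.
  rewrite -(ler_pM2l t0); apply: le_trans nx _.
  have -> : t * (c * nrm z) = 2 * n.+1%:R.
    rewrite mulrCA tz /c; field; by rewrite gt_eqF.
  by rewrite ler_pM2l // ler_nat.
rewrite -(ler_pM2l t0); apply: le_trans nzx _.
by rewrite mulrA tz; lra.
Qed.

Lemma range_closed_lift (D : completeNormedModType C) (Y : normedModType C)
    (f : {linear D -> Y}) (c : R) :
  continuous f ->
  (forall x, exists2 x', f x' = f x & nrm x' <= c * nrm (f x)) ->
  closed (range f).
Proof.
move=> fc fl; apply/closed_nrm => y yE.
suff [x <-] : exists x, f x = y by exists x.
(* [E] is the closure of the range: it is stable under subtraction of values of [f], and a nonzero
   point of it is within half its norm of a value of [f]. *)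
pose E := [set y | forall e : R, 0 < e -> exists2 z, range f z & nrm (y - z) < e].
have [|x fx _] := @approx_lift D Y f E (2 * `|c|) fc _ y yE; last by exists x.
move=> z Ez; have [z0|z0] := eqVneq z 0.
  by rewrite z0 in Ez *; exists 0; rewrite linear0 subr0 !nrm0 mul0r mulr0.
have [|_ [x0 _ <-] z1] := Ez (nrm z / 2); first by rewrite divr_gt0 // nrm_gt0.
have [x fx xc] := fl x0; exists x; rewrite fx; split; last exact: ltW.
  move=> e e0; have [_ [u _ <-] ue] := Ez e e0.
  exists (f (u - x0)); first by exists (u - x0).
  by rewrite linearB opprB addrA subrK.
apply: le_trans xc _.
have h : nrm (f x0) <= 2 * nrm z.
  have -> : f x0 = z - (z - f x0) by rewrite opprB addrC subrK.
  by apply: le_trans (nrmB _ _) _; have := nrm_ge0 z; lra.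
apply: (@le_trans _ _ (`|c| * nrm (f x0))).
  by rewrite ler_wpM2r ?nrm_ge0 // ler_norm.
by rewrite [2 * _]mulrC -mulrA ler_wpM2l.
Qed.

Definition range_cs (D Y : normedModType C) (f : {linear D -> Y})
  (fcl : closed (range f)) : closed_subspace Y.
Proof.
apply: (@ClosedSubspace _ Y (range f) _ _ fcl).
- by exists 0; rewrite ?linear0.
- by move=> a _ _ [x _ <-] [y _ <-]; exists (a *: x + y); rewrite ?linearP.
Defined.

Definition corestr (D Y : normedModType C) (M : closed_subspace Y)
    (f : D -> Y) (fM : forall x, cs_set M (f x)) (x : D) : cs_type M :=
  CsType (mem_set (fM x)).

Lemma corestr_linear (D Y : normedModType C) (M : closed_subspace Y)
    (f : {linear D -> Y}) (fM : forall x, cs_set M (f x)) : linear (corestr fM).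
Proof. by move=> a x y; apply: val_inj; rewrite /= linearP. Qed.

Lemma nrm_cs (Y : normedModType C) (M : closed_subspace Y) (x : cs_type M) :
  nrm x = nrm (cs_val x).
Proof. by []. Qed.

(** The open mapping theorem for [f] as a map onto its range, which is complete. Closedness of a
    range is mostly used below in this form. *)
Lemma closed_range_lift (D Y : completeNormedModType C) (f : {linear D -> Y}) :
  continuous f -> closed (range f) ->
  exists2 c : R, 0 < c &
    forall x, exists2 x', f x' = f x & nrm x' <= c * nrm (f x).
Proof.
move=> fc fcl; pose M := range_cs fcl.
have fM x : cs_set M (f x) by exists x.
have [||c c0 cP] := @open_mapping D (cs_type M) (mklin (corestr_linear fM)).
- have [K K0 fK] := (continuousP_nrm f).1 fc.
  by apply/continuousP_nrm; exists K => // x; rewrite nrm_cs; exact: fK.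
- move=> [y My]; have [x _ fx] := set_mem My; exists x.
  by apply: val_inj.
exists c => // x; have [x' fx' x'c] := cP (corestr fM x).
by exists x' => //; have := congr1 (@cs_val _ _ _) fx'.
Qed.

End OpenMapping.

(** * Hahn-Banach theorem for complex spaces *)

Section HahnBanach.
Context {R : realType}.
Local Notation C := (R[i]).

(* A partial real-linear functional dominated by [M * nrm], encoded by its
   graph; it is allowed to be empty so that Zorn's lemma applies. *)
Definition dominated_graph (Y : normedModType C) (M : R) (G0 G : set (Y * R)) :=
  [/\ forall (a : R) p q, G p -> G q ->
        G (p.1 + (a%:C)%C *: q.1, p.2 + a * q.2),
      forall p, G p -> p.2 <= M * nrm p.1 & G !=set0 -> G0 `<=` G].

(** The value at [y0] has to lie between all [p.2 - M * nrm (p.1 - y0)] and all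
    [M * nrm (q.1 + y0) - q.2]. The former are below the latter by domination at [p.1 + q.1], so
    their supremum [al] will do. *)
Lemma dominated_graph_extend (Y : normedModType C) (M : R) (G0 G : set (Y * R))
    (y0 : Y) : 0 <= M -> G !=set0 -> dominated_graph M G0 G ->
  exists2 G', dominated_graph M G0 G' & G `<=` G' /\ exists r, G' (y0, r).
Proof.
move=> M0 Gn [Gl Gd GG0].
have G00 : G (0, 0).
  have [p Gp] := Gn; have := Gl (-1) p p Gp Gp.
  by rewrite rmorphN1 scaleN1r subrr mulN1r subrr.
have GZ a p : G p -> G ((a%:C)%C *: p.1, a * p.2).
  by move=> Gp; have := Gl a _ _ G00 Gp; rewrite /= !add0r.
have nrmRZ (a : R) (y : Y) : 0 <= a -> nrm ((a%:C)%C *: y) = a * nrm y.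
  by move=> a0; rewrite nrmZ nrm_real ger0_norm.
have key p q : G p -> G q -> p.2 - M * nrm (p.1 - y0) <= M * nrm (q.1 + y0) - q.2.
  move=> Gp Gq; have := Gd _ (Gl 1 _ _ Gp Gq).
  rewrite /= rmorph1 scale1r mul1r => h.
  have : M * nrm (p.1 + q.1) <= M * (nrm (p.1 - y0) + nrm (q.1 + y0)).
    rewrite ler_wpM2l // (le_trans _ (nrmD _ _)) //.
    by rewrite addrACA addNr addr0.
  rewrite mulrDr; lra.
pose S := [set p.2 - M * nrm (p.1 - y0) | p in G].
have Sub q : G q -> ubound S (M * nrm (q.1 + y0) - q.2).
  by move=> Gq _ [p Gp <-]; exact: key.
have hS : has_sup S.
  split; first by exists (0 - M * nrm (0 - y0)); exists (0, 0).
  by exists (M * nrm (0 + y0) - 0); exact: (Sub _ G00).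
pose al := sup S.
have al1 p : G p -> p.2 - al <= M * nrm (p.1 - y0).
  move=> Gp; rewrite lerBlDr -lerBlDl; apply: ub_le_sup; first exact: hS.2.
  by exists p.
have al2 p : G p -> p.2 + al <= M * nrm (p.1 + y0).
  by move=> Gp; rewrite -lerBrDl; apply: ge_sup; [exact: hS.1|exact: Sub].
exists [set q | exists p, exists a : R, G p /\
          q = (p.1 + (a%:C)%C *: y0, p.2 + a * al)]; last first.
  split.
    move=> [y r] Gp; exists (y, r), 0; split => //.
    by rewrite /= rmorph0 scale0r mul0r !addr0.
  exists al, (0, 0), 1; split => //.
  by rewrite /= rmorph1 scale1r mul1r !add0r.
split.
- move=> a _ _ [p [b [Gp ->]]] [q [c [Gq ->]]] /=.
  exists (p.1 + (a%:C)%C *: q.1, p.2 + a * q.2), (b + a * c); split => /=.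
    exact: Gl.
  congr pair; last by ring.
  by rewrite rmorphD rmorphM /= scalerDl scalerDr scalerA addrACA.
- move=> _ [p [a [Gp ->]]] /=.
  have [a0|a0|->] := ltgtP a 0.
  + have /al1 /= := GZ (- a^-1) _ Gp.
    have an : 0 < - a by rewrite oppr_gt0.
    rewrite -(ler_pM2l an) mulrCA -(nrmRZ (- a)) ?(ltW an) //.
    rewrite scalerBr scalerA -rmorphM mulrNN mulfV ?lt_eqF // rmorph1 scale1r.
    by rewrite rmorphN scaleNr opprK mulrBr mulrA mulrNN mulfV ?lt_eqF // mul1r
      mulNr opprK.
  + have /al2 /= := GZ (a^-1) _ Gp.
    rewrite -(ler_pM2l a0) mulrCA -(nrmRZ a) ?(ltW a0) //.
    rewrite scalerDr scalerA -rmorphM mulfV ?gt_eqF // rmorph1 scale1r.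
    by rewrite mulrDr mulrA mulfV ?gt_eqF // mul1r.
  + by rewrite rmorph0 scale0r mul0r !addr0; exact: Gd.
- move=> _ p /(GG0 Gn) Gp; exists p, 0; split => //.
  by rewrite rmorph0 scale0r mul0r !addr0; case: p Gp.
Qed.

Lemma dominated_graph_total (Y : normedModType C) (M : R) (G0 : set (Y * R)) :
  0 <= M ->
  G0 !=set0 -> dominated_graph M G0 G0 ->
  exists2 u : Y -> R, (forall p, G0 p -> u p.1 = p.2) &
    (forall (a : R) y z, u (y + (a%:C)%C *: z) = u y + a * u z) /\
    (forall y, u y <= M * nrm y).
Proof.
move=> M0 G0n G0d.
have [|A [[Al Ad AG0] Amax]] := @Zorn_bigcup _ (dominated_graph M G0).
  move=> F FP Ftot; split.
  - move=> a p q [X FX Xp] [Z FZ Zq].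
    have [XZ|ZX] := Ftot X Z FX FZ.
      by exists Z => //; have [+ _ _] := FP _ FZ; apply => //; exact: XZ.
    by exists X => //; have [+ _ _] := FP _ FX; apply => //; exact: ZX.
  - by move=> p [X FX Xp]; have [_ + _] := FP _ FX; apply.
  - move=> [p [X FX Xp]] q G0q; exists X => //.
    by have [_ _] := FP _ FX; apply => //; exists p.
have An : A !=set0.
  apply: contrapT => An; apply: (Amax G0) => //; split.
    by move=> p Ap; exfalso; apply: An; exists p.
  by move=> /(_ _ _); have [p G0p] := G0n => /(_ p G0p) Ap; apply: An; exists p.
have At y : exists r, A (y, r).
  have [G' G'd [AG' [r G'r]]] := dominated_graph_extend y M0 An (And3 Al Ad AG0).
  exists r; apply: contrapT => nA; apply: (Amax G') => //; split => //.
  by move=> /(_ _ G'r).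
(* Two values at [y] differ by a value at 0, which domination bounds by 0 in both directions. *)
have Af y r s : A (y, r) -> A (y, s) -> r = s.
  move=> Ar As; apply: le_anti.
  have := Ad _ (Al (-1) _ _ Ar As); have := Ad _ (Al (-1) _ _ As Ar).
  by rewrite /= rmorphN1 scaleN1r subrr nrm0 mulr0 !mulN1r !subr_le0 => -> ->.
have /choice[u uP] := At.
exists u; first by case=> y r G0p; apply: Af (uP y) _; exact: AG0.
split=> [a y z|y]; last exact: (Ad _ (uP y)).
by apply: Af (uP _) _; exact: (Al a _ _ (uP y) (uP z)).
Qed.

Theorem hahn_banach (Y : normedModType C) (V : closed_subspace Y) (x : Y) :
  ~ cs_set V x -> exists f : {linear Y -> C},
    [/\ continuous f, f x = 1 & forall v, cs_set V v -> f v = 0].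
Proof.
move=> Vx; have Vlin := @cs_lin _ _ V; have V0 := @cs_zero _ _ V.
have [d d0 dV] : exists2 d : R, 0 < d & forall v, cs_set V v -> d <= nrm (x - v).
  apply: contrapT => nd; apply: Vx; apply: (closed_nrm V).1; first exact: cs_closed.
  move=> e e0; apply: contrapT => ne; apply: nd; exists e => // v Vv.
  by rewrite leNgt; apply/negP => xv; apply: ne; exists v.
(* The graph of [v + r x -> r] on the sum of [V] and the real line through [x]. It is dominated by
   [nrm / d] because [d] bounds the distance from [x] to [V] from below. *)
pose G0 := [set p : Y * R | cs_set V (p.1 - (p.2%:C)%C *: x)].
have VZ a v : cs_set V v -> cs_set V (a *: v).
  by move=> Vv; have := Vlin a _ _ Vv V0; rewrite addr0.
have [|||u uG0 [ul ud]] := @dominated_graph_total Y d^-1 G0.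
- by rewrite invr_ge0 ltW.
- by exists (0, 0); rewrite /G0 /= rmorph0 scale0r subr0.
- split; last by move=> _ ?.
    move=> a p q Gp Gq; have := Vlin (a%:C)%C _ _ Gq Gp.
    rewrite /G0 /= scalerBr scalerA rmorphD rmorphM /= scalerDl opprD.
    by rewrite addrC addrACA.
  move=> [y r] Gp; rewrite /= mulrC ler_pdivlMr //.
  have [->|r0] := eqVneq r 0; first by rewrite mul0r nrm_ge0.
  have rC : ((r%:C)%C : C) != 0 by rewrite fmorph_eq0.
  have /dV h := VZ (- (r%:C)%C^-1) _ Gp.
  apply: (@le_trans _ _ (`|r| * d)); first by rewrite ler_wpM2r ?ler_norm ?ltW.
  apply: (@le_trans _ _ (`|r| * nrm (x - - (r%:C)%C^-1 *: (y - (r%:C)%C *: x)))).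
    by rewrite ler_wpM2l.
  rewrite -nrm_real -nrmZ scaleNr opprK scalerDr scalerA mulfV // scale1r.
  by rewrite addrC subrK.
have u0 : u 0 = 0 by apply: (uG0 (0, 0)); rewrite /G0 /= rmorph0 scale0r subr0.
have uD y z : u (y + z) = u y + u z.
  by have := ul 1 y z; rewrite rmorph1 scale1r mul1r.
have uZ a y : u ((a%:C)%C *: y) = a * u y.
  by have := ul a 0 y; rewrite !add0r u0 add0r.
have uV v : cs_set V v -> u v = 0.
  by move=> Vv; apply: (uG0 (v, 0)); rewrite /G0 /= rmorph0 scale0r subr0.
have ux : u x = 1.
  by apply: (uG0 (x, 1)); rewrite /G0 /= rmorph1 scale1r subrr.
have un y : `|u y| <= d^-1 * nrm y.
  rewrite ler_norml ud andbT; have := ud ((-1)%:C%C *: y).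
  by rewrite uZ nrmZ nrm_real normrN1 mul1r mulN1r; lra.
(* The usual complexification of a real functional. Its value at [x] has real part 1, hence is
   nonzero, and dividing by it normalises [f0]. *)
pose f0 y : C := (u y -i* u ('i%C *: y))%C.
have f0l : linear f0.
  move=> [a b] y z; rewrite /f0 uD scalerDr uD.
  have -> : (a +i* b)%C *: y = (a%:C)%C *: y + (b%:C)%C *: ('i%C *: y).
    by rewrite scalerA -scalerDl; congr (_ *: _); apply/eqP; rewrite eq_complex /=;
      apply/andP; split; apply/eqP; ring.
  have -> : 'i%C *: ((a%:C)%C *: y + (b%:C)%C *: ('i%C *: y)) =
      (a%:C)%C *: ('i%C *: y) + ((- b)%:C)%C *: y.
    rewrite scalerDr !scalerA [_ * (a%:C)%C]mulrC; congr (_ + _ *: _).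
    by apply/eqP; rewrite eq_complex /=; apply/andP; split; apply/eqP; ring.
  rewrite !uD !uZ; apply/eqP; rewrite eq_complex /=.
  by apply/andP; split; apply/eqP; ring.
have f0c : continuous (mklin f0l).
  apply/continuousP_nrm; exists (2 * d^-1); first by rewrite mulr_gt0 ?invr_gt0.
  move=> y /=; have -> : f0 y = ((u y)%:C)%C - 'i%C * ((u ('i%C *: y))%:C)%C.
    by apply/eqP; rewrite eq_complex /=; apply/andP; split; apply/eqP; ring.
  apply: le_trans (nrmB _ _) _; rewrite nrmM !nrm_real.
  have ni : nrm ('i%C : C) = 1.
    by rewrite /nrm normc_def /= expr0n expr1n add0r sqrtr1.
  have := un y; have := un ('i%C *: y); rewrite nrmZ ni !mul1r; lra.
have fx : f0 x != 0 by rewrite eq_complex /= ux oner_eq0.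
have f1l : linear (fun y => (f0 x)^-1 * f0 y).
  by move=> a y z; rewrite f0l mulrDr; congr (_ + _); rewrite /GRing.scale /= mulrCA.
exists (mklin f1l); split => /=.
- move=> y; apply: (@continuousM _ _ (fun=> (f0 x)^-1) f0 y); first exact: cvg_cst.
  exact: f0c.
- by rewrite mulVf.
- move=> v Vv; have -> : f0 v = 0.
    by apply/eqP; rewrite eq_complex /= !uV ?oppr0 ?eqxx //; exact: VZ.
  by rewrite mulr0.
Qed.

End HahnBanach.

(** * Ranks modulo a subspace and biorthogonal functionals *)

Section Rank.
Context {R : realType}.
Local Notation C := (R[i]).

Definition subsp (Y : lmodType C) (V : set Y) :=
  V 0 /\ forall (a : C) x y, V x -> V y -> V (a *: x + y).

Lemma subspZ (Y : lmodType C) (V : set Y) a x : subsp V -> V x -> V (a *: x).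
Proof. by move=> [V0 Vl] Vx; have := Vl a x 0 Vx V0; rewrite addr0. Qed.

Lemma subspD (Y : lmodType C) (V : set Y) x y :
  subsp V -> V x -> V y -> V (x + y).
Proof. by move=> [V0 Vl] Vx Vy; have := Vl 1 x y Vx Vy; rewrite scale1r. Qed.

Lemma subspB (Y : lmodType C) (V : set Y) x y :
  subsp V -> V x -> V y -> V (x - y).
Proof.
by move=> sV Vx Vy; apply: subspD => //; rewrite -scaleN1r; exact: subspZ.
Qed.

Lemma subsp_sum (Y : lmodType C) (V : set Y) I (r : seq I) (P : pred I)
  (F : I -> Y) : subsp V -> (forall i, P i -> V (F i)) ->
  V (\sum_(i <- r | P i) F i).
Proof.
move=> sV VF; apply: big_ind => //; first by case: sV.
by move=> x y; exact: subspD.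
Qed.

Lemma subsp0 (Y : lmodType C) : subsp [set (0 : Y)].
Proof. by split=> [//|a _ _ -> ->]; rewrite scaler0 addr0. Qed.

Lemma subsp_cs (Y : normedModType C) (M : closed_subspace Y) :
  subsp (cs_set M).
Proof. by split; [exact: cs_zero|exact: cs_lin]. Qed.

Lemma subsp_ker (Y W : lmodType C) (f : {linear Y -> W}) :
  subsp [set x | f x = 0].
Proof.
by split=> [|a x y /= fx fy]; rewrite /= ?linear0 // linearP fx fy scaler0 addr0.
Qed.

Lemma subsp_range (Y W : lmodType C) (f : {linear Y -> W}) : subsp (range f).
Proof.
split=> [|a _ _ [x _ <-] [y _ <-]]; first by exists 0; rewrite ?linear0.
by exists (a *: x + y); rewrite ?linearP.
Qed.

Definition indep_mod (Y : lmodType C) n (x : 'I_n -> Y) (V0 : set Y) :=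
  forall c : 'I_n -> C, V0 (\sum_i c i *: x i) -> forall i, c i = 0.

Definition rk_ge (Y : lmodType C) (V V0 : set Y) (n : nat) : Prop :=
  exists2 x : 'I_n -> Y, (forall i, V (x i)) & indep_mod x V0.

(** Nullity is the case [V0 = [set 0]] and codimension the case [V = setT], so that both share one
    theory. *)
Definition erk (Y : lmodType C) (V V0 : set Y) : \bar R :=
  ereal_sup [set n%:R%:E | n in [set n : nat | rk_ge V V0 n]].

Lemma edimE (Y : completeNormedModType C) (V : set Y) :
  edim V = erk V [set 0].
Proof.
congr ereal_sup; apply/seteqP; split=> r [n /=].
  by move=> [x [Vx xi]] <-; exists n => //; exists x.
by move=> [x Vx xi] <-; exists n => //; exists x.
Qed.

Lemma ecodimE (Y : completeNormedModType C) (V : set Y) :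
  ecodim V = erk setT V.
Proof.
congr ereal_sup; apply/seteqP; split=> r [n /=].
  by move=> [x xi] <-; exists n => //; exists x.
by move=> [x _ xi] <-; exists n => //; exists x.
Qed.

Lemma rk_ge0 (Y : lmodType C) (V V0 : set Y) : rk_ge V V0 0.
Proof. by exists (fun=> 0) => [[]|c _ []]. Qed.

Lemma indep_mod_lift (Y : lmodType C) (V0 : set Y) n (x : 'I_n.+1 -> Y) :
  indep_mod x V0 -> indep_mod (fun i => x (lift ord0 i)) V0.
Proof.
move=> xi c Vc i; have := xi (fun i => if unlift ord0 i is Some j then c j else 0).
rewrite big_ord_recl unlift_none scale0r add0r.
under eq_bigr do rewrite liftK.
by move=> /(_ Vc (lift ord0 i)); rewrite liftK.
Qed.

Lemma rk_ge_leq (Y : lmodType C) (V V0 : set Y) m n :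
  (m <= n)%N -> rk_ge V V0 n -> rk_ge V V0 m.
Proof.
elim: n => [|n IH]; first by rewrite leqn0 => /eqP ->.
rewrite leq_eqVlt => /predU1P[-> //|/IH h [x Vx xi]]; apply: h.
by exists (fun i => x (lift ord0 i)) => //; exact: indep_mod_lift.
Qed.

Lemma erk_geP (Y : lmodType C) (V V0 : set Y) n :
  (n%:R%:E <= erk V V0)%E <-> rk_ge V V0 n.
Proof.
split=> [|Vn]; last by apply: ereal_sup_ubound; exists n.
case: n => [|n] h; first by move=> *; exact: rk_ge0.
apply: contrapT => nV; move: h; apply/negP; rewrite -ltNge.
apply: (@le_lt_trans _ _ n%:R%:E); last by rewrite lte_fin ltr_nat.
apply: ge_ereal_sup => _ [m /= Vm <-]; rewrite lee_fin ler_nat leqNgt.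
by apply/negP => nm; apply: nV; exact: rk_ge_leq Vm.
Qed.

Lemma erk_ge0 (Y : lmodType C) (V V0 : set Y) : (0 <= erk V V0)%E.
Proof. exact/(erk_geP V V0 0)/rk_ge0. Qed.

Lemma erk_finP (Y : lmodType C) (V V0 : set Y) n :
  erk V V0 = n%:R%:E <-> rk_ge V V0 n /\ ~ rk_ge V V0 n.+1.
Proof.
split=> [VE|[/erk_geP h1 h2]].
  by split; rewrite -erk_geP VE // lee_fin ler_nat ltnn.
apply: le_anti; rewrite h1 andbT.
apply: ge_ereal_sup => _ [m /= Vm <-]; rewrite lee_fin ler_nat leqNgt.
by apply/negP => nm; apply: h2; exact: rk_ge_leq Vm.
Qed.

Lemma erk_lty (Y : lmodType C) (V V0 : set Y) :
  (erk V V0 < +oo)%E -> exists n : nat, erk V V0 = n%:R%:E.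
Proof.
move=> Vy; have [n nV] : exists n, ~ rk_ge V V0 n.
  apply: contrapT => /forallNP h; move: Vy; apply/negP; rewrite -leNgt leye_eq.
  apply/eqP/eqyP => r r0.
  apply: (@le_trans _ _ (Num.bound r)%:R%:E); last by apply/erk_geP; exact: contrapT (h _).
  by rewrite lee_fin ltW // archi_boundP // ltW.
elim: n nV => [/(_ (rk_ge0 _ _)) //|n IH nV].
have [Vn|/IH //] := pselect (rk_ge V V0 n).
by exists n; apply/erk_finP.
Qed.

Lemma le_erk (Y W : lmodType C) (V V0 : set Y) (U U0 : set W) :
  (forall n, rk_ge V V0 n -> rk_ge U U0 n) -> (erk V V0 <= erk U U0)%E.
Proof. by move=> h; apply: ge_ereal_sup => _ [n /h/erk_geP nU <-]. Qed.

Lemma rk_ge_map (Y W : lmodType C) (f : {linear Y -> W}) (V V0 : set Y)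
    (U U0 : set W) n :
  (forall x, V x -> U (f x)) -> (forall x, U0 (f x) -> V0 x) ->
  rk_ge V V0 n -> rk_ge U U0 n.
Proof.
move=> fV f0 [x Vx xi]; exists (f \o x) => [i|c Uc]; first exact/fV/Vx.
apply: xi; apply: f0; rewrite linear_sum; move: Uc; congr U0.
by apply: eq_bigr => i _; rewrite linearZ.
Qed.

Lemma left_null n (B : 'M[C]_(n.+1, n)) :
  exists2 d : 'rV[C]_n.+1, d != 0 & d *m B = 0.
Proof.
have : kermx B != 0.
  rewrite kermx_eq0 /row_free; apply/eqP => h.
  by have := rank_leq_col B; rewrite h ltnn.
by move=> /rowV0Pn[d /sub_kermxP dB d0]; exists d.
Qed.

(** The matrix of coefficients of [n.+1] vectors over [n] generators has a nonzero left null vector,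
    which is a relation modulo [V0]. *)
Lemma span_rk (Y : lmodType C) (V V0 : set Y) n (y : 'I_n -> Y) :
  subsp V0 -> (forall v, V v -> exists c, V0 (v - \sum_i c i *: y i)) ->
  ~ rk_ge V V0 n.+1.
Proof.
move=> sV0 yV [x Vx xi].
have /choice[A AP] : forall j, exists c : 'I_n -> C, V0 (x j - \sum_i c i *: y i).
  by move=> j; exact: yV.
pose B : 'M[C]_(n.+1, n) := \matrix_(j, i) A j i.
have [d d0 dB] := left_null B.
move: d0; apply/negP; rewrite negbK; apply/eqP/rowP => j; rewrite mxE.
apply: (xi (fun j => d 0 j)).
have -> : \sum_j d 0 j *: x j =
    \sum_j d 0 j *: (x j - \sum_i A j i *: y i) +
    \sum_i (d *m B) 0 i *: y i.
  under [X in _ + X]eq_bigr do rewrite mxE scaler_suml.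
  rewrite exchange_big -big_split /=; apply: eq_bigr => k _.
  rewrite scalerBr scaler_sumr -addrA -[LHS]addr0; congr (_ + _).
  rewrite addrC -sumrB big1 // => i _.
  by rewrite mxE scalerA subrr.
rewrite dB [X in _ + X]big1 ?addr0; last by move=> i _; rewrite mxE scale0r.
by apply: subsp_sum => // k _; exact: subspZ.
Qed.

Lemma rk_span (Y : lmodType C) (V V0 : set Y) n (x : 'I_n -> Y) :
  subsp V0 -> (forall i, V (x i)) -> indep_mod x V0 -> ~ rk_ge V V0 n.+1 ->
  forall v, V v -> exists c, V0 (v - \sum_i c i *: x i).
Proof.
move=> sV0 Vx xi nV v Vv; apply: contrapT => nc; apply: nV.
exists (fun i : 'I_n.+1 => if unlift ord0 i is Some j then x j else v).
  by move=> i; case: unliftP.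
move=> c; rewrite big_ord_recl unlift_none.
under eq_bigr do rewrite liftK.
have [c0|c0] := eqVneq (c ord0) 0.
  rewrite c0 scale0r add0r => /xi h i.
  by case: (unliftP ord0 i) => [j ->|->]; [exact: h|].
move=> h; exfalso; apply: nc; exists (fun i => - (c ord0)^-1 * c (lift ord0 i)).
have := subspZ (c ord0)^-1 sV0 h; rewrite scalerDr scalerA mulVf // scale1r.
congr V0; congr (_ + _); rewrite scaler_sumr -sumrN; apply: eq_bigr => i _.
by rewrite scalerA mulNr scaleNr opprK.
Qed.

Lemma rk_basis (Y : lmodType C) (V V0 : set Y) n :
  subsp V0 -> ~ rk_ge V V0 n.+1 -> exists2 k, (k <= n)%N &
    exists x : 'I_k -> Y, [/\ forall i, V (x i), indep_mod x V0 &
      forall v, V v -> exists c, V0 (v - \sum_i c i *: x i)].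
Proof.
move=> sV0; elim: n => [|n IH] nV.
  have [x Vx xi] := rk_ge0 V V0.
  by exists 0%N => //; exists x; split=> //; exact: rk_span nV.
have [[x Vx xi]|/IH[k kn xP]] := pselect (rk_ge V V0 n.+1); last first.
  by exists k => //; exact: leqW.
by exists n.+1 => //; exists x; split => //; exact: rk_span nV.
Qed.

Definition cat_ord (T : Type) n m (x : 'I_n -> T) (y : 'I_m -> T)
    (i : 'I_(n + m)) : T :=
  match fintype.split i with inl j => x j | inr k => y k end.

Lemma cat_ordl (T : Type) n m (x : 'I_n -> T) (y : 'I_m -> T) i :
  cat_ord x y (lshift m i) = x i.
Proof. by rewrite /cat_ord (unsplitK (inl i)). Qed.

Lemma cat_ordr (T : Type) n m (x : 'I_n -> T) (y : 'I_m -> T) i :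
  cat_ord x y (rshift n i) = y i.
Proof. by rewrite /cat_ord (unsplitK (inr i)). Qed.

Lemma sum_cat_ord (Y W : lmodType C) n m (c : 'I_(n + m) -> C)
    (x : 'I_n -> Y) (y : 'I_m -> W) :
  \sum_i c i *: cat_ord (fun j => (x j, 0)) (fun k => (0, y k)) i =
  (\sum_j c (lshift m j) *: x j, \sum_k c (rshift n k) *: y k) :> (Y * W)%type.
Proof.
rewrite [LHS]surjective_pairing; congr pair.
  rewrite (linear_sum fst) big_split_ord /= [X in _ + X]big1 ?addr0; last first.
    by move=> i _; rewrite cat_ordr /= scaler0.
  by apply: eq_bigr => i _; rewrite cat_ordl.
rewrite (linear_sum snd) big_split_ord /= [X in X + _]big1 ?add0r; last first.
  by move=> i _; rewrite cat_ordl /= scaler0.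
by apply: eq_bigr => i _; rewrite cat_ordr.
Qed.

Lemma rk_ge_prod (Y W : lmodType C) (V V0 : set Y) (U U0 : set W) n m :
  rk_ge V V0 n -> rk_ge U U0 m -> subsp V -> subsp U ->
  rk_ge (V `*` U) (V0 `*` U0) (n + m).
Proof.
move=> [x Vx xi] [y Uy yi] sV sU.
exists (cat_ord (fun j => (x j, 0)) (fun k => (0, y k))).
  by move=> i; rewrite /cat_ord; case: fintype.split => j; split => //=;
    [case: sU|case: sV].
move=> c; rewrite sum_cat_ord => -[/= /xi cx /yi cy] i.
by rewrite -(splitK i); case: (fintype.split i) => j /=; [exact: cx|exact: cy].
Qed.

Lemma rk_lt_prod (Y W : lmodType C) (V V0 : set Y) (U U0 : set W) n m :
  subsp V0 -> subsp U0 -> ~ rk_ge V V0 n.+1 -> ~ rk_ge U U0 m.+1 ->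
  ~ rk_ge (V `*` U) (V0 `*` U0) (n + m).+1.
Proof.
move=> sV0 sU0 /(rk_basis sV0)[k kn [x [Vx _ xV]]].
move=> /(rk_basis sU0)[l lm [y [Uy _ yU]]] h.
have {h} : rk_ge (V `*` U) (V0 `*` U0) (k + l).+1.
  by apply: rk_ge_leq h; rewrite ltnS leq_add.
apply: (@span_rk _ _ _ (k + l)
  (cat_ord (fun j => (x j, 0)) (fun k => (0, y k)))).
  split=> [|a p q [p1 p2] [q1 q2]]; first by split => /=; [case: sV0|case: sU0].
  by split => /=; [exact: sV0.2|exact: sU0.2].
move=> [v u] [/= /xV[c cV] /yU[d dU]].
exists (cat_ord c d); rewrite sum_cat_ord; split => /=.
  by under eq_bigr do rewrite cat_ordl.
by under eq_bigr do rewrite cat_ordr.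
Qed.

Lemma erk_prod (Y W : lmodType C) (V V0 : set Y) (U U0 : set W) :
  subsp V -> subsp V0 -> subsp U -> subsp U0 ->
  erk (V `*` U) (V0 `*` U0) = (erk V V0 + erk U U0)%E.
Proof.
move=> sV sV0 sU sU0.
have [Vy|] := ltP (erk V V0) +oo%E; last first.
  rewrite leye_eq => /eqP Vy; rewrite Vy addye; last first.
    by rewrite gt_eqF // (lt_le_trans _ (erk_ge0 _ _)) ?ltNy0.
  apply/eqP; rewrite -leye_eq -Vy; apply: le_erk => n Vn.
  by rewrite -(addn0 n); apply: rk_ge_prod => //; exact: rk_ge0.
have [Uy|] := ltP (erk U U0) +oo%E; last first.
  rewrite leye_eq => /eqP Uy; rewrite Uy addey; last first.
    by rewrite gt_eqF // (lt_le_trans _ (erk_ge0 _ _)) ?ltNy0.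
  apply/eqP; rewrite -leye_eq -Uy; apply: le_erk => n Un.
  by rewrite -(add0n n); apply: rk_ge_prod => //; exact: rk_ge0.
have [n nE] := erk_lty Vy; have [m mE] := erk_lty Uy.
rewrite nE mE -EFinD -natrD; apply/erk_finP.
have [Vn nVn] := (erk_finP _ _ _).1 nE; have [Um nUm] := (erk_finP _ _ _).1 mE.
by split; [exact: rk_ge_prod|exact: rk_lt_prod].
Qed.

Lemma preim_cs_closed (Y : normedModType C) (V : closed_subspace Y)
    (f : {linear Y -> Y}) : continuous f -> closed [set x | cs_set V (f x)].
Proof. by move=> fc; apply: (@closed_comp _ _ f) => [x _|]; [exact: fc|exact: cs_closed]. Qed.

Definition preim_cs (Y : normedModType C) (V : closed_subspace Y)
  (f : {linear Y -> Y}) (fc : continuous f) : closed_subspace Y.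
Proof.
apply: (@ClosedSubspace _ Y [set x | cs_set V (f x)]).
- by rewrite /= linear0; exact: cs_zero.
- by move=> a x y /=; rewrite linearP => Vx Vy; exact: cs_lin.
- exact: preim_cs_closed.
Defined.

(** When the [f i] are biorthogonal to the [x i], this map is the projection onto the common kernel
    of the [f i] along the span of the [x i]. *)
Lemma span_proj_linear (Y : lmodType C) n (f : 'I_n -> {linear Y -> C})
  (x : 'I_n -> Y) : linear (fun y => y - \sum_i f i y *: x i).
Proof.
move=> a y z; rewrite scalerBr addrACA -opprD; congr (_ - _).
rewrite scaler_sumr -big_split /=; apply: eq_bigr => i _.
by rewrite linearP scalerDl scalerA.
Qed.

Lemma continuous_sum_nrm (Y : normedModType C) n (f : 'I_n -> {linear Y -> C})
    (x : 'I_n -> Y) : (forall i, continuous (f i)) ->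
  exists2 M : R, 0 < M & forall y, nrm (\sum_i f i y *: x i) <= M * nrm y.
Proof.
move=> fc; have /choice[M MP] : forall i, exists M : R,
    0 < M /\ forall y, nrm (f i y) <= M * nrm y.
  by move=> i; have [M] := (continuousP_nrm (f i)).1 (fc i); exists M.
exists (1 + \sum_i M i * nrm (x i)).
  rewrite ltr_wpDr // sumr_ge0 // => i _.
  by rewrite mulr_ge0 ?nrm_ge0 // ltW //; case: (MP i).
move=> y; apply: le_trans (nrm_sum _ _ _) _.
rewrite mulrDl mul1r ler_wpDl ?nrm_ge0 // mulr_suml; apply: ler_sum => i _.
rewrite nrmZ mulrAC ler_wpM2r ?nrm_ge0 //; exact: (MP i).2.
Qed.

Lemma span_proj_continuous (Y : normedModType C) n (f : 'I_n -> {linear Y -> C})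
  (x : 'I_n -> Y) : (forall i, continuous (f i)) ->
  continuous (mklin (span_proj_linear f x)).
Proof.
move=> /(continuous_sum_nrm x)[M M0 fM]; apply/continuousP_nrm.
exists (1 + M); first by rewrite addr_gt0.
move=> y /=; apply: le_trans (nrmB _ _) _.
by rewrite mulrDl mul1r lerD2l.
Qed.

(** Induction on [n]. [V'] is [V] plus the span of all vectors but the first, closed as a preimage
    of [V] under a continuous map. Hahn-Banach gives [g] with value 1 at the first vector and 0 on
    [V']; multiples of [g] are subtracted from the functionals already found to make them vanish at
    the first vector. *)
Lemma biorthogonal (Y : normedModType C) (V : closed_subspace Y) n
    (x : 'I_n -> Y) : indep_mod x (cs_set V) ->
  exists f : 'I_n -> {linear Y -> C}, [/\ forall i, continuous (f i),
    forall i v, cs_set V v -> f i v = 0 &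
    forall i j, f i (x j) = (i == j)%:R].
Proof.
elim: n x => [|n IH] x xi.
  have l0 : linear (fun _ : Y => 0 : C) by move=> a u v; rewrite addr0 [RHS]mulr0.
  by exists (fun=> mklin l0); split=> -[].
pose x' (i : 'I_n) := x (lift ord0 i).
have [|f [fc fV fx]] := IH x'; first exact: indep_mod_lift.
pose V' := preim_cs V (@span_proj_continuous _ n f x' fc).
have [|g [gc gx gV]] := @hahn_banach _ _ V' (x ord0).
  move=> /= h.
  have := xi (fun i => if unlift ord0 i is Some j then - f j (x ord0) else 1).
  rewrite big_ord_recl unlift_none scale1r.
  under eq_bigr do rewrite liftK scaleNr.
  by rewrite sumrN => /(_ h ord0)/eqP; rewrite unlift_none oner_eq0.
have gl j : linear (fun y => f j y - f j (x ord0) * g y).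
  move=> a y z; rewrite !linearP scalerBr mulrDr opprD addrACA; congr (_ - _ + _).
  by rewrite /GRing.scale /= mulrCA.
pose F i := if unlift ord0 i is Some j then mklin (gl j) else g.
exists F; split.
- move=> i; rewrite /F; case: unlift => [j|]; last exact: gc.
  have [M M0 fM] := (continuousP_nrm _).1 (fc j).
  have [N N0 gN] := (continuousP_nrm _).1 gc.
  apply/continuousP_nrm; exists (M + nrm (f j (x ord0)) * N).
    by rewrite ltr_wpDr // mulr_ge0 ?nrm_ge0 // ltW.
  move=> y /=; apply: le_trans (nrmB _ _) _; rewrite mulrDl lerD // nrmM -mulrA.
  by rewrite ler_wpM2l ?nrm_ge0.
- have gV0 v : cs_set V v -> g v = 0.
    move=> Vv; apply: gV => /=; rewrite big1 ?subr0 // => i _.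
    by rewrite fV // scale0r.
  move=> i v Vv; rewrite /F; case: unlift => [j|] /=; last exact: gV0.
  by rewrite fV // gV0 // mulr0 subr0.
- have gx' j : g (x' j) = 0.
    apply: gV => /=; rewrite (bigD1 j) //= big1 ?addr0.
      by rewrite fx eqxx scale1r subrr; exact: cs_zero.
    by move=> i ij; rewrite fx (negbTE ij) scale0r.
  move=> i j; rewrite /F.
  case: (unliftP ord0 i) => [i' ->|->] /=; case: (unliftP ord0 j) => [j' ->|->] //=.
  + by rewrite -/(x' j') gx' mulr0 subr0 fx (inj_eq (@lift_inj _ _)).
  + by rewrite gx mulr1 subrr.
  + by rewrite -/(x' j') gx'.
Qed.

End Rank.

(** * Behaviour of Kato operators under small shifts *)

Section KatoStability.
Context {R : realType}.
Local Notation C := (R[i]).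

Lemma iter_linear (Y : lmodType C) (f : {linear Y -> Y}) n : linear (iter n f).
Proof. by move=> a x y; elim: n => //= n ->; rewrite linearP. Qed.

Lemma iter_bounded (Y : normedModType C) (f : {linear Y -> Y}) n :
  continuous f -> continuous (mklin (iter_linear f n)).
Proof.
move=> /continuousP_nrm[M M0 fM]; apply/continuousP_nrm.
exists (M ^+ n); first exact: exprn_gt0.
elim: n => [|n IH] x /=; first by rewrite expr0 mul1r.
apply: le_trans (fM _) _; rewrite exprS -mulrA ler_wpM2l ?(ltW M0) //.
exact: IH.
Qed.

(** If [f x] is close to [f x'] with [x'] in [F], some small [u] has [f u = f (x - x')]. Then
    [x - u] differs from [x'] by a kernel vector, so it lies in [F], and it is close to [x]. *)
Lemma closed_image (D Y : completeNormedModType C) (f : {linear D -> Y})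
    (F : closed_subspace D) :
  continuous f -> closed (range f) -> [set x | f x = 0] `<=` cs_set F ->
  closed (f @` cs_set F).
Proof.
move=> fc fcl Ff; have [c c0 fl] := closed_range_lift fc fcl.
have /closed_nrm fcl' := fcl; apply/closed_nrm => y yE.
have [x _ fx] : range f y.
  apply: fcl' => e /yE[_ [x Fx <-] xe]; exists (f x) => //; by exists x.
exists x => //; have Fcl := @cs_closed _ _ F; move/closed_nrm: Fcl; apply=> e e0.
have [|_ [x' Fx' <-] xe] := yE (e / c); first by rewrite divr_gt0.
have [u fu uc] := fl (x - x').
exists (x - u).
  have -> : x - u = x' + (x - x' - u) by rewrite !addrA [RHS](ACl ((1*3)*2*4))/= subrr add0r.
  apply: (subspD (subsp_cs F) Fx'); apply: Ff => /=.
  by rewrite linearB fu subrr.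
rewrite opprB addrC subrK; apply: le_lt_trans uc _.
by rewrite linearB fx mulrC -ltr_pdivlMr.
Qed.

(** The range of each power is the image under [A] of the preceding one, which contains the kernel
    of [A]; [closed_image] propagates closedness. *)
Lemma range_iter_closed (Y : completeNormedModType C) (A : 'L(Y)) n :
  closed (range A) ->
  (forall k, (k < n)%N -> nullspace A `<=` range (iter k A)) ->
  closed (range (iter n A)).
Proof.
move=> Acl; elim: n => [|n IH] NA.
  rewrite (_ : range _ = setT); first exact: closedT.
  by apply/seteqP; split=> x // _; exists x.
have Fcl : closed (range (mklin (iter_linear A n))).
  by apply: IH => k /ltnW; exact: NA.
have -> : range (iter n.+1 A) = A @` cs_set (range_cs Fcl).
  apply/seteqP; split=> [_ [x _ <-]|_ [_ [x _ <-] <-]]; last by exists x.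
  by exists (iter n A x) => //; exists x.
apply: closed_image => //; first exact: bop_continuous.
exact: NA.
Qed.

(** The hyperrange of [A]. For Kato [A] it is closed, contains the kernel, is mapped onto itself and
    is its own preimage: [A] is onto inside it and injective modulo it. *)
Definition Rinf (Y : completeNormedModType C) (A : 'L(Y)) : set Y :=
  [set x | forall n, range (iter n A) x].

Lemma kato_iter_closed (Y : completeNormedModType C) (A : 'L(Y)) n :
  Kato A -> closed (range (iter n A)).
Proof. by move=> [Acl NA]; apply: range_iter_closed. Qed.

Definition Rinf_cs (Y : completeNormedModType C) (A : 'L(Y)) (K : Kato A) :
  closed_subspace Y.
Proof.
apply: (@ClosedSubspace _ Y (Rinf A)).
- by move=> n; have [] := subsp_range (mklin (iter_linear A n)).
- move=> a x y Zx Zy n; have [_] := subsp_range (mklin (iter_linear A n)).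
  by move=> /(_ a x y (Zx n) (Zy n)).
- rewrite (_ : Rinf A = \bigcap_n range (iter n A)).
    by apply: closed_bigI => n _; exact: kato_iter_closed.
  by apply/seteqP; split=> x Zx n; [move=> _|]; exact: Zx.
Defined.

Lemma Rinf_preim (Y : completeNormedModType C) (A : 'L(Y)) x :
  Kato A -> Rinf A (A x) -> Rinf A x.
Proof.
move=> [_ NA] ZA n; have [y _ Ay] := ZA n.+1.
have /(NA n)[w _ wE] : nullspace A (x - iter n A y).
  by rewrite /nullspace /= linearB -Ay subrr.
have [_] := subsp_range (mklin (iter_linear A n)).
move=> /(_ 1 (x - iter n A y) (iter n A y)); rewrite scale1r subrK.
by apply; [exists w|exists y].
Qed.

Lemma Rinf_image (Y : completeNormedModType C) (A : 'L(Y)) x :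
  Rinf A x -> Rinf A (A x).
Proof.
move=> Zx [|n]; first by exists (A x).
by have [y _ <-] := Zx n; exists y.
Qed.

(** The distance to a closed subspace need not be attained, hence the factor 2. *)
Lemma near_best (Y : normedModType C) (V : closed_subspace Y) (x : Y) :
  exists2 z, cs_set V z & forall z', cs_set V z' -> nrm (x - z) <= 2 * nrm (x - z').
Proof.
have [Vx|Vx] := pselect (cs_set V x).
  by exists x => // z' _; rewrite subrr nrm0 mulr_ge0 ?nrm_ge0.
pose S := [set nrm (x - v) | v in cs_set V].
have iS : has_inf S.
  split; first by exists (nrm (x - 0)), 0 => //; exact: cs_zero.
  by exists 0 => _ [v _ <-]; exact: nrm_ge0.
have S0 : 0 < inf S.
  rewrite ltNge; apply/negP => S0; apply: Vx.
  have /closed_nrm := @cs_closed _ _ V; apply=> e e0.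
  have [_ [v Vv <-] ve] := inf_adherent e0 iS.
  by exists v => //; lra.
have [_ [v Vv <-] ve] := inf_adherent S0 iS.
exists v => // z' Vz'; have : inf S <= nrm (x - z'); last by lra.
by apply: ge_inf; [exact: iS.2|exists z'].
Qed.

(** Uniformly in small [nu], the operator induced by [A - nu] on the quotient by [Rinf A] is bounded
    below; speaking of [z] and [w] avoids forming the quotient. *)
Lemma Rinf_approx (Y : completeNormedModType C) (A : 'L(Y)) : Kato A ->
  exists e c : R, [/\ 0 < e, 0 < c & forall nu : C, nrm nu < e -> forall x,
    exists2 z, Rinf A z & forall w, Rinf A w ->
      nrm (x - z) <= c * nrm (shift A nu x - w)].
Proof.
move=> K; have [Acl NA] := K.
have [c c0 Al] := closed_range_lift (@bop_continuous _ _ A) Acl.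
have sZ := subsp_cs (Rinf_cs K).
(* [near_best] costs a factor 2 and lifting a factor [c]. For [nrm nu < (4 * c)^-1] the term
   [nu (x - z)] accounts for at most half of [nrm (x - z)]; absorbing it doubles [2 * c]. *)
exists (4 * c)^-1, (4 * c); rewrite invr_gt0 !mulr_gt0 //; split => // nu nue x.
have [z Zz zP] := near_best (Rinf_cs K) x.
exists z => // w Zw.
have Zw' : Rinf A (w + nu *: z) by apply: (subspD sZ) => //; exact: (subspZ _ sZ).
have [y _ Ay] := Zw' 1%N.
have Zy : Rinf A y by apply: Rinf_preim => //; move: Ay => /= ->.
have [u Au uc] := Al (x - y).
have Zxu : Rinf A (x - u).
  have -> : x - u = y + (x - y - u) by rewrite !addrA [RHS](ACl ((1*3)*2*4))/= subrr add0r.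
  apply: (subspD sZ Zy) => n; apply: NA.
  by rewrite /nullspace /= linearB Au subrr.
have := zP _ Zxu; rewrite subKr => h1.
have h2 : nrm (A (x - y)) <= nrm (shift A nu x - w) + nrm nu * nrm (x - z).
  rewrite -nrmZ; apply: le_trans (nrmD _ _); rewrite le_eqVlt; apply/orP; left.
  apply/eqP; congr nrm; move: Ay => /= Ay.
  rewrite linearB Ay /shift_fun scalerBr opprD !addrA.
  by rewrite [RHS](ACl ((2*4)*1*3*5))/= addNr add0r.
have h3 : nrm nu * nrm (x - z) <= (4 * c)^-1 * nrm (x - z).
  by rewrite ler_wpM2r ?nrm_ge0 // ltW.
have h4 : c * ((4 * c)^-1 * nrm (x - z)) = nrm (x - z) / 4.
  by field; rewrite gt_eqF.
have h5 : c * nrm (A (x - y)) <=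
    c * nrm (shift A nu x - w) + c * ((4 * c)^-1 * nrm (x - z)).
  by rewrite -mulrDr ler_wpM2l ?(ltW c0) // (le_trans h2) // lerD2l.
lra.
Qed.

(** Since [Rinf A] is its own preimage, controlled preimages of its points stay inside it;
    [perturb_lift] on this Banach space passes from [A] to [A - nu]. *)
Lemma Rinf_lift (Y : completeNormedModType C) (A : 'L(Y)) : Kato A ->
  exists e c : R, [/\ 0 < e, 0 < c & forall nu : C, nrm nu < e ->
    forall z, Rinf A z -> exists x,
      [/\ Rinf A x, shift A nu x = z & nrm x <= c * nrm z]].
Proof.
move=> K; have [Acl NA] := K.
have [c c0 Al] := closed_range_lift (@bop_continuous _ _ A) Acl.
exists (2 * c)^-1, (2 * c); rewrite invr_gt0 !mulr_gt0 //; split => // nu nue z Zz.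
pose Z := Rinf_cs K.
have AZ : invariant_subspace A Z by move=> x; exact: Rinf_image.
have gl : linear (fun x : cs_type Z => - nu *: x).
  by move=> a x y; rewrite scalerDr !scalerA mulrC.
have gc : continuous (mklin gl).
  apply/continuousP_nrm; exists (nrm nu + 1); first by rewrite ltr_wpDl ?nrm_ge0.
  by move=> x /=; rewrite nrmZ nrmN ler_wpM2r ?nrm_ge0 // lerDl.
have cn : c * nrm nu <= 2^-1.
  have := ltW nue; rewrite -(ler_pM2l c0) => /le_trans; apply.
  rewrite le_eqVlt; apply/orP; left; apply/eqP; field; by rewrite gt_eqF.
have fl (y : cs_type Z) : exists2 x, restr AZ x = y & nrm x <= c * nrm y.
  case: y => y yZ; have Zy : Rinf A y := set_mem yZ.
  have [x0 _ Ax0] := Zy 1%N; have [x Ax xc] := Al x0.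
  have Zx : Rinf A x by apply: Rinf_preim => //; rewrite Ax; move: Ax0 => /= ->.
  exists (CsType (mem_set Zx : x \in cs_pred Z)).
    by apply: val_inj; rewrite /= Ax.
  by move: xc; rewrite !nrm_cs /=; move: Ax0 => /= ->.
have gd (x : cs_type Z) : nrm (mklin gl x) <= nrm nu * nrm x.
  by rewrite /= nrmZ nrmN.
have [[x xZ] xz xc] := perturb_lift (@bop_continuous _ _ (restr AZ)) gc (ltW c0)
  (nrm_ge0 nu) cn fl gd (CsType (mem_set Zz : z \in cs_pred Z)).
exists x; split; first exact: (set_mem xZ).
  by have := congr1 (@cs_val _ _ _) xz; rewrite /= /shift_fun scaleNr.
exact: xc.
Qed.

(** If [A x = nu x] with [nu] nonzero, then [x] is the image of [nu^-n x] under the [n]-th power of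
    [A]; for [nu = 0] this is the Kato condition. *)
Lemma nullspace_shift_Rinf (Y : completeNormedModType C) (A : 'L(Y)) nu :
  Kato A -> nullspace (shift A nu) `<=` Rinf A.
Proof.
move=> [_ NA] x; rewrite /nullspace /= /shift_fun => /eqP.
rewrite subr_eq0 => /eqP Ax n.
have [nu0|nu0] := eqVneq nu 0; first by apply: NA; rewrite /nullspace /= Ax nu0 scale0r.
have itx k : iter k A x = nu ^+ k *: x.
  elim: k => [|k IH]; first by rewrite expr0 scale1r.
  by rewrite iterS IH linearZ /= Ax scalerA exprSr.
exists (nu ^- n *: x) => //.
have := @linearZ_LR _ _ _ _ (mklin (iter_linear A n)) (nu ^- n) x.
by rewrite /= => ->; rewrite itx scalerA mulVf ?scale1r // expf_neq0.
Qed.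

Lemma bounded_preimages_closed (Y : completeNormedModType C) (A : 'L(Y)) (c : R) :
  (forall x, exists2 x', A x' = A x & nrm x' <= c * nrm (A x)) ->
  closed (range A).
Proof. by move=> h; apply: range_closed_lift h; exact: bop_continuous. Qed.

(** A controlled preimage of [(A - nu) x] is [x - z + u], where [z] in [Rinf A] comes from
    [Rinf_approx] and [u] solves [(A - nu) u = (A - nu) z] inside [Rinf A]. The kernel of [A - nu]
    lies in [Rinf A], which all powers of [A - nu] map onto itself. *)
Lemma kato_shift (Y : completeNormedModType C) (A : 'L(Y)) : Kato A ->
  exists2 e : R, 0 < e & forall nu : C, nrm nu < e -> Kato (shift A nu).
Proof.
move=> K; have [e1 [c1 [e10 c10 h1]]] := Rinf_approx K.
have [e2 [c2 [e20 c20 h2]]] := Rinf_lift K.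
exists (Num.min e1 e2); first by rewrite lt_min e10.
move=> nu; rewrite lt_min => /andP[/h1 {}h1 /h2 {}h2].
have [M M0 AM] := (continuousP_nrm (shift A nu)).1 (@bop_continuous _ _ (shift A nu)).
split.
  apply: (@bounded_preimages_closed _ _ (c1 + c2 * (1 + M * c1))) => x.
  have [z Zz /(_ 0 (subsp_cs (Rinf_cs K)).1)] := h1 x.
  rewrite subr0 => zc.
  have ZTz : Rinf A (shift A nu z).
    apply: (subspB (subsp_cs (Rinf_cs K))); first exact: Rinf_image.
    exact: (subspZ _ (subsp_cs (Rinf_cs K))).
  have [u [Zu uz uc]] := h2 _ ZTz.
  exists (x - z + u); first by rewrite linearD linearB uz subrK.
  apply: le_trans (nrmD _ _) _; rewrite mulrDl lerD //.
  apply: le_trans uc _; rewrite -mulrA ler_wpM2l ?(ltW c20) //.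
  have -> : shift A nu z = shift A nu x - shift A nu (x - z).
    by rewrite (linearB (shift A nu)) subKr.
  apply: le_trans (nrmB _ _) _; rewrite mulrDl mul1r lerD2l.
  by apply: le_trans (AM _) _; rewrite -mulrA ler_wpM2l // ltW.
move=> n x /(nullspace_shift_Rinf K) Zx.
suff : forall y, Rinf A y -> exists2 z, Rinf A z & iter n (shift A nu) z = y.
  by move=> /(_ x Zx)[z _ zx]; exists z.
elim: n => [|n IH] y Zy; first by exists y.
have [z [Zz zy _]] := h2 _ Zy; have [w Zw wz] := IH _ Zz.
by exists w => //; rewrite iterS wz.
Qed.

Lemma ler_sum_nrm n (d : 'I_n -> C) j : nrm (d j) <= \sum_i nrm (d i).
Proof. by rewrite (bigD1 j) //= lerDl sumr_ge0 // => k _; exact: nrm_ge0. Qed.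

(** Summation bounds the total of the [nrm (d i)] by a proper fraction of itself. This is how
    independence is kept under small shifts. *)
Lemma coeffs0 n (d : 'I_n -> C) (b : 'I_n -> R) :
  (forall i, nrm (d i) <= b i * \sum_j nrm (d j)) -> \sum_i b i < 1 ->
  forall i, d i = 0.
Proof.
move=> db b1; set D := \sum_j nrm (d j) in db.
have DS : D <= (\sum_i b i) * D by rewrite mulr_suml; apply: ler_sum.
have D0 : D = 0.
  apply/eqP; rewrite eq_le sumr_ge0 ?andbT; last by move=> *; exact: nrm_ge0.
  by rewrite leNgt; apply/negP => Dp; move: b1; rewrite -(ltr_pM2r Dp) mul1r ltNge DS.
move=> i; apply: nrm_eq0; apply/eqP; rewrite eq_le nrm_ge0 andbT.
by rewrite -[X in _ <= X]D0 ler_sum_nrm.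
Qed.

Lemma closed0 (Y : normedModType C) : closed [set (0 : Y)].
Proof.
apply/closed_nrm => y yP; apply/eqP; rewrite -[_ == _]negbK; apply/negP => /nrm_gt0.
by move=> /yP[_ ->]; rewrite subr0 ltxx.
Qed.

Definition zero_cs (Y : normedModType C) : closed_subspace Y :=
  @ClosedSubspace _ Y [set 0] (subsp0 Y).1 (subsp0 Y).2 (@closed0 Y).

(** A kernel vector [x i] lies in [Rinf A], so some [y] of norm proportional to [nrm nu] solves
    [(A - nu) y = nu x i], and [x i + y] is in the kernel of [A - nu]. Biorthogonal functionals show
    that these small corrections preserve independence. *)
Lemma kato_rk_null_ge (Y : completeNormedModType C) (A : 'L(Y)) n : Kato A ->
  rk_ge (nullspace A) [set 0] n ->
  exists2 e : R, 0 < e & forall nu : C, nrm nu < e ->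
    rk_ge (nullspace (shift A nu)) [set 0] n.
Proof.
move=> K [x Nx xi].
have [e [c [e0 c0 h]]] := Rinf_lift K.
have [f [fc _ fx]] := @biorthogonal _ _ (zero_cs Y) _ _ xi.
have /choice[g gP] : forall p : C * 'I_n, exists y, nrm p.1 < e ->
    shift A p.1 y = p.1 *: x p.2 /\ nrm y <= c * nrm (p.1 *: x p.2).
  move=> [nu i] /=; have [nue|] := ltP (nrm nu) e; last by exists 0.
  have [|y [_ yE yc]] := h nu nue (nu *: x i).
    apply: (subspZ _ (subsp_cs (Rinf_cs K))).
    by move=> m; case: K => _; apply; exact: Nx.
  by exists y.
have /choice[F FP] : forall i, exists N : R,
    0 < N /\ forall y, nrm (f i y) <= N * nrm y.
  by move=> i; have [N] := (continuousP_nrm (f i)).1 (fc i); exists N.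
pose S := \sum_i \sum_j (F i * (c * nrm (x j))).
have F0 i : 0 <= F i by rewrite ltW //; case: (FP i).
have S0 : 0 <= S.
  by rewrite sumr_ge0 // => i _; rewrite sumr_ge0 // => j _; rewrite !mulr_ge0 ?nrm_ge0 // ltW.
exists (Num.min e (S + 1)^-1); first by rewrite lt_min e0 invr_gt0 ltr_wpDl.
move=> nu; rewrite lt_min => /andP[nue nuS].
exists (fun i => x i + g (nu, i)).
  move=> i; have [gE _] := gP (nu, i) nue; rewrite /nullspace /=.
  move: gE => /=; rewrite /shift_fun linearD (Nx i) add0r scalerDr opprD addrCA => ->.
  by rewrite addNr.
move=> d /eqP; under eq_bigr do rewrite scalerDr.
rewrite big_split /= addr_eq0 => /eqP dE.
have fd i : d i = - \sum_j d j * f i (g (nu, j)).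
  have := congr1 (f i) dE; rewrite linearN !linear_sum (bigD1 i) //= big1 ?addr0.
    rewrite linearZ /= fx eqxx => h1; rewrite -[LHS]mulr1; apply: (etrans h1).
    by apply: eq_bigr => j _; rewrite linearZ.
  by move=> j ji; rewrite linearZ /= fx eq_sym (negbTE ji) [LHS]mulr0.
apply: (@coeffs0 _ _ (fun i => nrm nu * \sum_j (F i * (c * nrm (x j))))).
  move=> i; rewrite fd nrmN; apply: le_trans (nrm_sum _ _ _) _.
  rewrite mulr_sumr mulr_suml; apply: ler_sum => j _; rewrite nrmM.
  have [_ gn] := gP (nu, j) nue; have [_ fn] := FP i.
  have h1 : nrm (f i (g (nu, j))) <= F i * (c * (nrm nu * nrm (x j))).
    by apply: le_trans (fn _) _; rewrite ler_wpM2l // -nrmZ.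
  apply: le_trans (ler_pM (nrm_ge0 _) (nrm_ge0 _) (ler_sum_nrm d j) h1) _.
  by rewrite le_eqVlt; apply/orP; left; apply/eqP; ring.
rewrite -mulr_sumr -/S; apply: (@le_lt_trans _ _ ((S + 1)^-1 * S)).
  by rewrite ler_wpM2r // ltW.
by rewrite mulrC ltr_pdivrMr ?ltr_wpDl // mul1r ltrDl.
Qed.

(** Let the [f i] be biorthogonal to the [x i] and zero on the range of [A]. If a combination of the
    [x i] with coefficients [d] equals [(A - nu) w], then [d i = - nu f i (w - z)] for [z] in
    [Rinf A], and [Rinf_approx] bounds [w - z] by the combination: [d] is small compared with
    itself. *)
Lemma kato_rk_range_ge (Y : completeNormedModType C) (A : 'L(Y)) n : Kato A ->
  rk_ge setT (range A) n ->
  exists2 e : R, 0 < e & forall nu : C, nrm nu < e ->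
    rk_ge setT (range (shift A nu)) n.
Proof.
move=> K [x _ xi]; have [Acl NA] := K.
have [e [c [e0 c0 h]]] := Rinf_approx K.
have [f [fc fV fx]] := @biorthogonal _ _ (range_cs Acl) _ _ xi.
have /choice[F FP] : forall i, exists N : R,
    0 < N /\ forall y, nrm (f i y) <= N * nrm y.
  by move=> i; have [N] := (continuousP_nrm (f i)).1 (fc i); exists N.
have F0 i : 0 <= F i by rewrite ltW //; case: (FP i).
pose S := \sum_i F i * (c * \sum_j nrm (x j)).
have S0 : 0 <= S.
  rewrite sumr_ge0 // => i _; rewrite !mulr_ge0 ?(ltW c0) // sumr_ge0 // => j _.
  exact: nrm_ge0.
exists (Num.min e (S + 1)^-1); first by rewrite lt_min e0 invr_gt0 ltr_wpDl.
move=> nu; rewrite lt_min => /andP[nue nuS].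
exists x => // d [w _ wE].
apply: (@coeffs0 _ _ (fun i => nrm nu * (F i * (c * \sum_j nrm (x j))))); last first.
  rewrite -mulr_sumr -/S; apply: (@le_lt_trans _ _ ((S + 1)^-1 * S)).
    by rewrite ler_wpM2r // ltW.
  by rewrite mulrC ltr_pdivrMr ?ltr_wpDl // mul1r ltrDl.
move=> i; have [z Zz /(_ 0 (subsp_cs (Rinf_cs K)).1)] := h nu nue w.
rewrite subr0 wE => zc.
have -> : d i = - (nu * f i (w - z)).
  have := congr1 (f i) wE; rewrite linear_sum (bigD1 i) //= big1 ?addr0; last first.
    by move=> j ji; rewrite linearZ /= fx eq_sym (negbTE ji) [LHS]mulr0.
  rewrite linearZ /= fx eqxx => h1; rewrite -[LHS]mulr1; apply: (etrans (esym h1)).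
  have fAw : f i (A w) = 0 by apply: fV; exists w.
  have fz : f i z = 0 by apply: fV; have [z' _ /= <-] := Zz 1%N; exists z'.
  by rewrite /= /shift_fun !linearB linearZ /= fAw fz sub0r subr0.
rewrite nrmN nrmM -!mulrA ler_wpM2l ?nrm_ge0 //.
apply: le_trans ((FP i).2 _) _; rewrite ler_wpM2l //; apply: le_trans zc _.
rewrite ler_wpM2l ?(ltW c0) //; apply: le_trans (nrm_sum _ _ _) _.
rewrite mulr_suml; apply: ler_sum => j _.
by rewrite nrmZ mulrC ler_wpM2l ?nrm_ge0 // ler_sum_nrm.
Qed.

Lemma functionals_rk (Y : lmodType C) (V V0 : set Y) n
    (f : 'I_n -> {linear Y -> C}) : subsp V ->
  (forall v, V v -> (forall i, f i v = 0) -> V0 v) -> ~ rk_ge V V0 n.+1.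
Proof.
move=> sV fV [x Vx xi].
pose B : 'M[C]_(n.+1, n) := \matrix_(j, i) f i (x j).
have [d d0 dB] := left_null B.
move: d0; apply/negP; rewrite negbK; apply/eqP/rowP => j; rewrite mxE.
apply: (xi (fun j => d 0 j)); apply: fV.
  by apply: subsp_sum => // i _; exact: subspZ.
move=> i; have := congr1 (fun M : 'rV_n => M 0 i) dB; rewrite !mxE => <-.
by rewrite linear_sum; apply: eq_bigr => k _; rewrite linearZ mxE.
Qed.

(** Functionals dual to a basis of the kernel of [A] separate the kernel of [A - nu]: a vector [v]
    of the latter on which they vanish is a controlled preimage of [A v = nu v] minus its projection
    to the kernel of [A], so [nrm v <= c' * (nrm nu * nrm v)] and [v = 0]. *)
Lemma rk_null_lt (Y : completeNormedModType C) (A : 'L(Y)) n :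
  closed (range A) -> ~ rk_ge (nullspace A) [set 0] n.+1 ->
  exists2 e : R, 0 < e & forall nu : C, nrm nu < e ->
    ~ rk_ge (nullspace (shift A nu)) [set 0] n.+1.
Proof.
move=> Acl /(rk_basis (subsp0 Y))[k kn [x [Nx xi xN]]].
have [c c0 Al] := closed_range_lift (@bop_continuous _ _ A) Acl.
have [f [fc _ fx]] := @biorthogonal _ _ (zero_cs Y) _ _ xi.
have [M M0 fM] := continuous_sum_nrm x fc.
pose c' := (1 + M) * c.
have c'0 : 0 < c' by rewrite mulr_gt0 // addr_gt0.
exists c'^-1; first by rewrite invr_gt0.
move=> nu nue h; have {h} : rk_ge (nullspace (shift A nu)) [set 0] k.+1.
  exact: rk_ge_leq h.
apply: functionals_rk (f) _ _; first exact: subsp_ker.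
move=> v; rewrite /nullspace /= /shift_fun => /eqP; rewrite subr_eq0 => /eqP Av fv.
have [u Au uc] := Al v.
have [|d /= /eqP] := xN (v - u); first by rewrite /nullspace /= linearB Au subrr.
rewrite subr_eq0 => /eqP dE.
have dfi i : d i = - f i u.
  have := congr1 (f i) dE; rewrite linearB fv sub0r linear_sum (bigD1 i) //=.
  rewrite big1 ?addr0; last first.
    by move=> j ji; rewrite linearZ /= fx eq_sym (negbTE ji) [LHS]mulr0.
  by rewrite linearZ /= fx eqxx => ->; rewrite [RHS]mulr1.
have vE : v = u - \sum_i f i u *: x i.
  rewrite -[LHS](subrK u) dE addrC; congr (_ + _).
  by rewrite -sumrN; apply: eq_bigr => i _; rewrite dfi scaleNr.
have vn : nrm v <= c' * (nrm nu * nrm v).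
  rewrite -nrmZ -Av {1}vE; apply: le_trans (nrmB _ _) _.
  rewrite /c' -mulrA mulrDl mul1r lerD //; apply: le_trans (fM _) _.
  by rewrite ler_wpM2l // ltW.
apply: nrm_eq0; apply/eqP; rewrite eq_le nrm_ge0 andbT leNgt; apply/negP => v0.
move: vn; rewrite mulrA -{1}[nrm v]mul1r ler_pM2r // leNgt.
by rewrite mulrC -ltr_pdivlMr // div1r nue.
Qed.

(** [p] projects onto the range of [A] along the span of the [x i]. The map [y -> A y - nu p y] is a
    small perturbation of [A] as a map onto its range, and it equals [p] after [A - nu]. Hence every
    [v] is, modulo the range of [A - nu], in the kernel of [p], that is in the span. *)
Lemma rk_range_lt (Y : completeNormedModType C) (A : 'L(Y)) n :
  closed (range A) -> ~ rk_ge setT (range A) n.+1 ->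
  exists2 e : R, 0 < e & forall nu : C, nrm nu < e ->
    ~ rk_ge setT (range (shift A nu)) n.+1.
Proof.
move=> Acl; have sA := subsp_range A; move=> /(rk_basis sA)[k kn [x [_ xi xN]]].
have [c c0 Al] := closed_range_lift (@bop_continuous _ _ A) Acl.
have [f [fc fV fx]] := @biorthogonal _ _ (range_cs Acl) _ _ xi.
pose p := mklin (span_proj_linear f x).
have pc : continuous p := @span_proj_continuous _ _ _ _ x fc.
have pA y : cs_set (range_cs Acl) (p y).
  have [d [w _ wE]] := xN y I; exists w => //; rewrite wE /=; congr (_ - _).
  apply: eq_bigr => i _; congr (_ *: _).
  have := congr1 (f i) wE; rewrite fV; last by exists w.
  rewrite linearB linear_sum (bigD1 i) //= big1 ?addr0; last first.
    by move=> j ji; rewrite linearZ /= fx eq_sym (negbTE ji) [LHS]mulr0.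
  rewrite linearZ /= fx eqxx => /esym/eqP; rewrite subr_eq0 => /eqP ->.
  by rewrite [RHS]mulr1.
have pid y : range A y -> p y = y.
  by move=> Ay /=; rewrite big1 ?subr0 // => i _; rewrite fV // scale0r.
have [M M0 pM] := (continuousP_nrm _).1 pc.
exists (2 * c * M)^-1; first by rewrite invr_gt0 !mulr_gt0.
move=> nu nue h; have {h} : rk_ge setT (range (shift A nu)) k.+1.
  exact: rk_ge_leq h.
apply: (@span_rk _ _ _ _ _ x); first exact: subsp_range.
move=> v _.
have AM y : cs_set (range_cs Acl) (A y) by exists y.
have gl : linear (fun y => - nu *: p y).
  by move=> a y z; rewrite linearP scalerDr !scalerA mulrC.
have gM y : cs_set (range_cs Acl) (mklin gl y).
  by apply: (subspZ _ (subsp_cs _)); exact: pA.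
have fcc : continuous (mklin (corestr_linear AM)).
  have [N N0 AN] := (continuousP_nrm A).1 (@bop_continuous _ _ A).
  apply/continuousP_nrm; exists N => // y; exact: AN.
have gn (y : Y) : nrm (mklin (corestr_linear gM) y) <= nrm nu * M * nrm y.
  rewrite nrm_cs /= nrmZ nrmN -mulrA; apply: ler_wpM2l; first exact: nrm_ge0.
  exact: pM.
have nM : 0 <= nrm nu * M by rewrite mulr_ge0 ?nrm_ge0 // ltW.
have gcc : continuous (mklin (corestr_linear gM)).
  apply/continuousP_nrm; exists (nrm nu * M + 1); first by rewrite ltr_wpDl.
  by move=> y; rewrite mulrDl mul1r ler_wpDr ?nrm_ge0.
have cn : c * (nrm nu * M) <= 2^-1.
  rewrite mulrCA; have := ltW nue.
  rewrite -(ler_pM2r (mulr_gt0 c0 M0)) => /le_trans; apply.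
  by rewrite le_eqVlt; apply/orP; left; apply/eqP; field; rewrite !gt_eqF.
have fl (y : cs_type (range_cs Acl)) : exists2 w : Y,
    mklin (corestr_linear AM) w = y & nrm w <= c * nrm y.
  case: y => y yR; have [w _ wy] := set_mem yR; have [w' w'E w'c] := Al w.
  exists w'; first by apply: val_inj; rewrite /= w'E.
  by rewrite nrm_cs /= -wy.
have [y yE _] := perturb_lift fcc gcc (ltW c0) nM cn fl gn (corestr pA v).
have {}yE : p (shift A nu y) = p v.
  have -> : p (shift A nu y) = A y + - nu *: p y.
    rewrite -[in RHS](pid (A y)); last by exists y.
    by rewrite scaleNr -linearZ -linearB.
  exact: (congr1 (@cs_val _ _ _) yE).
exists (fun i => f i (v - shift A nu y)); exists y => //.
have : p (v - shift A nu y) = 0 by rewrite linearB yE subrr.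
move=> /= /eqP; rewrite subr_eq0 => /eqP <-.
by rewrite subKr.
Qed.

End KatoStability.

(** * Completeness of products *)

Section ProductComplete.
Context {K : numFieldType} {U V : completeNormedModType K}.

HB.instance Definition _ := Pointed.on (U * V)%type.

Let prod_complete (F : set_system (U * V)) :
  ProperFilter F -> cauchy F -> cvg F.
Proof.
move=> FF /cauchy_ballP Fc.
have cU : cauchy (fst @ F).
  apply/cauchy_ballP => e e0; have [[A B] /= [FA FB] AB] := Fc e e0.
  exists (fst @` A, fst @` B) => /=.
    by split; [apply: filterS FA|apply: filterS FB] => x Ax; exists x.
  by move=> [_ _] /= [[x Ax <-] [y By <-]]; have [] := AB (x, y) (conj Ax By).
have cV : cauchy (snd @ F).
  apply/cauchy_ballP => e e0; have [[A B] /= [FA FB] AB] := Fc e e0.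
  exists (snd @` A, snd @` B) => /=.
    by split; [apply: filterS FA|apply: filterS FB] => x Ax; exists x.
  by move=> [_ _] /= [[x Ax <-] [y By <-]]; have [] := AB (x, y) (conj Ax By).
have /cvg_ex[l Fl] : cvg (fst @ F) by exact: cauchy_cvg.
have /cvg_ex[m Fm] : cvg (snd @ F) by exact: cauchy_cvg.
apply/cvg_ex; exists (l, m).
move=> A [[P Q] [/= lP mQ] PQ].
have FP : F (fst @^-1` P) by exact: Fl lP.
have FQ : F (snd @^-1` Q) by exact: Fm mQ.
by apply: (@filterS _ F _ _ _ _ (filterI FP FQ)) => x xPQ; exact: PQ.
Qed.

HB.instance Definition _ := Uniform_isComplete.Build (U * V)%type prod_complete.

End ProductComplete.

(** * Nullity and defect, the nine classes, and constancy on a disc *)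

Section Indices.
Context {R : realType}.
Local Notation C := (R[i]).

Lemma nrm_prod (U V : normedModType C) (x : U * V) :
  nrm x = Num.max (nrm x.1) (nrm x.2).
Proof.
apply: complexI; rewrite -nrmE prod_normE !nrmE /Order.max ltcR.
by case: ifP.
Qed.

Lemma nrm_pairl (U V : normedModType C) (x : U * V) : nrm x.1 <= nrm x.
Proof. by rewrite nrm_prod le_max lexx. Qed.

Lemma nrm_pairr (U V : normedModType C) (x : U * V) : nrm x.2 <= nrm x.
Proof. by rewrite nrm_prod le_max lexx orbT. Qed.

Lemma nrm_pair (U V : normedModType C) (x : U * V) : nrm x <= nrm x.1 + nrm x.2.
Proof. by rewrite nrm_prod ge_max lerDl lerDr !nrm_ge0. Qed.

(* Naming the product structure keeps unification from unfolding it. *)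
Definition psum (U V : completeNormedModType C) : completeNormedModType C :=
  (U * V)%type.

Lemma psum_lin1 (U V : completeNormedModType C) :
  linear (fst : psum U V -> U).
Proof. by []. Qed.

Lemma psum_lin2 (U V : completeNormedModType C) :
  linear (snd : psum U V -> V).
Proof. by []. Qed.

Lemma nrm_psuml (U V : completeNormedModType C) (x : psum U V) :
  nrm x.1 <= nrm x.
Proof. exact: nrm_pairl. Qed.

Lemma nrm_psumr (U V : completeNormedModType C) (x : psum U V) :
  nrm x.2 <= nrm x.
Proof. exact: nrm_pairr. Qed.

Lemma nrm_psum (U V : completeNormedModType C) (x : psum U V) :
  nrm x <= nrm x.1 + nrm x.2.
Proof. exact: nrm_pair. Qed.

Definition alpha (Y : completeNormedModType C) (A : 'L(Y)) : \bar R :=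
  erk (nullspace A) [set 0].

Definition beta (Y : completeNormedModType C) (A : 'L(Y)) : \bar R :=
  erk setT (range A).

Lemma erk_eq0 (Y : lmodType C) (V V0 : set Y) : subsp V0 ->
  erk V V0 = 0%E <-> V `<=` V0.
Proof.
move=> sV0; split=> [/(erk_finP V V0 0)[_ h] v Vv|h].
  apply: contrapT => nv; apply: h; exists (fun=> v) => // c.
  rewrite big_ord1 => Vc i; rewrite (ord1 i).
  apply/eqP; rewrite -[_ == _]negbK; apply/negP => c0; apply: nv.
  by have := subspZ (c ord0)^-1 sV0 Vc; rewrite scalerA mulVf // scale1r.
apply/(erk_finP V V0 0); split; first exact: rk_ge0.
move=> [x Vx xi]; have := xi (fun=> 1); rewrite big_ord1 scale1r.
by move=> /(_ (h _ (Vx _)) ord0)/eqP; rewrite oner_eq0.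
Qed.

Lemma alpha0 (Y : completeNormedModType C) (A : 'L(Y)) :
  alpha A = 0%E <-> forall x, A x = 0 -> x = 0.
Proof. by split=> [/(erk_eq0 _ (subsp0 Y))|h]; last exact/(erk_eq0 _ (subsp0 Y)). Qed.

Lemma beta0 (Y : completeNormedModType C) (A : 'L(Y)) :
  beta A = 0%E <-> range A = setT.
Proof.
split=> [/(erk_eq0 _ (subsp_range A)) h|h]; last by apply/(erk_eq0 _ (subsp_range A)); rewrite h.
by apply/seteqP; split.
Qed.

(** With [E] a finite-dimensional complement of the range, [(x, e) -> A x + e] is onto and so has
    controlled preimages. The [E]-component of a point is unique, and for a limit of points of the
    range it is arbitrarily small. *)
Lemma finite_codim_closed (Y : completeNormedModType C) (A : 'L(Y)) :
  (beta A < +oo)%E -> closed (range A).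
Proof.
have sA := subsp_range A.
move=> /erk_lty[n /erk_finP[_ /(rk_basis sA)[k _ [x [_ xi xA]]]]].
(* [biorthogonal] asks for a closed subspace, and the range is not yet known to be closed; hence
   independence modulo 0. *)
have xi0 : indep_mod x [set 0].
  by move=> c /= c0; apply: xi; rewrite c0; exact: sA.1.
have [f [fc _ fx]] := @biorthogonal _ _ (zero_cs Y) _ _ xi0.
pose E := preim_cs (zero_cs Y) (@span_proj_continuous _ _ _ _ x fc).
have EA v : cs_set E v -> range A v -> v = 0.
  move=> /= /eqP; rewrite subr_eq0 => /eqP vE vA; rewrite vE in vA.
  by rewrite vE big1 // => i _; rewrite (xi (fun i => f i v)) // scale0r.
have gl : linear (fun p : psum Y (cs_type E) => A p.1 + cs_val p.2).
  by move=> a p q; rewrite psum_lin1 psum_lin2 linearP scalerDr addrACA.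
have gc : continuous (mklin gl).
  have [M M0 AM] := (continuousP_nrm A).1 (@bop_continuous _ _ A).
  apply/continuousP_nrm; exists (M + 1); first by rewrite addr_gt0.
  move=> p; apply: le_trans (nrmD _ _) _; rewrite mulrDl mul1r lerD //.
    by apply: le_trans (AM _) _; rewrite ler_wpM2l ?(ltW M0) // nrm_psuml.
  exact: (nrm_psumr p).
have [|c c0 cP] := open_mapping gc.
  move=> y; have [d [w _ wE]] := xA y I.
  have Ed : cs_set E (\sum_i d i *: x i).
    apply/eqP; rewrite subr_eq0; apply/eqP; apply: eq_bigr => i _.
    rewrite linear_sum (bigD1 i) //= big1 ?addr0.
      by rewrite linearZ /= fx eqxx /GRing.scale /= mulr1.
    by move=> j ji; rewrite linearZ /= fx eq_sym (negbTE ji) /GRing.scale /= mulr0.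
  by exists (w, CsType (mem_set Ed)); rewrite /= wE subrK.
apply/closed_nrm => y yA.
have [[x0 e0] y0 _] := cP y.
suff e00 : cs_val e0 = 0 by exists x0 => //; rewrite -y0 /= e00 addr0.
apply: nrm_eq0; apply/eqP; rewrite eq_le nrm_ge0 andbT.
apply/ler_addgt0Pr => e ep; rewrite add0r.
have [|_ [w _ <-] yw] := yA (e / c); first by rewrite divr_gt0.
have [[x1 e1] y1 p1] := cP (y - A w).
have <- : cs_val e1 = cs_val e0.
  apply/eqP; rewrite -subr_eq0; apply/eqP; apply: EA.
    apply: (subspB (subsp_cs E)); [exact: set_mem (cs_valP e1)|exact: set_mem (cs_valP e0)].
  exists (x0 - w - x1) => //; move: y1; rewrite -y0 /= !linearB => h.
  have -> : cs_val e1 = A x0 + cs_val e0 - A w - A x1.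
    by rewrite -h addrAC subrr add0r.
  by rewrite [RHS](ACl ((2*5)*1*3*4))/= subrr add0r.
apply: le_trans (nrm_psumr (x1, e1)) _; apply: le_trans p1 _.
by rewrite mulrC -ler_pdivlMr // ltW.
Qed.

(** [a] stands for the nullity and [b] for the defect. Wherever [a - b] occurs one of them is
    finite, so the convention for [+oo - +oo] does not interfere. *)
Definition class_index (c : opclass) (a b : \bar R) : Prop :=
  match c with
  | CJ => a = 0
  | CS => b = 0
  | CInv => a = 0 /\ b = 0
  | CPhiPlus => (a < +oo)%E
  | CPhiMinus => (b < +oo)%E
  | CPhi => (a < +oo)%E /\ (b < +oo)%E
  | CWPlus => (a < +oo)%E /\ (a - b <= 0)%E
  | CWMinus => (b < +oo)%E /\ (0 <= a - b)%E
  | CW => [/\ (a < +oo)%E, (b < +oo)%E & (a - b = 0)%E]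
  end.

Lemma bounded_belowP (Y : completeNormedModType C) (A : 'L(Y)) :
  bounded_below A <-> closed (range A) /\ alpha A = 0%E.
Proof.
split=> [[_/posC[d d0 ->] dA]|[Acl /alpha0 A0]].
  have dA' x : d * nrm x <= nrm (A x).
    by have := dA x; rewrite !nrmE -rmorphM lecR.
  split; last first.
    apply/alpha0 => x Ax; apply: nrm_eq0; apply/eqP; rewrite eq_le nrm_ge0 andbT.
    by have := dA' x; rewrite Ax nrm0 pmulr_rle0.
  apply: (@bounded_preimages_closed _ _ _ d^-1) => x; exists x => //.
  by rewrite mulrC ler_pdivlMr // mulrC.
have [c c0 Al] := closed_range_lift (@bop_continuous _ _ A) Acl.
exists ((c^-1)%:C)%C; first by rewrite ltcR invr_gt0.
move=> x; rewrite !nrmE -rmorphM lecR mulrC ler_pdivrMr // mulrC.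
have [x' x'E] := Al x; suff -> : x' = x by [].
by apply/eqP; rewrite -subr_eq0; apply/eqP/A0; rewrite linearB x'E subrr.
Qed.

Lemma invertibleP (Y : completeNormedModType C) (A : 'L(Y)) :
  invertible A <-> [/\ closed (range A), alpha A = 0%E & beta A = 0%E].
Proof.
split=> [[S [AS SA]]|[Acl A0 /beta0 As]].
  have As : range A = setT by apply/seteqP; split=> // y _; exists (S y).
  split; first by rewrite As; exact: closedT.
    by apply/alpha0 => x Ax; rewrite -(AS x) Ax linear0.
  exact/beta0.
have [c c0 Al] := closed_range_lift (@bop_continuous _ _ A) Acl.
have /choice[S SP] : forall y, exists x, A x = y.
  move=> y; have [x _ xy] : range A y by rewrite As.
  by exists x.
have Ainj x y : A x = A y -> x = y.
  move=> Axy; apply/eqP; rewrite -subr_eq0; apply/eqP.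
  by apply: ((alpha0 A).1 A0); rewrite linearB Axy subrr.
have Sl : linear S by move=> a x y; apply: Ainj; rewrite linearP !SP.
have Sc : continuous (mklin Sl).
  apply/continuousP_nrm; exists c => // y; have [x' x'E] := Al (S y).
  by rewrite SP; rewrite (Ainj _ _ x'E).
exists (BoundedOperator Sc); split => [x|y] /=; last exact: SP.
by apply: Ainj; rewrite SP.
Qed.

Lemma in_classP c (Y : completeNormedModType C) (A : 'L(Y)) :
  in_class c A <-> closed (range A) /\ class_index c (alpha A) (beta A).
Proof.
have h0 : (0 < +oo :> \bar R)%E by [].
have fc := @finite_codim_closed _ A.
case: c => /=; rewrite /Weyl /lower_semi_Weyl /upper_semi_Weyl /Fredholm
  /lower_semi_Fredholm /upper_semi_Fredholm /op_index ?edimE ?ecodimE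
  -?/(alpha A) -?/(beta A); try tauto.
- exact: bounded_belowP.
- rewrite /op_surjective -beta0; split=> [b0|[//]]; split=> //.
  by apply: fc; rewrite b0.
- by rewrite invertibleP; split=> [[]|[? []]].
- by split=> [[[[? ?] ?] ?]|[? [? ? ?]]].
Qed.

Lemma class_indexD c (a b : \bar R) (d : nat) : (0 <= a)%E -> (0 <= b)%E ->
  class_index c (a + d%:R%:E) (b + d%:R%:E) -> class_index c a b.
Proof.
have d0 : 0 <= d%:R :> R by exact: ler0n.
have sum0 (x : \bar R) : (0 <= x)%E -> (x + d%:R%:E = 0)%E -> x = 0%E.
  by case: x => [x| |] //=; rewrite lee_fin -EFinD => x0 [] h; congr EFin; lra.
have sumy (x : \bar R) : (x + d%:R%:E < +oo)%E -> (x < +oo)%E.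
  by case: x => [x| |] //= _; rewrite ltry.
have dif (x y : \bar R) : ((x + d%:R%:E) - (y + d%:R%:E) = x - y)%E.
  case: x y => [x| |] [y| |] //=; rewrite -!EFinD -?EFinB; congr EFin; lra.
move=> a0 b0; case: c => /=; rewrite ?dif.
- exact: sum0.
- exact: sum0.
- by move=> [/sum0 -> // /sum0 ->].
- exact: sumy.
- exact: sumy.
- by move=> [/sumy ? /sumy].
- by move=> [/sumy].
- by move=> [/sumy].
- by move=> [/sumy ? /sumy].
Qed.

(** On the segment from 0 to [nu] the parameters at which [P] agrees with [P 0] form a nonempty
    relatively clopen set. *)
Lemma disc_const (e : R) (P : C -> Prop) :
  (forall mu, nrm mu < e -> exists2 d : R, 0 < d &
    forall nu, nrm (nu - mu) < d -> (P nu <-> P mu)) ->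
  forall nu, nrm nu < e -> (P nu <-> P 0).
Proof.
move=> loc nu nue.
pose I := `[0, 1]%classic : set R.
pose Q (t : R) := P ((t%:C)%C * nu) <-> P 0.
have Iloc t : I t -> exists2 d : R, 0 < d &
    forall s, `|s - t| < d -> (Q s <-> Q t).
  rewrite /I /= in_itv /= => /andP[t0 t1].
  have [|d d0 dP] := loc ((t%:C)%C * nu).
    rewrite nrmM nrm_real ger0_norm //; apply: le_lt_trans nue.
    by rewrite ler_piMl ?nrm_ge0.
  exists (d / (nrm nu + 1)); first by rewrite divr_gt0 ?ltr_wpDl ?nrm_ge0.
  move=> s st; have -> // : Q s <-> Q t.
  rewrite /Q (dP ((s%:C)%C * nu)) //.
  rewrite -mulrBl nrmM -rmorphB nrm_real.
  have n0 := nrm_ge0 nu.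
  move: st; rewrite ltr_pdivlMr ?ltr_wpDl // => h; apply: le_lt_trans h.
  by rewrite ler_wpM2l // lerDl.
have near_ball (t d : R) (X : set R) : 0 < d -> (forall s, `|s - t| < d -> X s) ->
    nbhs t X.
  move=> d0 dX; apply/nbhs_normP; exists d => //= s /=.
  by rewrite distrC; exact: dX.
have IQ : [set t | I t /\ Q t] = I.
  apply: (@segment_connected _ 0 1).
  - by exists 0; split; rewrite /I ?/Q /= ?in_itv /= ?lexx ?ler01 // rmorph0 mul0r.
  - exists ([set t | I t -> Q t]°); first exact: open_interior.
    apply/seteqP; split=> [t [It Qt]|t [It /nbhs_singleton h]]; last by split=> //; exact: h.
    split=> //; have [d d0 dP] := Iloc t It.
    by apply: (near_ball _ d) => // s st _; apply/(dP s st).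
  - exists (~` [set t | I t -> ~ Q t]°).
      by apply: open_closedC; exact: open_interior.
    apply/seteqP; split=> [t [It Qt]|t [It h]].
      by split=> // /nbhs_singleton; apply.
    split=> //; apply: contrapT => nQt; apply: h.
    have [d d0 dP] := Iloc t It.
    by apply: (near_ball _ d) => // s st _ /(dP s st).
have : I 1 by rewrite /I /= in_itv /= ler01 lexx.
by rewrite -{1}IQ => -[_]; rewrite /Q rmorph1 mul1r.
Qed.

Lemma shift_shift (Y : normedModType C) (A : 'L(Y)) (mu nu : C) x :
  shift (shift A mu) (nu - mu) x = shift A nu x.
Proof. by rewrite /= /shift_fun /= /shift_fun scalerBl opprB addrA subrK. Qed.

Lemma kato_local (Y : completeNormedModType C) (A : 'L(Y)) n : Kato A ->
  exists2 e : R, 0 < e & forall nu, nrm nu < e ->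
   (rk_ge (nullspace (shift A nu)) [set 0] n <-> rk_ge (nullspace A) [set 0] n) /\
   (rk_ge setT (range (shift A nu)) n <-> rk_ge setT (range A) n).
Proof.
move=> K; have Acl := K.1.
have [e1 e10 h1] : exists2 e : R, 0 < e & forall nu, nrm nu < e ->
   (rk_ge (nullspace (shift A nu)) [set 0] n <-> rk_ge (nullspace A) [set 0] n).
  have [h|] := pselect (rk_ge (nullspace A) [set 0] n).
    by have [e e0 eP] := kato_rk_null_ge K h; exists e => // nu /eP.
  case: n => [/(_ (rk_ge0 _ _)) //|n] h.
  by have [e e0 eP] := rk_null_lt Acl h; exists e => // nu /eP.
have [e2 e20 h2] : exists2 e : R, 0 < e & forall nu, nrm nu < e ->
   (rk_ge setT (range (shift A nu)) n <-> rk_ge setT (range A) n).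
  have [h|] := pselect (rk_ge setT (range A) n).
    by have [e e0 eP] := kato_rk_range_ge K h; exists e => // nu /eP.
  case: n {h1} => [/(_ (rk_ge0 _ _)) //|n] h.
  by have [e e0 eP] := rk_range_lt Acl h; exists e => // nu /eP.
exists (Num.min e1 e2); first by rewrite lt_min e10.
by move=> nu; rewrite lt_min => /andP[/h1 ? /h2].
Qed.

(** [kato_local] applies at every point of the disc where the shifts stay Kato, so each condition
    [rk_ge _ _ n] is constant there. The radius comes from [kato_shift] alone and serves all [n],
    which covers infinite nullity and defect. *)
Theorem kato_const (Y : completeNormedModType C) (A : 'L(Y)) : Kato A ->
  exists2 e : R, 0 < e & forall nu, nrm nu < e ->
    [/\ Kato (shift A nu), alpha (shift A nu) = alpha A &
        beta (shift A nu) = beta A].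
Proof.
move=> K; have [e e0 eK] := kato_shift K; exists e => // nu nue.
have eqE (B1 B2 : 'L(Y)) : (forall x, B1 x = B2 x) -> bop B1 = bop B2 :> (Y -> Y).
  by move=> h; apply/funext.
have s0 : bop (shift A 0) = bop A :> (Y -> Y).
  by apply/funext => x; rewrite /= /shift_fun scale0r subr0.
have ss mu nu' : bop (shift (shift A mu) (nu' - mu)) = bop (shift A nu') :> (Y -> Y).
  by apply/funext => x; exact: shift_shift.
have h n : (rk_ge (nullspace (shift A nu)) [set 0] n <-> rk_ge (nullspace A) [set 0] n) /\
   (rk_ge setT (range (shift A nu)) n <-> rk_ge setT (range A) n).
  split.
    rewrite -[X in _ <-> X]/(rk_ge [set x | A x = 0] [set 0] n) -s0.
    apply: (@disc_const e (fun nu => rk_ge (nullspace (shift A nu)) [set 0] n)) => //.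
    move=> mu /eK/kato_local-/(_ n)[d d0 dP]; exists d => // nu' /dP[+ _].
    by rewrite /nullspace ss.
  rewrite -s0.
  apply: (@disc_const e (fun nu => rk_ge setT (range (shift A nu)) n)) => //.
  move=> mu /eK/kato_local-/(_ n)[d d0 dP]; exists d => // nu' /dP[_].
  by rewrite ss.
split; first exact: eK.
  by apply: le_anti; apply/andP; split; apply: le_erk => n; case: (h n) => -[].
by apply: le_anti; apply/andP; split; apply: le_erk => n; case: (h n) => _ [].
Qed.

End Indices.

(** * Similarity of operators and external direct sums *)

Section Similarity.
Context {R : realType}.
Local Notation C := (R[i]).
Implicit Types Y : completeNormedModType C.

Definition sim Y Y' (T : 'L(Y)) (T' : 'L(Y')) : Prop :=
  exists (J : {linear Y -> Y'}) (G : {linear Y' -> Y}),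
    [/\ continuous J, continuous G, cancel J G, cancel G J &
        forall x, J (T x) = T' (J x)].

Lemma id_linear Y : linear (fun x : Y => x). Proof. by []. Qed.

Lemma id_continuous_lin Y : continuous (mklin (@id_linear Y)).
Proof. by apply/continuousP_nrm; exists 1 => // x /=; rewrite mul1r. Qed.

Lemma sim_ext Y (T T' : 'L(Y)) : (forall x, T x = T' x) -> sim T T'.
Proof.
by move=> TT'; exists (mklin (@id_linear Y)), (mklin (@id_linear Y)); split => //=;
  exact: id_continuous_lin.
Qed.

Lemma sim_refl Y (T : 'L(Y)) : sim T T. Proof. exact: sim_ext. Qed.

Lemma sim_sym Y Y' (T : 'L(Y)) (T' : 'L(Y')) : sim T T' -> sim T' T.
Proof.
move=> [J [G [Jc Gc JG GJ JT]]]; exists G, J; split=> [||||x] //.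
by apply: (can_inj JG); rewrite GJ JT GJ.
Qed.

Lemma comp_linear (U V W : lmodType C) (f : {linear V -> W}) (g : {linear U -> V}) :
  linear (f \o g).
Proof. by move=> a x y /=; rewrite !linearP. Qed.

Lemma comp_continuous_lin (U V W : normedModType C) (f : {linear V -> W})
    (g : {linear U -> V}) : continuous f -> continuous g ->
  continuous (mklin (comp_linear f g)).
Proof.
move=> /continuousP_nrm[M M0 fM] /continuousP_nrm[N N0 gN].
apply/continuousP_nrm; exists (M * N); first exact: mulr_gt0.
by move=> x /=; apply: le_trans (fM _) _; rewrite -mulrA ler_wpM2l ?(ltW M0).
Qed.

Lemma sim_trans Y1 Y2 Y3 (T1 : 'L(Y1)) (T2 : 'L(Y2)) (T3 : 'L(Y3)) :
  sim T1 T2 -> sim T2 T3 -> sim T1 T3.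
Proof.
move=> [J [G [Jc Gc JG GJ JT]]] [J' [G' [Jc' Gc' JG' GJ' JT']]].
exists (mklin (comp_linear J' J)), (mklin (comp_linear G G')); split.
- exact: comp_continuous_lin.
- exact: comp_continuous_lin.
- by move=> x /=; rewrite JG' JG.
- by move=> x /=; rewrite GJ GJ'.
- by move=> x /=; rewrite JT JT'.
Qed.

Lemma sim_shift Y Y' (T : 'L(Y)) (T' : 'L(Y')) l :
  sim T T' -> sim (shift T l) (shift T' l).
Proof.
move=> [J [G [Jc Gc JG GJ JT]]]; exists J, G; split => // x.
by rewrite /= /shift_fun linearB linearZ /= JT.
Qed.

Section DirectSum.
Variables (Y1 Y2 : completeNormedModType C) (T1 : 'L(Y1)) (T2 : 'L(Y2)).

Definition dsum_fun (p : psum Y1 Y2) : psum Y1 Y2 := (T1 p.1, T2 p.2).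

Lemma dsum_linear : linear dsum_fun.
Proof. by move=> a p q; rewrite /dsum_fun psum_lin1 psum_lin2 !linearP. Qed.

Lemma dsum_continuous : continuous (mklin dsum_linear).
Proof.
have [M M0 T1M] := (continuousP_nrm T1).1 (@bop_continuous _ _ T1).
have [N N0 T2N] := (continuousP_nrm T2).1 (@bop_continuous _ _ T2).
apply/continuousP_nrm; exists (M + N); first exact: addr_gt0.
move=> p; apply: le_trans (nrm_psum _) _; rewrite mulrDl /= lerD //.
  by apply: le_trans (T1M _) _; rewrite ler_wpM2l ?(ltW M0) // nrm_psuml.
by apply: le_trans (T2N _) _; rewrite ler_wpM2l ?(ltW N0) // nrm_psumr.
Qed.

Definition dsum : 'L(psum Y1 Y2) := BoundedOperator dsum_continuous.

End DirectSum.

Lemma psum_map_linear Y1 Y2 Y3 Y4 (f : {linear Y1 -> Y3}) (g : {linear Y2 -> Y4}) :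
  linear (fun p : psum Y1 Y2 => (f p.1, g p.2) : psum Y3 Y4).
Proof. by move=> a p q; rewrite psum_lin1 psum_lin2 !linearP. Qed.

Lemma psum_map_continuous Y1 Y2 Y3 Y4 (f : {linear Y1 -> Y3})
    (g : {linear Y2 -> Y4}) : continuous f -> continuous g ->
  continuous (mklin (psum_map_linear f g)).
Proof.
move=> /continuousP_nrm[M M0 fM] /continuousP_nrm[N N0 gN].
apply/continuousP_nrm; exists (M + N); first exact: addr_gt0.
move=> p; apply: le_trans (nrm_psum _) _; rewrite mulrDl /= lerD //.
  by apply: le_trans (fM _) _; rewrite ler_wpM2l ?(ltW M0) // nrm_psuml.
by apply: le_trans (gN _) _; rewrite ler_wpM2l ?(ltW N0) // nrm_psumr.
Qed.

Lemma sim_dsum Y1 Y2 Y3 Y4 (T1 : 'L(Y1)) (T2 : 'L(Y2)) (T3 : 'L(Y3))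
    (T4 : 'L(Y4)) : sim T1 T3 -> sim T2 T4 -> sim (dsum T1 T2) (dsum T3 T4).
Proof.
move=> [J [G [Jc Gc JG GJ JT]]] [J' [G' [Jc' Gc' JG' GJ' JT']]].
exists (mklin (psum_map_linear J J')), (mklin (psum_map_linear G G')); split.
- exact: psum_map_continuous.
- exact: psum_map_continuous.
- by move=> [x y] /=; rewrite JG JG'.
- by move=> [x y] /=; rewrite GJ GJ'.
- by move=> [x y]; rewrite /= /dsum_fun /= JT JT'.
Qed.

Lemma sim_dsumC Y1 Y2 (T1 : 'L(Y1)) (T2 : 'L(Y2)) :
  sim (dsum T1 T2) (dsum T2 T1).
Proof.
have sl (U V : completeNormedModType C) :
    linear (fun p : psum U V => (p.2, p.1) : psum V U) by [].
have sc (U V : completeNormedModType C) : continuous (mklin (sl U V)).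
  apply/continuousP_nrm; exists 2 => // p; apply: le_trans (nrm_psum _) _ => /=.
  by have := nrm_psuml p; have := nrm_psumr p; lra.
by exists (mklin (sl Y1 Y2)), (mklin (sl Y2 Y1)); split => [||[]|[]|[]] //; exact: sc.
Qed.

Lemma sim_dsumA Y1 Y2 Y3 (T1 : 'L(Y1)) (T2 : 'L(Y2)) (T3 : 'L(Y3)) :
  sim (dsum T1 (dsum T2 T3)) (dsum (dsum T1 T2) T3).
Proof.
have sl : linear (fun p : psum Y1 (psum Y2 Y3) =>
    ((p.1, p.2.1), p.2.2) : psum (psum Y1 Y2) Y3) by [].
have sl' : linear (fun p : psum (psum Y1 Y2) Y3 =>
    (p.1.1, (p.1.2, p.2)) : psum Y1 (psum Y2 Y3)) by [].
exists (mklin sl), (mklin sl'); split => [||[? []]|[[]]|[? []]] //.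
- apply/continuousP_nrm; exists 3 => // p.
  apply: le_trans (nrm_psum _) _; apply: le_trans (lerD (nrm_psum _) (lexx _)) _.
  have := nrm_psuml p; have := nrm_psumr p; have := nrm_psuml p.2.
  by have := nrm_psumr p.2; rewrite /=; lra.
- apply/continuousP_nrm; exists 3 => // p.
  apply: le_trans (nrm_psum _) _; apply: le_trans (lerD (lexx _) (nrm_psum _)) _.
  have := nrm_psuml p; have := nrm_psumr p; have := nrm_psuml p.1.
  by have := nrm_psumr p.1; rewrite /=; lra.
Qed.

Lemma shift_dsum Y1 Y2 (T1 : 'L(Y1)) (T2 : 'L(Y2)) l :
  sim (shift (dsum T1 T2) l) (dsum (shift T1 l) (shift T2 l)).
Proof. exact: sim_ext. Qed.

Lemma sim_range_closed Y Y' (T : 'L(Y)) (T' : 'L(Y')) :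
  sim T T' -> closed (range T) -> closed (range T').
Proof.
move=> [J [G [/continuousP_nrm[M M0 JM] /continuousP_nrm[N N0 GN] JG GJ JT]]].
move=> /closed_nrm Tcl; apply/closed_nrm => y yT.
have [x _ xE] : range T (G y).
  apply: Tcl => e e0; have [|_ [x _ <-] xe] := yT (e / N); first by rewrite divr_gt0.
  exists (T (G x)); first by exists (G x).
  rewrite -(JG (T _)) JT GJ -linearB; apply: le_lt_trans (GN _) _.
  by rewrite mulrC -ltr_pdivlMr.
by exists (J x) => //; rewrite -JT xE GJ.
Qed.

Lemma sim_alpha Y Y' (T : 'L(Y)) (T' : 'L(Y')) : sim T T' -> alpha T = alpha T'.
Proof.
move=> [J [G [_ _ JG GJ JT]]].
have GT x : G (T' x) = T (G x) by rewrite -(JG (T _)) JT GJ.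
apply: le_anti; apply/andP; split; apply: le_erk => n.
  apply: (@rk_ge_map _ _ _ J) => [x Tx|x /= Jx].
    by rewrite /nullspace /= -JT Tx linear0.
  by rewrite -(JG x) Jx linear0.
apply: (@rk_ge_map _ _ _ G) => [x Tx|x /= Gx].
  by rewrite /nullspace /= -GT Tx linear0.
by rewrite -(GJ x) Gx linear0.
Qed.

Lemma sim_beta Y Y' (T : 'L(Y)) (T' : 'L(Y')) : sim T T' -> beta T = beta T'.
Proof.
move=> [J [G [_ _ JG GJ JT]]].
have GT x : G (T' x) = T (G x) by rewrite -(JG (T _)) JT GJ.
apply: le_anti; apply/andP; split; apply: le_erk => n.
  apply: (@rk_ge_map _ _ _ J) => // x [y _ yx].
  by exists (G y) => //; rewrite -GT yx JG.
apply: (@rk_ge_map _ _ _ G) => // x [y _ yx].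
by exists (J y) => //; rewrite -JT yx GJ.
Qed.

Lemma sim_class c Y Y' (T : 'L(Y)) (T' : 'L(Y')) :
  sim T T' -> in_class c T -> in_class c T'.
Proof.
move=> TT' /in_classP[Tcl Tc]; apply/in_classP; split.
  exact: sim_range_closed TT' Tcl.
by rewrite -(sim_alpha TT') -(sim_beta TT').
Qed.

Lemma sim_Kato Y Y' (T : 'L(Y)) (T' : 'L(Y')) : sim T T' -> Kato T -> Kato T'.
Proof.
move=> TT' [Tcl NT]; split; first exact: sim_range_closed TT' Tcl.
have [J [G [_ _ JG GJ JT]]] := TT'.
have GT x : G (T' x) = T (G x) by rewrite -(JG (T _)) JT GJ.
have JTn n x : J (iter n T x) = iter n T' (J x).
  by elim: n => //= n IH; rewrite JT IH.
move=> n x T'x; have [|y _ yx] := NT n (G x).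
  by rewrite /nullspace /= -GT T'x linear0.
by exists (J y) => //; rewrite -JTn yx GJ.
Qed.

Lemma alpha_dsum Y1 Y2 (T1 : 'L(Y1)) (T2 : 'L(Y2)) :
  alpha (dsum T1 T2) = (alpha T1 + alpha T2)%E.
Proof.
transitivity (erk (nullspace T1 `*` nullspace T2) ([set 0] `*` [set 0])).
  congr erk; apply/seteqP; split => -[x y].
  - by rewrite /nullspace /= /dsum_fun /=; case.
  - by rewrite /nullspace /= /dsum_fun /=; case=> -> ->.
  - by case=> -> ->.
  - by case=> /= -> ->.
by apply: erk_prod; [exact: subsp_ker|exact: subsp0|exact: subsp_ker|exact: subsp0].
Qed.

Lemma beta_dsum Y1 Y2 (T1 : 'L(Y1)) (T2 : 'L(Y2)) :
  beta (dsum T1 T2) = (beta T1 + beta T2)%E.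
Proof.
transitivity (erk (setT `*` setT) (range T1 `*` range T2)).
  congr erk; first by apply/seteqP; split => -[].
  apply/seteqP; split => [_ [[x y] _ <-]|[_ _] /= [[x _ <-] [y _ <-]]].
    by split; [exists x|exists y].
  by exists (x, y).
by apply: erk_prod; [split|exact: subsp_range|split|exact: subsp_range].
Qed.

Lemma dsum_range_closed Y1 Y2 (T1 : 'L(Y1)) (T2 : 'L(Y2)) :
  closed (range T1) -> closed (range T2) -> closed (range (dsum T1 T2)).
Proof.
move=> /closed_nrm c1 /closed_nrm c2; apply/closed_nrm => y yT.
have [x1 _ x1E] : range T1 y.1.
  apply: c1 => e /yT[_ [x _ <-] xe]; exists (T1 x.1); first by exists x.1.
  exact: le_lt_trans (nrm_psuml (y - dsum T1 T2 x)) xe.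
have [x2 _ x2E] : range T2 y.2.
  apply: c2 => e /yT[_ [x _ <-] xe]; exists (T2 x.2); first by exists x.2.
  exact: le_lt_trans (nrm_psumr (y - dsum T1 T2 x)) xe.
by exists (x1, x2) => //; rewrite /= /dsum_fun /= x1E x2E -surjective_pairing.
Qed.

Lemma dsum_range_closedl Y1 Y2 (T1 : 'L(Y1)) (T2 : 'L(Y2)) :
  closed (range (dsum T1 T2)) -> closed (range T1).
Proof.
move=> /closed_nrm c; apply/closed_nrm => y yT.
have [|[x1 x2] _ []] := c (y, 0).
  move=> e /yT[_ [x _ <-] xe]; exists (T1 x, 0).
    by exists (x, 0) => //; rewrite /= /dsum_fun /= linear0.
  apply: le_lt_trans (nrm_psum _) _ => /=.
  by rewrite [0 - 0]subr0 nrm0 addr0.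
by exists x1.
Qed.

Lemma class_dsum_inv c Y1 Y2 (T : 'L(Y1)) (S : 'L(Y2)) : invertible S ->
  in_class c (dsum T S) <-> in_class c T.
Proof.
move=> /invertibleP[Scl S0 S1]; rewrite !in_classP alpha_dsum beta_dsum S0 S1 !adde0.
split=> -[Tcl Tc]; split => //; first exact: dsum_range_closedl Tcl.
exact: dsum_range_closed.
Qed.

Lemma dsum_invertible Y1 Y2 (T : 'L(Y1)) (S : 'L(Y2)) :
  invertible (dsum T S) <-> invertible T /\ invertible S.
Proof.
split=> [[H [HT TH]]|[[G [GT TG]] [H [HS SH]]]]; last first.
  exists (dsum G H); split => -[x y]; rewrite /= /dsum_fun /=.
    by rewrite GT HS.
  by rewrite TG SH.
have inv : in_class CInv (dsum T S) by exists H.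
have /in_classP[cl [a0 b0]] := inv.
have /alpha0 ai := a0; have /beta0 bs := b0.
have cS : closed (range S).
  apply: (@dsum_range_closedl _ _ S T).
  exact: sim_range_closed (sim_dsumC T S) cl.
have nn (x y : \bar R) : (0 <= x)%E -> (0 <= y)%E -> (x + y = 0)%E -> x = 0%E /\ y = 0%E.
  move=> x0 y0 /eqP; rewrite padde_eq0 //; by move=> /andP[/eqP -> /eqP ->].
move: a0 b0; rewrite alpha_dsum beta_dsum.
move=> /nn[]; [exact: erk_ge0|exact: erk_ge0|] => aT aS.
move=> /nn[]; [exact: erk_ge0|exact: erk_ge0|] => bT bS.
split; apply/invertibleP; split => //; exact: dsum_range_closedl cl.
Qed.

(** Addition from [M] and [N] to [Y] is a continuous bijection; the open mapping theorem makes its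
    inverse continuous. *)
Lemma red_sim Y (T : 'L(Y)) (M N : closed_subspace Y)
    (TM : invariant_subspace T M) (TN : invariant_subspace T N) :
  cs_set M `&` cs_set N = [set 0] ->
  (forall x, exists y z, [/\ cs_set M y, cs_set N z & x = y + z]) ->
  sim T (dsum (restr TM) (restr TN)).
Proof.
move=> MN0 MN; apply: sim_sym.
pose S (p : psum (cs_type M) (cs_type N)) : Y := cs_val p.1 + cs_val p.2.
have Sl : linear S.
  by move=> a p q; rewrite /S psum_lin1 psum_lin2 /= scalerDr addrACA.
have Sc : continuous (mklin Sl).
  apply/continuousP_nrm; exists 2 => // p; apply: le_trans (nrmD _ _) _.
  by have := nrm_psuml p; have := nrm_psumr p; rewrite !nrm_cs; lra.
have [|c c0 cP] := open_mapping Sc.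
  move=> x; have [y [z [My Nz ->]]] := MN x.
  by exists (CsType (mem_set My : y \in cs_pred M), CsType (mem_set Nz : z \in cs_pred N)).
have Sinj : injective S.
  move=> p q pq; apply/eqP; rewrite -subr_eq0; apply/eqP.
  have S0 : S (p - q) = 0 by rewrite -[S]/(mklin Sl : _ -> _) linearB /= pq subrr.
  have : (cs_set M `&` cs_set N) (cs_val (p - q).1).
    split; first exact: set_mem (cs_valP _).
    move: S0; rewrite /S => /eqP; rewrite addr_eq0 => /eqP ->.
    by rewrite -scaleN1r; apply: (subspZ _ (subsp_cs N)); exact: set_mem (cs_valP _).
  rewrite MN0 => p1; have {}p1 : cs_val (p - q).1 = 0 := p1.
  move: S0; rewrite /S p1 add0r => p2.
  rewrite [LHS]surjective_pairing.
  by congr pair; apply: val_inj.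
have /choice[G GP] : forall x, exists p, S p = x /\ nrm p <= c * nrm x.
  by move=> x; have [p] := cP x; exists p.
have Gl : linear G.
  move=> a x y; apply: Sinj; rewrite (GP _).1 Sl.
  by rewrite (GP x).1 (GP y).1.
exists (mklin Sl), (mklin Gl); split => //.
- by apply/continuousP_nrm; exists c => // x; exact: (GP x).2.
- by move=> p; apply: Sinj; rewrite (GP _).1.
- by move=> x; exact: (GP x).1.
- by move=> [x y]; rewrite /= /S /= linearD.
Qed.

Lemma sim_red Y Y1 Y2 (T : 'L(Y)) (T1 : 'L(Y1)) (T2 : 'L(Y2)) :
  sim T (dsum T1 T2) -> exists (M N : closed_subspace Y) (r : Red T M N),
    sim (restr (red_l r)) T1 /\ sim (restr (red_r r)) T2.
Proof.
move=> [J [G [Jc Gc JG GJ JT]]].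
have [K K0 JK] := (continuousP_nrm J).1 Jc.
have [L L0 GL] := (continuousP_nrm G).1 Gc.
have Mc : closed [set x | (J x).2 = 0].
  apply/closed_nrm => x xP; apply: nrm_eq0; apply/eqP; rewrite eq_le nrm_ge0 andbT.
  apply/ler_addgt0Pr => e e0; rewrite add0r.
  have [|y /= y2 xy] := xP (e / K); first by rewrite divr_gt0.
  have -> : (J x).2 = (J (x - y)).2 by rewrite linearB /= [RHS]/= y2 subr0.
  apply: le_trans (nrm_psumr _) _; apply: le_trans (JK _) _.
  by rewrite mulrC -ler_pdivlMr // ltW.
have Nc : closed [set x | (J x).1 = 0].
  apply/closed_nrm => x xP; apply: nrm_eq0; apply/eqP; rewrite eq_le nrm_ge0 andbT.
  apply/ler_addgt0Pr => e e0; rewrite add0r.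
  have [|y /= y2 xy] := xP (e / K); first by rewrite divr_gt0.
  have -> : (J x).1 = (J (x - y)).1 by rewrite linearB /= [RHS]/= y2 subr0.
  apply: le_trans (nrm_psuml _) _; apply: le_trans (JK _) _.
  by rewrite mulrC -ler_pdivlMr // ltW.
have J0 : J 0 = 0 by exact: linear0.
have M0 : (J 0).2 = 0 by rewrite J0.
have N0 : (J 0).1 = 0 by rewrite J0.
have Ml (a : C) x y : (J x).2 = 0 -> (J y).2 = 0 -> (J (a *: x + y)).2 = 0.
  by rewrite linearP psum_lin2 => -> ->; rewrite scaler0 addr0.
have Nl (a : C) x y : (J x).1 = 0 -> (J y).1 = 0 -> (J (a *: x + y)).1 = 0.
  by rewrite linearP psum_lin1 => -> ->; rewrite scaler0 addr0.
pose M := ClosedSubspace M0 Ml Mc; pose N := ClosedSubspace N0 Nl Nc.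
have TM : invariant_subspace T M.
  by move=> x /= Mx; rewrite JT /= Mx linear0.
have TN : invariant_subspace T N.
  by move=> x /= Nx; rewrite JT /= Nx linear0.
have i1l : linear (fun x : Y1 => G (x, 0)).
  move=> a x y; rewrite -linearP; congr (G _).
  by rewrite [RHS]surjective_pairing psum_lin1 psum_lin2 /= scaler0 addr0.
have i2l : linear (fun x : Y2 => G (0, x)).
  move=> a x y; rewrite -linearP; congr (G _).
  by rewrite [RHS]surjective_pairing psum_lin1 psum_lin2 /= scaler0 addr0.
have r : Red T M N.
  split => //.
    apply/seteqP; split=> [x [/= Mx Nx]|_ ->]; last by split; [exact: M0|exact: N0].
    by rewrite -(JG x) [J x]surjective_pairing Mx Nx -[(0, 0)]/(0 : psum Y1 Y2) linear0.
  move=> x; exists (G ((J x).1, 0)), (G (0, (J x).2)); split => /=; rewrite ?GJ //.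
  rewrite -linearD -[LHS](JG x); congr (G _).
  by rewrite [LHS]surjective_pairing -[_ + _]/((J x).1 + 0, 0 + (J x).2) addr0 add0r.
exists M, N, r; split.
  pose f (x : cs_type M) := (J (cs_val x)).1.
  have fl : linear f by move=> a x y; rewrite /f /= linearP.
  have gM x : cs_set M (mklin i1l x) by rewrite /= GJ.
  exists (mklin fl), (mklin (corestr_linear gM)); split.
  - apply/continuousP_nrm; exists K => // x; apply: le_trans (nrm_psuml _) _.
    exact: JK.
  - apply/continuousP_nrm; exists L => // x; rewrite nrm_cs /=.
    apply: le_trans (GL _) _; rewrite ler_wpM2l ?(ltW L0) //.
    by apply: le_trans (nrm_psum _) _; rewrite /= nrm0 addr0.
  - move=> [x xM]; apply: val_inj; rewrite /= /f /=.
    have /= <- := set_mem xM; by rewrite -surjective_pairing JG.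
  - by move=> x; rewrite /= /f /= GJ.
  - by move=> x; rewrite /= /f /= JT.
pose f (x : cs_type N) := (J (cs_val x)).2.
have fl : linear f by move=> a x y; rewrite /f /= linearP.
have gN x : cs_set N (mklin i2l x) by rewrite /= GJ.
exists (mklin fl), (mklin (corestr_linear gN)); split.
- apply/continuousP_nrm; exists K => // x; apply: le_trans (nrm_psumr _) _.
  exact: JK.
- apply/continuousP_nrm; exists L => // x; rewrite nrm_cs /=.
  apply: le_trans (GL _) _; rewrite ler_wpM2l ?(ltW L0) //.
  by apply: le_trans (nrm_psum _) _; rewrite /= nrm0 add0r.
- move=> [x xN]; apply: val_inj; rewrite /= /f /=.
  have /= <- := set_mem xN; by rewrite -surjective_pairing JG.
- by move=> x; rewrite /= /f /= GJ.
- by move=> x; rewrite /= /f /= JT.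
Qed.

End Similarity.

(** * Splitting Jordan blocks off a semi-Fredholm operator *)

Section KatoDecomposition.
Context {R : realType}.
Local Notation C := (R[i]).
Implicit Types Y : completeNormedModType C.

Definition nilpotent_op Y (F : 'L(Y)) : Prop := exists n, forall x, iter n F x = 0.

Lemma ker_cs Y (P : {linear Y -> Y}) : continuous P ->
  exists M : closed_subspace Y, cs_set M = [set x | P x = 0].
Proof.
move=> Pc; exists (preim_cs (zero_cs Y) Pc).
by apply/seteqP; split.
Qed.

Lemma fix_cs Y (P : {linear Y -> Y}) : continuous P ->
  exists M : closed_subspace Y, cs_set M = [set x | P x = x].
Proof.
move=> Pc; have Ql : linear (fun x => x - P x).
  by move=> a x y; rewrite linearP scalerBr opprD addrACA.
have Qc : continuous (mklin Ql).
  have [M M0 PM] := (continuousP_nrm P).1 Pc.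
  apply/continuousP_nrm; exists (1 + M); first exact: addr_gt0.
  by move=> x /=; apply: le_trans (nrmB _ _) _; rewrite mulrDl mul1r lerD2l.
have [M ME] := ker_cs Qc; exists M; rewrite ME; apply/seteqP; split => x /=.
  by move=> /eqP; rewrite subr_eq0 => /eqP.
by move=> ->; rewrite subrr.
Qed.

Lemma proj_split Y (T : 'L(Y)) (P : {linear Y -> Y}) : continuous P ->
  (forall x, P (P x) = P x) -> (forall x, P (T x) = T (P x)) ->
  exists (M N : closed_subspace Y) (TM : invariant_subspace T M)
    (TN : invariant_subspace T N),
    [/\ cs_set M = [set x | P x = 0], cs_set N = [set x | P x = x] &
        sim T (dsum (restr TM) (restr TN))].
Proof.
move=> Pc PP PT; have [M ME] := ker_cs Pc; have [N NE] := fix_cs Pc.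
have TM : invariant_subspace T M.
  by move=> x; rewrite ME /= => Px; rewrite PT Px linear0.
have TN : invariant_subspace T N by move=> x; rewrite NE /= => Px; rewrite PT Px.
exists M, N, TM, TN; split => //; apply: red_sim.
  rewrite ME NE; apply/seteqP; split=> x /=; first by case=> -> .
  by move=> ->; rewrite linear0.
move=> x; exists (x - P x), (P x); rewrite ME NE /=; split => //.
- by rewrite linearB PP subrr.
- exact: PP.
- by rewrite subrK.
Qed.

Lemma iterA Y (A : 'L(Y)) n m x : iter n A (iter m A x) = iter (n + m) A x.
Proof. by rewrite iterD. Qed.

Lemma iter_op0 Y (A : 'L(Y)) n : iter n A 0 = 0.
Proof. by elim: n => //= n ->; rewrite linear0. Qed.

(* Replacing [y] by [y - f (A^m y) A^(n-1-m) y] kills one more of the values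
   [f (A^m y)], [m < n - 1], without changing [A^(n-1) y]. *)
Lemma adjust_chain Y (A : 'L(Y)) (f : {linear Y -> C}) n (y : Y) :
  iter n.+1 A y = 0 -> f (iter n A y) = 1 ->
  exists y', [/\ iter n A y' = iter n A y, iter n.+1 A y' = 0 &
    forall m, (m < n)%N -> f (iter m A y') = 0].
Proof.
move=> y0 fy.
suff H k : (k <= n)%N -> exists y', [/\ iter n A y' = iter n A y,
    iter n.+1 A y' = 0 &
    forall m, (n - k <= m < n)%N -> f (iter m A y') = 0].
  have [y' [h1 h2 h3]] := H n (leqnn n); exists y'; split => // m mn.
  by apply: h3; rewrite subnn.
elim: k => [|k IH] kn.
  exists y; split => // m; rewrite subn0 => /andP[nm mn].
  by move: (leq_ltn_trans nm mn); rewrite ltnn.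
have [y' [h1 h2 h3]] := IH (ltnW kn).
have big m : (n < m)%N -> iter m A y' = 0.
  move=> nm; rewrite -(subnK nm) -iterA h2; exact: iter_op0.
pose c := f (iter (n - k.+1) A y').
have iB m : iter m A (y' - c *: iter k.+1 A y') =
    iter m A y' - c *: iter (m + k.+1) A y'.
  rewrite -iterA; apply: (etrans (linearB (mklin (iter_linear A m)) _ _)).
  by congr (_ - _); exact: (linearZ_LR (mklin (iter_linear A m))).
exists (y' - c *: iter k.+1 A y'); split.
- by rewrite iB (big (n + _)%N) ?scaler0 ?subr0 //; lia.
- by rewrite iB h2 (big (n.+1 + _)%N) ?scaler0 ?subr0 //; lia.
- move=> m /andP[nm mn]; rewrite iB linearB linearZ /=.
  have [nm'|nm'] := leqP (n - k) m.
    rewrite (big (m + _)%N); last by lia.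
    by rewrite linear0 scaler0 subr0 h3 // nm'.
  have -> : m = (n - k.+1)%N by apply/eqP; rewrite eqn_leq nm andbT -ltnS subnSK.
  by rewrite subnK // h1 fy [_ *: _]mulr1 subrr.
Qed.

(** For the least power whose range misses a kernel vector [x], write [x] as the previous power of
    [A] applied to [y]: the iterates of [y] form a Jordan chain ending at [x]. A functional [f] with
    [f x = 1], zero on that range, gives a dual chain by composition with powers of [A], and the
    resulting finite-rank projection commutes with [A]. *)
Lemma kato_step Y (A : 'L(Y)) : closed (range A) -> ~ Kato A ->
  exists (Y1 Y2 : completeNormedModType C) (A1 : 'L(Y1)) (F : 'L(Y2)),
    [/\ sim A (dsum A1 F), nilpotent_op F, alpha F = 1%E & beta F = 1%E].
Proof.
move=> Acl nK.
have [n nP nmin] : exists2 n, ~ nullspace A `<=` range (iter n A) &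
    forall k, (k < n)%N -> nullspace A `<=` range (iter k A).
  have ex : exists n, `[< ~ nullspace A `<=` range (iter n A) >].
    apply: contrapT => nex; apply: nK; split=> // n; apply: contrapT => h.
    by apply: nex; exists n; apply/asboolP.
  exists (ex_minn ex); case: ex_minnP => n /asboolP // _ nmin k kn.
  apply: contrapT => h; have /nmin : `[< ~ nullspace A `<=` range (iter k A) >].
    exact/asboolP.
  by rewrite leqNgt kn.
(* The zeroth power has full range, so the least exponent is a successor [n.+1]. *)
case: n nP nmin => [nP|n nP nmin].
  by exfalso; apply: nP => x _; exists x.
have [x Ax nx] : exists2 x, A x = 0 & ~ range (iter n.+1 A) x.
  apply: contrapT => h; apply: nP => x Ax; apply: contrapT => nx; apply: h.
  by exists x.
have [y0 _ y0x] := nmin n (ltnSn n) x Ax.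
have Rcl : closed (range (mklin (iter_linear A n.+1))).
  exact: (@range_iter_closed _ _ A n.+1).
have [f [fc fx fR]] := @hahn_banach _ _ (range_cs Rcl) x nx.
have fA z m : (n < m)%N -> f (iter m A z) = 0.
  move=> nm; apply: fR; rewrite -(subnKC nm) -iterA.
  by exists (iter (m - n.+1) A z).
have y00 : iter n.+1 A y0 = 0 by rewrite iterS y0x.
have fy0 : f (iter n A y0) = 1 by rewrite y0x.
have [y [yx y1 yf]] := adjust_chain y00 fy0.
rewrite y0x in yx.
have big m : (n < m)%N -> iter m A y = 0.
  by move=> nm; rewrite -(subnK nm) -iterA y1; exact: iter_op0.
(* [g i] is dual to [e i]: [f (iter m A y)] is 1 for [m = n], vanishes for [m < n] thanks to
   [adjust_chain], and for [m > n] since [f] kills the range of the power [n.+1]. *)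
have [g [gc gE]] : exists g : 'I_n.+1 -> {linear Y -> C},
    (forall i, continuous (g i)) /\ forall i z, g i z = f (iter (n - i) A z).
  exists (fun i => mklin (comp_linear f (mklin (iter_linear A (n - i))))).
  split=> [i|i z]; last by [].
  exact: (comp_continuous_lin fc
    (@iter_bounded _ _ A (n - i)%N (@bop_continuous _ _ A))).
pose e (i : 'I_n.+1) := iter i A y.
have ge i j : g i (e j) = (i == j)%:R.
  rewrite gE /e iterA.
  have [ij|ij|/val_inj ->] := ltngtP (val i) (val j).
  - rewrite fA; first by rewrite -val_eqE /= ltn_eqF.
    by move: (ltn_ord j) ij => /=; lia.
  - rewrite yf; first by rewrite -val_eqE /= gtn_eqF.
    by move: (ltn_ord i) ij => /=; lia.
  - by rewrite subnK ?leq_ord // yx fx eqxx.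
have Pl : linear (fun z => \sum_i g i z *: e i).
  move=> a u v; rewrite scaler_sumr -big_split /=; apply: eq_bigr => i _.
  by rewrite linearP scalerDl scalerA.
pose P := mklin Pl.
have PE z : P z = \sum_i g i z *: e i by [].
have Pc : continuous P.
  by have [M M0 gM] := continuous_sum_nrm e gc; apply/continuousP_nrm; exists M.
clearbody P.
have Pe j : P (e j) = e j.
  rewrite PE (bigD1 j) //= ge eqxx scale1r big1 ?addr0 // => i ij.
  by rewrite ge (negbTE ij) scale0r.
have PP z : P (P z) = P z.
  rewrite (PE z) linear_sum; apply: eq_bigr => i _.
  by rewrite linearZ Pe.
have gA0 z : g ord0 (A z) = 0.
  by rewrite gE subn0 -iterSr fA.
(* One end term drops out of each sum, as [g ord0 (A z) = 0] and [A (e ord_max) = 0]; the others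
   match because [A] raises the index of [e] by one and composition with [A] lowers that of [g]. *)
have PA z : P (A z) = A (P z).
  rewrite !PE linear_sum big_ord_recl gA0 scale0r add0r.
  have Ae0 : A (e ord_max) = 0 by exact: y1.
  rewrite [RHS]big_ord_recr [A (g ord_max z *: _)]linearZ /= Ae0 scaler0 addr0.
  apply: eq_bigr => i _; rewrite linearZ !gE -iterSr.
  have -> : (n - lift ord0 i).+1 = (n - widen_ord (leqnSn n) i)%N.
    by move: (ltn_ord i); rewrite /= /bump /=; lia.
  by [].
have [M [N [AM [AN [ME NE AMN]]]]] := proj_split Pc PP PA.
exists (cs_type M), (cs_type N), (restr AM), (restr AN).
have Nv (z : cs_type N) : P (cs_val z) = cs_val z.
  by have := set_mem (cs_valP z); rewrite NE.
have itN m (z : cs_type N) : cs_val (iter m (restr AN) z) = iter m A (cs_val z).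
  by elim: m => //= m ->.
have Ne i : cs_set N (e i) by rewrite NE; exact: Pe.
pose eN i : cs_type N := CsType (mem_set (Ne i) : e i \in cs_pred N).
have en : e ord_max = x by rewrite /e /= yx.
have x0 : x != 0.
  by apply: contra_notN nx => /eqP ->; exists 0 => //; exact: iter_op0.
split => //.
- exists n.+1 => z; apply: val_inj; rewrite /= -[LHS]/(cs_val (iter n.+1 (restr AN) z)).
  rewrite itN -Nv PE.
  have Ae i : iter n.+1 A (e i) = 0 by rewrite /e iterA big // ltn_addr.
  rewrite -[LHS]/(mklin (iter_linear A n.+1) _) linear_sum big1 // => i _.
  by rewrite linearZ; apply: (etrans (congr1 _ (Ae i))); exact: scaler0.
- apply/(erk_finP _ _ 1); split.
    exists (fun=> eN ord_max) => [i|c].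
      by rewrite /nullspace /=; apply: val_inj; rewrite /= -/(e ord_max) en.
    rewrite big_ord1 /= => /(congr1 (@cs_val _ _ _)) /= /eqP.
    rewrite -/(e ord_max) en scaler_eq0 (negbTE x0) orbF => /eqP c0 i.
    by rewrite (ord1 i).
  apply: (@span_rk _ _ _ _ 1 (fun=> eN ord_max)); first exact: subsp0.
  move=> z /(congr1 (@cs_val _ _ _)) /= Az.
  exists (fun=> f (cs_val z)); rewrite big_ord1 /=; apply: val_inj; rewrite /= -/(e ord_max).
  have gm : g ord_max (cs_val z) = f (cs_val z) by rewrite gE subnn.
  rewrite -gm -[X in X - _](Nv z) PE (bigD1 ord_max) //= big1 ?addr0 ?subrr // => i im.
  have : (0 < n - i)%N.
    rewrite subn_gt0 ltn_neqAle -ltnS ltn_ord andbT.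
    by apply: contra_neq im => im; apply: val_inj.
  by rewrite gE; case: (n - i)%N => // k _; rewrite iterSr Az iter_op0 linear0 scale0r.
(* When the coordinate at [e ord0] vanishes, lowering all indices by one gives a preimage; so the
   defect of the block is 1. *)
- have RE (z : cs_type N) : g ord0 (cs_val z) = 0 -> range (restr AN) z.
    move=> g0.
    have wN : cs_set N (\sum_(i < n) g (lift ord0 i) (cs_val z) *: e (widen_ord (leqnSn n) i)).
      apply: (subsp_sum _ (subsp_cs N)) => i _; exact: (subspZ _ (subsp_cs N)).
    exists (CsType (mem_set wN : _ \in cs_pred N)) => //; apply: val_inj.
    rewrite /= linear_sum -[RHS]Nv PE big_ord_recl g0 scale0r add0r.
    by apply: eq_bigr => i _; rewrite linearZ.
  have Rg (z : cs_type N) : range (restr AN) z -> g ord0 (cs_val z) = 0.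
    by move=> [w _ <-]; exact: gA0.
  apply/(erk_finP _ _ 1); split.
    exists (fun=> eN ord0) => // c; rewrite big_ord1 => /Rg.
    by rewrite linearZ -/(g ord0 _) /= -/(g ord0 (e ord0)) ge eqxx [_ *: _]mulr1 => c0 i; rewrite (ord1 i).
  apply: (@span_rk _ _ _ _ 1 (fun=> eN ord0)); first exact: subsp_range.
  move=> z _; exists (fun=> g ord0 (cs_val z)); rewrite big_ord1; apply: RE.
  rewrite [cs_val _]/(cs_val z - g ord0 (cs_val z) *: e ord0) linearB linearZ ge.
  by rewrite eqxx; exact: (etrans (congr1 _ (congr1 _ (mulr1 _))) (subrr _)).
Qed.

Lemma nilpotent_dsum (Y1 Y2 : completeNormedModType C) (F1 : 'L(Y1)) (F2 : 'L(Y2)) :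
  nilpotent_op F1 -> nilpotent_op F2 -> nilpotent_op (dsum F1 F2).
Proof.
move=> [n F1n] [m F2m]; exists (n + m)%N.
have it k p : iter k (dsum F1 F2) p = (iter k F1 p.1, iter k F2 p.2) :> psum Y1 Y2.
  by elim: k => [|k IH]; [case: p|rewrite iterS IH].
by move=> p; rewrite it addnC -iterA F1n iter_op0 addnC -iterA F2m iter_op0.
Qed.

(** The zero space serves as second summand for operators that need no splitting. *)
Lemma sim_dsum0 Y (T : 'L(Y)) : exists (Z : completeNormedModType C) (F : 'L(Z)),
  [/\ sim T (dsum T F), nilpotent_op F, alpha F = 0%E & beta F = 0%E].
Proof.
pose Z := cs_type (zero_cs Y).
have Z0 (z : Z) : z = 0 by apply: val_inj; exact: (set_mem (cs_valP z)).
have TZ : invariant_subspace T (zero_cs Y) by move=> x ->; exact: linear0.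
exists Z, (restr TZ); split.
- have jl : linear (fun x : Y => (x, 0) : psum Y Z).
    by move=> a x y; rewrite [RHS]surjective_pairing psum_lin1 psum_lin2 scaler0 addr0.
  exists (mklin jl), (mklin (@psum_lin1 _ Y Z)); split.
  + apply/continuousP_nrm; exists 1 => // x; apply: le_trans (nrm_psum _) _.
    by rewrite /= nrm0 addr0 mul1r.
  + by apply/continuousP_nrm; exists 1 => // x; rewrite mul1r; exact: nrm_psuml.
  + by [].
  + by move=> [x z] /=; rewrite (Z0 z).
  + by move=> x; rewrite /= /dsum_fun /= linear0.
- by exists 0%N => z; exact: Z0.
- by apply/alpha0 => z _; exact: Z0.
- by apply/beta0/seteqP; split=> // z _; exists 0 => //; rewrite linear0 [RHS]Z0.
Qed.

(** Induction on whichever of nullity and defect is finite, since [kato_step] lowers both by 1. Once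
    it is 0 no block can be split off, so the operator is Kato. *)
Theorem semi_Fredholm_Kato Y (A : 'L(Y)) : closed (range A) ->
  (alpha A < +oo)%E \/ (beta A < +oo)%E ->
  exists (Y1 Y2 : completeNormedModType C) (K : 'L(Y1)) (F : 'L(Y2)) (d : nat),
    [/\ sim A (dsum K F), Kato K, nilpotent_op F,
        alpha A = (alpha K + d%:R%:E)%E & beta A = (beta K + d%:R%:E)%E].
Proof.
move=> Acl Afin.
have [N AN] : exists N : nat, alpha A = N%:R%:E \/ beta A = N%:R%:E.
  by case: Afin => /erk_lty[N NE]; exists N; [left|right].
elim: N Y A Acl AN {Afin} => [|N IH] Y A Acl AN.
all: have [K|nK] := pselect (Kato A); first by
  have [Z [F [sF nF a0 b0]]] := sim_dsum0 A;
  exists Y, Z, A, F, 0%N; rewrite !adde0; split.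
all: have [Y1 [Y2 [A1 [F [sA nF aF bF]]]]] := kato_step Acl nK.
all: have aA : alpha A = (alpha A1 + 1)%E by rewrite (sim_alpha sA) alpha_dsum aF.
all: have bA : beta A = (beta A1 + 1)%E by rewrite (sim_beta sA) beta_dsum bF.
all: have a0 : (0 <= alpha A1)%E by exact: erk_ge0.
all: have b0 : (0 <= beta A1)%E by exact: erk_ge0.
  exfalso; move: AN; rewrite aA bA.
  have pos (x : \bar R) : (0 <= x)%E -> (x + 1 = 0%:R%:E)%E -> False.
    move=> x_ge0 h; have : (0 < x + 1)%E by rewrite (lt_le_trans lte01) // leeDr.
    by rewrite h ltxx.
  by case; exact: pos.
have A1cl : closed (range A1).
  exact: dsum_range_closedl (sim_range_closed sA Acl).
have [|Z1 [Z2 [K [F' [d [sK KK nF' aK bK]]]]]] := IH _ A1 A1cl.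
  have dec (x : \bar R) : (x + 1 = N.+1%:R%:E)%E -> x = N%:R%:E.
    by case: x => [x| |] //=; rewrite -EFinD -natr1 => -[h]; congr EFin; lra.
  by move: AN; rewrite aA bA => -[/dec|/dec]; [left|right].
exists Z1, (psum Z2 Y2), K, (dsum F' F), d.+1; split => //.
- apply: sim_trans sA _; apply: sim_trans (sim_dsum sK (sim_refl F)) _.
  exact: sim_sym (sim_dsumA _ _ _).
- exact: nilpotent_dsum.
- by rewrite aA aK -natr1 EFinD addeA.
- by rewrite bA bK -natr1 EFinD addeA.
Qed.

End KatoDecomposition.

(** * Poles of the resolvent and meromorphic operators *)

Section Meromorphic.
Context {R : realType}.
Local Notation C := (R[i]).
Implicit Types Y : completeNormedModType C.

Lemma near_punctured (mu : C) (P : C -> Prop) :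
  (\forall l \near mu^', P l) <->
  exists2 r : R, 0 < r & forall l, nrm (l - mu) < r -> l != mu -> P l.
Proof.
split=> [/(@nbhs_nrm R R[i]^o)[r r0 rP]|[r r0 rP]].
  by exists r => // l lr lmu; apply: rP => //; rewrite nrmBC.
apply/(@nbhs_nrm R R[i]^o); exists r => // l lr lmu.
by apply: rP => //; rewrite nrmBC.
Qed.

Lemma geo_tail (t : R) a j : 0 <= t <= 2^-1 ->
  \sum_(i < j) t ^+ (a + i) + 2 * t ^+ (a + j) <= 2 * t ^+ a.
Proof.
move=> /andP[t0 t1]; elim: j => [|j IH]; first by rewrite big_ord0 add0r addn0.
rewrite big_ord_recr /= -addrA; apply: le_trans IH; rewrite lerD2l.
rewrite addnS exprS; have := exprn_ge0 (a + j) t0; nra.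
Qed.

(** Convergence at one point [s0] bounds all terms there by some [M]. If the coefficients before [m]
    vanish, evaluation at [t s0] and division by the [m]-th power of [t] bound the [m]-th term at
    [s0] by [2 * M * t], for every small [t]. *)
Lemma power_series_unique (Y : normedModType C) (b : nat -> Y) (r : R) : 0 < r ->
  (forall s : C, 0 < nrm s < r ->
     (fun n : nat => \sum_(k < n) s ^+ k *: b k) @ \oo --> (0 : Y)) ->
  forall k, b k = 0.
Proof.
move=> r0 bs; pose s0 : C := ((r / 2)%:C)%C.
have ns0 : nrm s0 = r / 2 by rewrite nrm_real ger0_norm // divr_ge0 // ltW.
have s0r : 0 < nrm s0 < r by rewrite ns0; apply/andP; split; lra.
have s00 : s0 != 0 by apply: contraTneq s0r => ->; rewrite nrm0 ltxx.
have [M M0 bM] : exists2 M : R, 0 <= M & forall n, nrm (s0 ^+ n *: b n) <= M.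
  have /cvg_nrm/(_ 1 ltr01)[N NP] := bs s0 s0r.
  exists (2 + \sum_(k < N) nrm (s0 ^+ k *: b k)).
    by rewrite addr_ge0 // sumr_ge0 // => k _; exact: nrm_ge0.
  move=> n; have [nN|Nn] := ltnP n N.
    rewrite (bigD1 (Ordinal nN)) //= addrCA lerDl addr_ge0 // sumr_ge0 // => k _.
    exact: nrm_ge0.
  have h1 := NP n Nn; have h2 := NP n.+1 (leqW Nn).
  rewrite sub0r nrmN in h1; rewrite sub0r nrmN big_ord_recr /= in h2.
  apply: (@le_trans _ _ 2); last by rewrite lerDl sumr_ge0 // => k _; exact: nrm_ge0.
  rewrite -[X in nrm X](addKr (\sum_(i < n) s0 ^+ i *: b i)) addrC.
  by apply: le_trans (nrmB _ _) _; lra.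
move=> m; elim/ltn_ind: m => m IH.
have bm (t : R) : 0 < t <= 2^-1 -> nrm (s0 ^+ m *: b m) <= 2 * M * t.
  move=> /andP[t0 t1]; have t0' := ltW t0.
  have tm : 0 < t ^+ m by rewrite exprn_gt0.
  rewrite -(ler_pM2l tm).
  apply/ler_addgt0Pr => e e0.
  pose s : C := (t%:C)%C * s0.
  have nst k : nrm (s ^+ k *: b k) = t ^+ k * nrm (s0 ^+ k *: b k).
    by rewrite exprMn -scalerA nrmZ nrmX nrm_real ger0_norm.
  have sr : 0 < nrm s < r.
    rewrite nrmM nrm_real ger0_norm //; move: s0r => /andP[h1 h2].
    by apply/andP; split; [rewrite mulr_gt0|nra].
  have /cvg_nrm/(_ e e0)[N NP] := bs s sr.
  have := NP (m.+1 + N)%N (leq_addl _ _).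
  rewrite sub0r nrmN big_split_ord /= big_ord_recr /= big1 ?add0r; last first.
    by move=> i _; rewrite IH ?scaler0 //; exact: ltn_ord.
  set S2 := \sum_(i < N) _ => hS.
  have S2M : nrm S2 <= M * (2 * t ^+ m.+1).
    apply: le_trans (nrm_sum _ _ _) _.
    apply: (@le_trans _ _ (\sum_(i < N) M * t ^+ (m.+1 + i))).
      by apply: ler_sum => i _; rewrite nst mulrC ler_wpM2r ?exprn_ge0.
    rewrite -mulr_sumr ler_wpM2l //.
    have := @geo_tail t m.+1 N; rewrite t0' t1 => /(_ isT); apply: le_trans.
    by rewrite lerDl mulr_ge0 ?exprn_ge0.
  rewrite -nst -[X in nrm X](addrK S2).
  apply: le_trans (nrmB _ _) _.
  have -> : t ^+ m * (2 * M * t) = M * (2 * t ^+ m.+1) by rewrite exprS; ring.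
  by rewrite addrC lerD // ltW.
have : nrm (s0 ^+ m *: b m) = 0.
  apply/eqP; rewrite eq_le nrm_ge0 andbT; apply/ler_addgt0Pr => e e0; rewrite add0r.
  pose t := Num.min 2^-1 (e / (2 * M + 1)).
  have t0 : 0 < t by rewrite lt_min divr_gt0 ?invr_gt0 // ltr_wpDl // mulr_ge0.
  have t1 : t <= 2^-1 by rewrite ge_min lexx.
  have t2 : t <= e / (2 * M + 1) by rewrite ge_min lexx orbT.
  apply: le_trans (bm t _) _; first by rewrite t0.
  move: t2; rewrite ler_pdivlMr ?ltr_wpDl ?mulr_ge0 //; lra.
by move=> /nrm_eq0/eqP; rewrite scaler_eq0 expf_eq0 (negbTE s00) andbF => /eqP.
Qed.

(** Multiplication by [s ^+ p] turns the relation between the two Laurent series into a power series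
    identity, to which uniqueness of coefficients applies. *)
Lemma laurent_coef (Y : normedModType C) (a c : nat -> Y) (x : Y) (p : nat) (r : R) :
  0 < r ->
  (forall s : C, 0 < nrm s < r -> exists w,
     (fun n : nat => \sum_(k < n) s ^ (k%:Z - p%:Z) *: a k) @ \oo --> w /\
     (fun n : nat => \sum_(k < n) s ^ (k%:Z - p%:Z) *: c k) @ \oo --> x + s *: w) ->
  forall k, c k = (if k is j.+1 then a j else 0) + (if k == p then x else 0).
Proof.
move=> r0 ac k; pose b k := c k - (if k is j.+1 then a j else 0) - (if k == p then x else 0).
suff /(_ k)/eqP : forall k, b k = 0 by rewrite subr_eq0 subr_eq addrC => /eqP.
apply: (power_series_unique r0) => s /[dup] /ac[w [aw cw]] /andP[s_gt0 _].
have s0 : s != 0 by apply: contraTneq s_gt0 => ->; rewrite nrm0 ltxx.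
have sp (d : nat -> Y) n : \sum_(k < n) s ^+ k *: d k =
    s ^+ p *: \sum_(k < n) s ^ (k%:Z - p%:Z) *: d k.
  rewrite scaler_sumr; apply: eq_bigr => j _; rewrite scalerA; congr (_ *: _).
  have -> : s ^+ j = s ^ (p%:Z + (j%:Z - p%:Z)) by rewrite addrC subrK.
  by rewrite expfzDr.
pose u n := \sum_(k < n) s ^ (k%:Z - p%:Z) *: a k.
pose v n := \sum_(k < n) s ^ (k%:Z - p%:Z) *: c k.
(* The factor [s] shifts indices, so [n.+1] terms of [c] go with [n] terms of [a]; the term in [x]
   appears once the index [p] is reached. *)
have ue : forall n, \sum_(k < n.+1) s ^+ k *: b k =
    s ^+ p *: (v n.+1 - s *: u n) - (if (p < n.+1)%N then s ^+ p *: x else 0).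
  move=> n; rewrite scalerBr scalerA [s ^+ p * s]mulrC -scalerA -!sp.
  rewrite /b; under eq_bigr do rewrite !scalerBr.
  rewrite !sumrB; congr (_ - _ - _).
    rewrite big_ord_recl /= scaler0 add0r scaler_sumr; apply: eq_bigr => j _.
    by rewrite scalerA -exprS.
  case: ifP => pn.
    rewrite (bigD1 (Ordinal pn)) //= eqxx big1 ?addr0 // => j jp.
    by rewrite ifN ?scaler0 //; apply: contra jp => /eqP jp; apply/eqP/val_inj.
  rewrite big1 // => j _; rewrite ifN ?scaler0 //.
  by apply/negP => /eqP jp; move: (ltn_ord j); rewrite jp pn.
apply/cvg_nrm => e e0.
have sp0 : 0 < nrm (s ^+ p) by rewrite nrm_gt0 // expf_neq0.
have h : (fun n => v n.+1 - s *: u n) @ \oo --> x.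
  have -> : x = x + s *: w - s *: w by rewrite addrK.
  apply: cvgB; last by apply: cvgZ; [exact: cvg_cst|exact: aw].
  by rewrite (cvg_shiftS v).
have /cvg_nrm/(_ (e / nrm (s ^+ p)))[|N NP] := h; first by rewrite divr_gt0.
exists (maxn N p).+1 => -[//|n]; rewrite ltnS geq_max => /andP[Nn pn].
rewrite ue ltnS pn -scalerBr sub0r nrmN nrmZ mulrC -ltr_pdivlMr // nrmBC.
exact: NP.
Qed.

Lemma class_Kato c Y (T : 'L(Y)) : in_class c T ->
  alpha T = 0%E \/ beta T = 0%E -> Kato T.
Proof.
move=> /in_classP[Tcl _] [/alpha0 a0|/beta0 b0]; split => // n x Tx.
  by rewrite (a0 _ Tx); exists 0 => //; exact: iter_op0.
suff -> : range (iter n T) = setT by [].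
apply/seteqP; split=> // y _; elim: n y => [|n IH] y; first by exists y.
have [z _ <-] : range T y by rewrite b0.
by have [w _ <-] := IH z; exists w.
Qed.

Lemma invertible_open Y (T : 'L(Y)) : invertible T ->
  exists2 e : R, 0 < e & forall nu, nrm nu < e -> invertible (shift T nu).
Proof.
move=> iT; have /invertibleP[Tcl a0 b0] := iT.
have [|e e0 eP] := @kato_const _ _ T; first by apply: (@class_Kato CInv) => //; left.
exists e => // nu /eP[K aE bE]; apply/invertibleP; rewrite aE bE; split => //.
exact: K.1.
Qed.

Lemma invertible_sim Y Y' (T : 'L(Y)) (T' : 'L(Y')) :
  sim T T' -> invertible T -> invertible T'.
Proof. exact: (@sim_class _ CInv). Qed.

Lemma sim_shift_shift Y (T : 'L(Y)) (mu l : C) :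
  sim (shift (shift T mu) (l - mu)) (shift T l).
Proof. by apply: sim_ext => x; exact: shift_shift. Qed.

Lemma sim_shift0 Y (T : 'L(Y)) : sim (shift T 0) T.
Proof. by apply: sim_ext => x; rewrite /= /shift_fun scale0r subr0. Qed.

Lemma resolvent_open Y (T : 'L(Y)) (l : C) : invertible (shift T l) ->
  exists2 e : R, 0 < e & forall w, nrm (w - l) < e -> invertible (shift T w).
Proof.
move=> /invertible_open[e e0 eP]; exists e => // w /eP.
by apply: invertible_sim; exact: sim_shift_shift.
Qed.

Lemma mero_isolated Y (T : 'L(Y)) (mu : C) : meromorphic T -> mu != 0 ->
  exists2 r : R, 0 < r & forall l, nrm (l - mu) < r -> l != mu ->
    invertible (shift T l).
Proof.
move=> mT mu0; have [/resolvent_open[r r0 rP]|nI] := pselect (invertible (shift T mu)).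
  by exists r => // l /rP.
have [p [p0 [A [_ /near_punctured[r r0 rP]]]]] := mT mu nI mu0.
exists r => // l lr lmu; have [S [[TS ST] _]] := rP l lr lmu.
by exists S.
Qed.

Lemma C_near (z : C) (r : R) : 0 < r -> exists2 w : C, nrm (w - z) < r & w != z.
Proof.
move=> r0; exists (z + ((r / 2)%:C)%C).
  by rewrite addrAC subrr add0r nrm_real ger0_norm ?divr_ge0 ?ltW //; lra.
rewrite -subr_eq0 addrAC subrr add0r fmorph_eq0; apply/eqP; lra.
Qed.

(** Nonzero spectral points are isolated but may accumulate at 0. So [z] is first moved off 0, then
    off a possible isolated spectral point. *)
Lemma mero_dense Y (T : 'L(Y)) (z : C) (r : R) : meromorphic T -> 0 < r ->
  exists w : C, nrm (w - z) < r /\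
    exists2 r' : R, 0 < r' & forall v, nrm (v - w) < r' -> invertible (shift T v).
Proof.
move=> mT r0.
have [z1 z1z z10] : exists2 z1 : C, nrm (z1 - z) < r & z1 != 0.
  have [->|z0] := eqVneq z 0; first exact: C_near.
  by exists z => //; rewrite subrr nrm0.
have [r1 r10 r1P] := mero_isolated mT z10.
have [|w wz1 wne] := @C_near z1 (Num.min r1 (r - nrm (z1 - z))).
  by rewrite lt_min r10 subr_gt0.
move: wz1; rewrite lt_min => /andP[wr1 wr].
exists w; split; first by apply: le_lt_trans (nrm_dist z1 _ _) _; lra.
by have [e e0 eP] := resolvent_open (r1P w wr1 wne); exists e.
Qed.

Lemma laurent_partial Y (A : nat -> 'L(Y)) (S : 'L(Y)) (f : nat -> C) x :
  op_norm_cvg (fun n x => \sum_(k < n) f k *: A k x) S ->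
  (fun n : nat => \sum_(k < n) f k *: A k x) @ \oo --> S x.
Proof.
move=> AS; apply/cvg_nrm => e e0.
have nx : 0 < nrm x + 1 by rewrite ltr_wpDl ?nrm_ge0.
have [|N _ NP] := AS ((e / (nrm x + 1))%:C)%C; first by rewrite ltcR divr_gt0.
exists N => n Nn; have := NP n Nn x.
rewrite !nrmE -rmorphM lecR nrmBC => h; apply: le_lt_trans h _.
rewrite mulrAC ltr_pdivrMr // ltr_pM2l //; lra.
Qed.

(** With [E = T - mu], both products of [E] and [A k] equal the preceding coefficient, plus the
    identity when [k = p]. Hence [G = A p] commutes with [E], and [E^(p+1) G = E^p] as for a Drazin
    inverse. The product [P0] of the [p]-th powers of [E] and [G] is then idempotent; [E] has
    inverse [G] on its range and is nilpotent on its kernel. *)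
Lemma pole_split Y (T : 'L(Y)) (mu : C) : resolvent_pole T mu ->
  exists (Y1 Y2 : completeNormedModType C) (I : 'L(Y1)) (F : 'L(Y2)),
    [/\ sim (shift T mu) (dsum I F), invertible I & nilpotent_op F].
Proof.
move=> [p [p0 [A [_ /near_punctured[r r0 rP]]]]].
have [E EE] : exists E, E = shift T mu by exists (shift T mu).
rewrite -EE.
have TE s x : shift T (mu + s) x = E x - s *: x.
  by rewrite EE /= /shift_fun scalerDl opprD addrA.
have res (s : C) : 0 < nrm s < r -> exists S : 'L(Y),
    [/\ forall x, S (E x) = x + s *: S x, forall x, E (S x) = x + s *: S x &
    forall x, (fun n : nat => \sum_(k < n) s ^ (k%:Z - p%:Z) *: A k x) @ \oo --> S x].
  move=> /andP[s_gt0 sr].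
  have s0 : s != 0 by apply: contraTneq s_gt0 => ->; rewrite nrm0 ltxx.
  have [||S [[TS ST] AS]] := rP (mu + s).
  - by rewrite addrAC subrr add0r.
  - by rewrite -subr_eq0 addrAC subrr add0r.
  exists S; split=> x.
  - have := TS x; rewrite TE linearB linearZ /= => /eqP.
    by rewrite subr_eq => /eqP.
  - by have := ST x; rewrite TE => /eqP; rewrite subr_eq => /eqP.
  - move: AS; rewrite addrAC subrr add0r.
    exact: (@laurent_partial _ A S (fun k : nat => s ^ (k%:Z - p%:Z)) x).
have EA x k : E (A k x) =
    (if k is j.+1 then A j x else 0) + (if k == p then x else 0).
  apply: (@laurent_coef _ (fun k => A k x) (fun k => E (A k x)) x p r r0) => s /res[S [_ ES AS]].
  exists (S x); split; first exact: AS.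
  rewrite -ES.
  have -> : (fun n : nat => \sum_(k < n) s ^ (k%:Z - p%:Z) *: E (A k x)) =
      E \o (fun n : nat => \sum_(k < n) s ^ (k%:Z - p%:Z) *: A k x).
    by apply/funext => n; rewrite /= linear_sum; apply: eq_bigr => i _; rewrite linearZ.
  by apply: continuous_cvg; [exact: bop_continuous|exact: AS].
have AE x k : A k (E x) =
    (if k is j.+1 then A j x else 0) + (if k == p then x else 0).
  apply: (@laurent_coef _ (fun k => A k x) (fun k => A k (E x)) x p r r0) => s /res[S [SE _ AS]].
  by exists (S x); split; [exact: AS|rewrite -SE; exact: AS].
pose G := A p.
have GE x : G (E x) = E (G x) by rewrite AE EA.
have itEA k x : (k < p)%N -> iter k.+1 E (A k x) = 0.
  elim: k x => [|k IH] x kp; first by rewrite /= EA ltn_eqF // addr0.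
  by rewrite iterSr EA ltn_eqF // addr0 IH // ltnW.
(* [E (G x)] is [x] plus the coefficient of index [p - 1] at [x], which the [p]-th power of [E]
   kills. *)
have EG x : iter p.+1 E (G x) = iter p E x.
  case: p p0 @G itEA EA {AE res rP GE} => // p _ G itEA EA.
  rewrite iterSr EA eqxx.
  apply: (etrans (linearD (mklin (iter_linear E p.+1)) _ _)).
  by rewrite /= -[E (iter p E _)]/(iter p.+1 E _) itEA // add0r.
have itG k x : iter k G (E x) = E (iter k G x).
  by elim: k => //= k ->; rewrite GE.
have itE k x : iter k E (G x) = G (iter k E x).
  by elim: k => //= k ->; rewrite GE.
have itGE k l x : iter k G (iter l E x) = iter l E (iter k G x).
  by elim: l x => // l IH x; rewrite iterS itG IH.
have EGk k x : iter (p + k) E (iter k G x) = iter p E x.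
  elim: k x => [|k IH] x; first by rewrite addn0.
  by rewrite addnS -addSn addnC -iterA [iter k.+1 G x]iterS EG iterA addnC IH.
pose P0 x := iter p E (iter p G x).
have P0l : linear P0.
  by move=> a x y; rewrite /P0 (iter_linear G) (iter_linear E).
have P0E x : P0 (E x) = E (P0 x) by rewrite /P0 itG -iterSr.
have P0P0 x : P0 (P0 x) = P0 x.
  by rewrite /P0 itGE iterA EGk.
(* The splitting uses the complementary projection: its kernel [M] carries the invertible part, its
   fixed space [N] the nilpotent one. *)
have Ql : linear (fun x => x - P0 x).
  by move=> a x y; rewrite P0l scalerBr opprD addrACA.
have P0c : continuous (mklin P0l).
  exact: (comp_continuous_lin (@iter_bounded _ _ E p (@bop_continuous _ _ E))
     (@iter_bounded _ _ G p (@bop_continuous _ _ G))).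
have Qc : continuous (mklin Ql).
  have [M M0 PM] := (continuousP_nrm _).1 P0c.
  apply/continuousP_nrm; exists (1 + M); first exact: addr_gt0.
  by move=> x /=; apply: le_trans (nrmB _ _) _; rewrite mulrDl mul1r lerD2l; exact: PM.
have P0B x y : P0 (x - y) = P0 x - P0 y by exact: (linearB (mklin P0l)).
have QQ x : mklin Ql (mklin Ql x) = mklin Ql x.
  by rewrite /= P0B P0P0 subrr subr0.
have QE x : mklin Ql (E x) = E (mklin Ql x).
  by rewrite -[LHS]/(E x - P0 (E x)) P0E -[mklin Ql x]/(x - P0 x) linearB.
have [M [N [EM [EN [ME NE sE]]]]] := proj_split Qc QQ QE.
exists (cs_type M), (cs_type N), (restr EM), (restr EN); split => //.
- have GM : invariant_subspace G M.
    move=> x; rewrite ME /= => /eqP; rewrite subr_eq0 => /eqP Px.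
    by rewrite /P0 -iterSr iterS itE -/(P0 x) -Px subrr.
  have EGM x : cs_set M x -> E (G x) = x.
    rewrite ME /= => /eqP; rewrite subr_eq0 => /eqP Px.
    by rewrite [in LHS]Px /P0 -itE -iterS EG -/(P0 x) -Px.
  exists (restr GM); split => -[x xM]; apply: val_inj; have Mx := set_mem xM.
    by rewrite /= GE EGM.
  by rewrite /= EGM.
- exists p => x; apply: val_inj.
  have itN m (z : cs_type N) : cs_val (iter m (restr EN) z) = iter m E (cs_val z).
    by elim: m => //= m ->.
  rewrite [LHS](itN p x) [RHS]/=; have := set_mem (cs_valP x); rewrite NE /= => /eqP.
  rewrite subr_eq addrC -subr_eq subrr eq_sym => /eqP Px.
  by rewrite -(EGk p) -iterA -/(P0 (cs_val x)) Px iter_op0.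
Qed.

(** Surjectivity is by induction on the number of steps in which [F] kills [x]: if
    [(F - l) z = F x], then [l^-1 *: (z - x)] is mapped to [x]. Injectivity holds since [F x = l x]
    makes a power of [l] annihilate [x]. *)
Lemma nilpotent_shift_invertible Y (F : 'L(Y)) (l : C) : nilpotent_op F ->
  l != 0 -> invertible (shift F l).
Proof.
move=> [n Fn] l0; have sur y : exists x, shift F l x = y.
  suff H m x : iter m F x = 0 -> exists y, shift F l y = x by exact: H (Fn y).
  elim: m x => [|m IH] x; first by move=> /= ->; exists 0; exact: linear0.
  rewrite iterSr => /IH[z zE]; exists (l^-1 *: (z - x)).
  rewrite linearZ linearB zE /= /shift_fun opprB addrC subrK.
  by rewrite scalerA mulVf // scale1r.
apply/invertibleP; have Rs : range (shift F l) = setT.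
  by apply/seteqP; split=> // y _; have [x <-] := sur y; exists x.
split; [by rewrite Rs; exact: closedT| |exact/beta0].
apply/alpha0 => x; rewrite /= /shift_fun => /eqP; rewrite subr_eq0 => /eqP Fx.
have itF k : iter k F x = l ^+ k *: x.
  elim: k => [|k IH]; first by rewrite scale1r.
  by rewrite iterS IH linearZ /= Fx scalerA -exprSr.
have /eqP := Fn x; rewrite itF scaler_eq0 expf_eq0 (negbTE l0) andbF.
by move=> /eqP.
Qed.

Lemma nilpotent_mero Y (F : 'L(Y)) : nilpotent_op F -> meromorphic F.
Proof.
by move=> nF mu sF mu0; exfalso; apply: sF; exact: nilpotent_shift_invertible.
Qed.

Lemma is_inverse_sim Y Y' (T S : 'L(Y)) (T' S' : 'L(Y')) (J : {linear Y -> Y'})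
  (G : {linear Y' -> Y}) : cancel J G -> cancel G J ->
  (forall x, J (T x) = T' (J x)) -> (forall x, S' x = J (S (G x))) ->
  is_inverse T S -> is_inverse T' S'.
Proof.
move=> JG GJ JT S'E [TS ST]; split=> x.
  by rewrite S'E; rewrite -{1}(GJ x) -JT JG TS GJ.
by rewrite S'E -JT ST GJ.
Qed.

Lemma mero_sim Y Y' (T : 'L(Y)) (T' : 'L(Y')) :
  sim T T' -> meromorphic T -> meromorphic T'.
Proof.
move=> TT' mT mu sT' mu0.
have sT : spectrum T mu.
  by move=> iT; apply: sT'; exact: invertible_sim (sim_shift mu TT') iT.
have [p [p0 [A [[x Ax] near]]]] := mT mu sT mu0.
have [J [G [Jc Gc JG GJ JT]]] := TT'.
exists p; split => //.
pose conj (B : 'L(Y)) : 'L(Y') := BoundedOperator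
  (comp_continuous_lin Jc (comp_continuous_lin (@bop_continuous _ _ B) Gc)).
exists (fun k => conj (A k)); split.
  exists (J x); rewrite /= JG; apply: contra_neq Ax => h.
  by rewrite -(JG (A 0%N x)) h linear0.
apply: filterS near => l [S [iS cS]]; exists (conj S); split.
  apply: is_inverse_sim JG GJ _ _ iS => //= y.
  by rewrite /shift_fun linearB linearZ /= JT.
have [K K0 JK] := (continuousP_nrm J).1 Jc.
have [L L0 GL] := (continuousP_nrm G).1 Gc.
move=> _/posC[e e0 ->].
have [|N _ NP] := cS ((e / (K * L))%:C)%C; first by rewrite ltcR divr_gt0 ?mulr_gt0.
exists N => // n Nn y; have := NP n Nn (G y).
rewrite !nrmE -!rmorphM !lecR => h.
have -> : \sum_(k < n) (l - mu) ^ (k%:Z - p%:Z) *: conj (A k) y - conj S y =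
   J (\sum_(k < n) (l - mu) ^ (k%:Z - p%:Z) *: A k (G y) - S (G y)).
  by rewrite linearB linear_sum /=; congr (_ - _); apply: eq_bigr => i _; rewrite linearZ.
apply: le_trans (JK _) _.
have : K * nrm (\sum_(k < n) (l - mu) ^ (k%:Z - p%:Z) *: A k (G y) - S (G y))
    <= K * (e / (K * L) * (L * nrm y)).
  rewrite ler_wpM2l ?(ltW K0) //; apply: le_trans h _.
  by rewrite ler_wpM2l // divr_ge0 ?mulr_ge0 // ltW.
move=> /le_trans; apply; rewrite le_eqVlt; apply/orP; left; apply/eqP.
by field; rewrite !gt_eqF.
Qed.

(** The nilpotent [F] has no spectrum away from 0, so a nonzero pole comes from [B] and keeps its
    order. Near [mu] the resolvent of [F] is a Neumann series in the inverse [G] of [F - mu]. *)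
Lemma mero_dsum (Y1 Y2 : completeNormedModType C) (F : 'L(Y1)) (B : 'L(Y2)) :
  nilpotent_op F -> meromorphic B -> meromorphic (dsum F B).
Proof.
move=> nF mB mu sFB mu0.
have [G [EG GE]] := nilpotent_shift_invertible nF mu0.
have sB : spectrum B mu.
  move=> iB; apply: sFB; apply: invertible_sim (sim_sym (shift_dsum F B mu)) _.
  by apply/dsum_invertible; split => //; exists G.
have [p [p0 [A [[x Ax] /near_punctured[r r0 rP]]]]] := mB mu sB mu0.
exists p; split => //.
have zl : linear (fun _ : Y1 => 0 : Y1) by move=> a u v; rewrite scaler0 addr0.
have zc : continuous (mklin zl).
  by apply/continuousP_nrm; exists 1 => // u; rewrite nrm0 mul1r nrm_ge0.
(* The Neumann series starts at exponent 0, that is at Laurent index [p], with [G] to the power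
   1. *)
pose D k : 'L(Y1) := if (k < p)%N then BoundedOperator zc else
  BoundedOperator (@iter_bounded _ _ G (k - p).+1 (@bop_continuous _ _ G)).
exists (fun k => dsum (D k) (A k)); split.
  exists (0, x); apply: contra_neq Ax => h.
  by have := congr1 snd h.
have [g g0 Gg] := (continuousP_nrm G).1 (@bop_continuous _ _ G).
(* Within this radius the expansion for [B] holds, [l] is nonzero, and [nrm s * g <= 2^-1] makes the
   Neumann series geometric. *)
have rho0 : 0 < Num.min r (Num.min (nrm mu) (2 * g)^-1).
  by rewrite !lt_min r0 nrm_gt0 // invr_gt0 mulr_gt0.
apply/near_punctured; exists (Num.min r (Num.min (nrm mu) (2 * g)^-1)) => // l.
rewrite !lt_min => /and3P[lr lmu lg] lne.
have [S [iS cS]] := rP l lr lne.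
have l0 : l != 0 by apply: contraTneq lmu => ->; rewrite sub0r nrmN ltxx.
have [Rl iR] := nilpotent_shift_invertible nF l0.
exists (dsum Rl S); split.
  case: iR => FR RF; case: iS => BS SB; split => -[u v].
    by rewrite /= /dsum_fun /=; congr pair; [exact: FR|exact: BS].
  by rewrite /= /dsum_fun /=; congr pair; [exact: RF|exact: SB].
set s := l - mu in lr lg cS *.
have s0 : s != 0 by rewrite subr_eq0.
have sg : nrm s * g <= 2^-1.
  have := ltW lg; rewrite -(ler_pM2r g0) => /le_trans; apply.
  by rewrite le_eqVlt; apply/orP; left; apply/eqP; field; rewrite gt_eqF.
have Gn k (u : Y1) : nrm (iter k G u) <= g ^+ k * nrm u.
  elim: k => [|k IH]; first by rewrite expr0 mul1r.
  by rewrite iterS exprS -mulrA; apply: le_trans (Gg _) _; rewrite ler_wpM2l ?(ltW g0).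
pose W m (u : Y1) := \sum_(j < m) s ^+ j *: iter j.+1 G u.
(* The sum telescopes; applying the inverse of [F - l] turns the remainder into the error estimate
   [WR]. *)
have FW m u : shift F l (W m u) = u - s ^+ m *: iter m G u.
  have Fs v : shift F l v = shift F mu v - s *: v.
    by rewrite /= /shift_fun /s scalerBl opprB addrA subrK.
  elim: m => [|m IH]; first by rewrite /W big_ord0 linear0 expr0 scale1r subrr.
  have key : shift F mu (s ^+ m *: iter m.+1 G u) = s ^+ m *: iter m G u.
    by rewrite linearZ; exact: (congr1 _ (GE _)).
  rewrite /W big_ord_recr linearD -/(W m u) IH Fs key.
  by rewrite scalerA -exprS addrA subrK.
have [L L0 RL] := (continuousP_nrm Rl).1 (@bop_continuous _ _ Rl).
have WR m u : nrm (W m u - Rl u) <= L * 2^-1 ^+ m * nrm u.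
  have -> : W m u - Rl u = - Rl (s ^+ m *: iter m G u).
    have [FR _] := iR; rewrite -{1}(FR (W m u)) FW linearB.
    by rewrite addrAC subrr add0r.
  rewrite nrmN; apply: le_trans (RL _) _; rewrite -mulrA ler_wpM2l ?(ltW L0) //.
  rewrite nrmZ nrmX; apply: (@le_trans _ _ (nrm s ^+ m * (g ^+ m * nrm u))).
    by rewrite ler_wpM2l ?exprn_ge0 ?nrm_ge0.
  rewrite mulrA -exprMn ler_wpM2r ?nrm_ge0 //.
  by rewrite lerXn2r ?nnegrE ?mulr_ge0 ?nrm_ge0 // ltW.
have DW n u : (p <= n)%N -> \sum_(k < n) s ^ (k%:Z - p%:Z) *: D k u = W (n - p)%N u.
  move=> /subnKC; move: (n - p)%N => q <-.
  rewrite big_split_ord /= big1 ?add0r; last first.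
    by move=> i _; rewrite /D ltn_ord /= scaler0.
  apply: eq_bigr => i _; rewrite /D ltnNge leq_addr /= addnC addnK.
  by rewrite PoszD addrK.
move=> _/posC[e e0 ->].
have [|N _ NP] := cS ((e / 2)%:C)%C; first by rewrite ltcR divr_gt0.
have [||m mP] := @geo2_lt _ L (e / 2); [by rewrite divr_gt0|exact: ltW|].
exists (maxn N (p + m)) => // n; rewrite /= geq_max => /andP[Nn pmn] [u v].
have pn : (p <= n)%N := leq_trans (leq_addr _ _) pmn.
have := NP n Nn v; rewrite !nrmE -!rmorphM !lecR => hS.
set Q := \sum_(k < n) _.
have QE : Q = (W (n - p)%N u, \sum_(k < n) s ^ (k%:Z - p%:Z) *: A k v).
  rewrite /Q -DW // [LHS]surjective_pairing; congr pair.
    rewrite (linear_sum (mklin (@psum_lin1 _ Y1 Y2))); apply: eq_bigr => i _.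
    by rewrite linearZ.
  rewrite (linear_sum (mklin (@psum_lin2 _ Y1 Y2))); apply: eq_bigr => i _.
  by rewrite linearZ.
rewrite QE; apply: le_trans (nrm_psum _) _.
have nu := nrm_psuml ((u, v) : psum Y1 Y2); have nv := nrm_psumr ((u, v) : psum Y1 Y2).
have -> : e * nrm ((u, v) : psum Y1 Y2) =
    e / 2 * nrm ((u, v) : psum Y1 Y2) + e / 2 * nrm ((u, v) : psum Y1 Y2).
  by field.
apply: lerD; last first.
  by apply: le_trans hS _; rewrite ler_wpM2l // divr_ge0 // ltW.
apply: le_trans (WR _ _) _; apply: ler_pM => //.
- by rewrite mulr_ge0 ?exprn_ge0 // ltW.
- exact: nrm_ge0.
- apply: le_trans (ltW mP); rewrite ler_wpM2l ?(ltW L0) //.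
  apply: ler_wiXn2l; rewrite ?invr_ge0 ?invf_le1 ?ler1n //.
  by rewrite leq_subRL.
Qed.

End Meromorphic.

(** * Openness and comparison of the decomposition conditions *)

Section Decompositions.
Context {R : realType}.
Local Notation C := (R[i]).
Implicit Types Y : completeNormedModType C.

Lemma class_index_fin c (a b : \bar R) : class_index c a b ->
  (a < +oo)%E \/ (b < +oo)%E.
Proof.
by case: c => /=; [move=> ->|move=> ->|move=> [-> _]|auto|auto|case|case|case|case];
  auto; left.
Qed.

(** For nonzero [nu] the nilpotent part becomes invertible, so near 0 the nullity and defect of
    [T - nu] are those of the Kato part. Both have dropped by the same [d], and [class_indexD]
    applies. *)
Lemma class_open c Y (T : 'L(Y)) : in_class c T ->
  exists2 e : R, 0 < e & forall nu, nrm nu < e -> in_class c (shift T nu).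
Proof.
move=> Tc; have /in_classP[Tcl Ti] := Tc.
have [Y1 [Y2 [K [F [d [sT KK nF aT bT]]]]]] :=
  semi_Fredholm_Kato Tcl (class_index_fin Ti).
have [e e0 eP] := kato_const KK; exists e => // nu nue.
have [->|nu0] := eqVneq nu 0; first exact: sim_class (sim_sym (sim_shift0 T)) Tc.
have [Kn aK bK] := eP nu nue.
apply: sim_class (sim_sym (sim_trans (sim_shift nu sT) (shift_dsum K F nu))) _.
apply/class_dsum_inv; first exact: nilpotent_shift_invertible.
apply/in_classP; split; first exact: Kn.1.
rewrite aK bK; apply: (@class_indexD _ _ _ _ d); [exact: erk_ge0|exact: erk_ge0|].
by rewrite -aT -bT.
Qed.

Definition gD c Y (A : 'L(Y)) : Prop :=
  exists (Y1 Y2 : completeNormedModType C) (T1 : 'L(Y1)) (T2 : 'L(Y2)),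
    [/\ sim A (dsum T1 T2), in_class c T1 & meromorphic T2].

Definition gK Y (A : 'L(Y)) : Prop :=
  exists (Y1 Y2 : completeNormedModType C) (T1 : 'L(Y1)) (T2 : 'L(Y2)),
    [/\ sim A (dsum T1 T2), Kato T1 & meromorphic T2].

Lemma gD_sim c Y Y' (A : 'L(Y)) (A' : 'L(Y')) : sim A A' -> gD c A -> gD c A'.
Proof.
move=> AA' [Y1 [Y2 [T1 [T2 [sA c1 m2]]]]]; exists Y1, Y2, T1, T2; split => //.
exact: sim_trans (sim_sym AA') sA.
Qed.

Lemma gDP c Y (T : 'L(Y)) l : ~ sigma_gDMC c T l <-> gD c (shift T l).
Proof.
split=> [/contrapT[M [N [r [c1 m2]]]]|].
  exists _, _, (restr (invariant_shift l (red_l r))), (restr (invariant_shift l (red_r r))).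
  by split => //; apply: red_sim; [exact: (red_cap r)|exact: (red_sum r)].
move=> [Y1 [Y2 [T1 [T2 [sA c1 m2]]]]]; apply; have [M [N [r [s1 s2]]]] := sim_red sA.
have inv (L : closed_subspace Y) : invariant_subspace (shift T l) L ->
    invariant_subspace T L.
  move=> LT x Lx; have -> : T x = shift T l x + l *: x by rewrite /= /shift_fun subrK.
  by apply: (subspD (subsp_cs L)); [exact: LT|exact: (subspZ _ (subsp_cs L))].
have r' : Red T M N.
  by split; [exact: inv (red_l r)|exact: inv (red_r r)|exact: (red_cap r)|exact: (red_sum r)].
exists M, N, r'; split.
  apply: sim_class c1; apply: sim_trans (sim_sym s1) _.
  by apply: sim_ext => x; apply: val_inj.
apply: mero_sim m2; apply: sim_trans (sim_sym s2) _.
by apply: sim_ext => x; apply: val_inj.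
Qed.

Lemma gKP Y (T : 'L(Y)) l : ~ sigma_gKM T l <-> gK (shift T l).
Proof.
split=> [/contrapT[M [N [r [c1 m2]]]]|].
  exists _, _, (restr (red_l r)), (restr (red_r r)).
  by split => //; apply: red_sim; [exact: (red_cap r)|exact: (red_sum r)].
move=> [Y1 [Y2 [T1 [T2 [sA c1 m2]]]]]; apply; have [M [N [r [s1 s2]]]] := sim_red sA.
exists M, N, r; split; first exact: sim_Kato (sim_sym s1) c1.
exact: mero_sim (sim_sym s2) m2.
Qed.

(** The nilpotent summand of the part in the class is moved to the meromorphic side. *)
Lemma gD_gK c Y (A : 'L(Y)) : gD c A -> gK A.
Proof.
move=> [Y1 [Y2 [T1 [T2 [sA /in_classP[cl1 i1] m2]]]]].
have [Z1 [Z2 [K [F [d [sT KK nF _ _]]]]]] :=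
  semi_Fredholm_Kato cl1 (class_index_fin i1).
exists Z1, (psum Z2 Y2), K, (dsum F T2); split => //; last exact: mero_dsum.
apply: sim_trans sA (sim_trans (sim_dsum sT (sim_refl T2)) _).
exact: sim_sym (sim_dsumA _ _ _).
Qed.

Lemma gD_class c Y (A : 'L(Y)) : in_class c A -> gD c A.
Proof.
move=> cA; have [Z [F [sA nF _ _]]] := sim_dsum0 A.
by exists Y, Z, A, F; split => //; exact: nilpotent_mero.
Qed.

Lemma gD_open c Y (A : 'L(Y)) : gD c A ->
  exists2 e : R, 0 < e & forall nu, nrm nu < e -> gD c (shift A nu).
Proof.
move=> gA; have [Y1 [Y2 [T1 [T2 [sA c1 m2]]]]] := gA.
have [e e0 eP] := class_open c1; exists e => // nu nue.
have [->|nu0] := eqVneq nu 0; first exact: gD_sim (sim_sym (sim_shift0 A)) gA.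
have sAn := sim_trans (sim_shift nu sA) (shift_dsum T1 T2 nu).
have [i2|s2] := pselect (invertible (shift T2 nu)).
  apply: gD_sim (sim_sym sAn) (gD_class _).
  by apply/class_dsum_inv => //; exact: eP.
(* A nonzero [nu] in the spectrum of [T2] is a pole: the invertible summand joins the part in the
   class, the nilpotent one remains as meromorphic part. *)
have [Z1 [Z2 [I [F [sT2 iI nF]]]]] := pole_split (m2 nu s2 nu0).
exists (psum Y1 Z1), Z2, (dsum (shift T1 nu) I), F; split.
- apply: sim_trans sAn (sim_trans (sim_dsum (sim_refl _) sT2) _).
  exact: sim_dsumA.
- by apply/class_dsum_inv => //; exact: eP.
- exact: nilpotent_mero.
Qed.

(* On the Kato part of [A] the defects are constant near [0], and there are
   small [nu] for which both the decomposition of [A - nu] and that of [A] have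
   invertible meromorphic part; hence the Kato part of [A] is in the class. *)
Lemma gK_gD c Y (A : 'L(Y)) : gK A ->
  (forall e : R, 0 < e -> exists2 nu, nrm nu < e & gD c (shift A nu)) -> gD c A.
Proof.
move=> [Y1 [Y2 [K [B [sA KK mB]]]]] near.
have [e e0 eP] := kato_const KK.
have [mu mue [Z1 [Z2 [T1 [T2 [sAm c1 m2]]]]]] := near e e0.
have [d d0 dP] := class_open c1.
(* [w] comes with a whole disc off the spectrum of [T2]. Then [v] is taken off the spectrum of [B],
   so close to [mu + w] that [nu = v - mu] stays in that disc and [nrm nu] stays below [d] and
   [e - nrm mu]. *)
have [|w [wd [r r0 rP]]] := @mero_dense _ _ T2 0 (Num.min d (e - nrm mu)) m2.
  by rewrite lt_min d0 subr_gt0.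
have [|v [vd [r' r'0 r'P]]] := @mero_dense _ _ B (mu + w)
    (Num.min r (Num.min d (e - nrm mu) - nrm w)) mB.
  by rewrite lt_min r0 /= subr_gt0; move: wd; rewrite subr0.
move: vd; rewrite lt_min => /andP[vr vd].
have iB : invertible (shift B v) by apply: r'P; rewrite subrr nrm0.
pose nu := v - mu.
have nuw : nu - w = v - (mu + w) by rewrite /nu opprD addrA.
have i2 : invertible (shift T2 nu) by apply: rP; rewrite nuw.
have nud : nrm nu < Num.min d (e - nrm mu).
  have : nrm nu <= nrm (v - (mu + w)) + nrm w.
    by rewrite -nuw; apply: le_trans (nrmD _ _); rewrite subrK.
  by move: vd; lra.
move: nud; rewrite lt_min => /andP[nud nue].
have ve : nrm v < e.
  have : nrm v <= nrm nu + nrm mu by apply: le_trans (nrmD _ _); rewrite subrK.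
  by move: nue; lra.
have [Kv aK bK] := eP v ve.
have cA : in_class c (shift A v).
  apply: sim_class (sim_shift_shift A mu v) _.
  apply: sim_class (sim_sym (sim_trans (sim_shift nu sAm) (shift_dsum T1 T2 nu))) _.
  by apply/class_dsum_inv => //; exact: dP.
have /(class_dsum_inv _ _ iB)/in_classP[_] :=
  sim_class (sim_trans (sim_shift v sA) (shift_dsum K B v)) cA.
rewrite aK bK => cK; exists Y1, Y2, K, B; split => //.
by apply/in_classP; split => //; exact: KK.1.
Qed.

Definition class_le (c c' : opclass) := forall a b : \bar R,
  (0 <= a)%E -> (0 <= b)%E -> class_index c a b -> class_index c' a b.

Lemma gD_le c c' Y (A : 'L(Y)) : class_le c c' -> gD c A -> gD c' A.
Proof.
move=> cc [Y1 [Y2 [T1 [T2 [sA /in_classP[cl1 i1] m2]]]]].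
exists Y1, Y2, T1, T2; split => //; apply/in_classP; split => //.
by apply: cc i1; exact: erk_ge0.
Qed.

(** For [nrm l > 2 * M] the operator [T] is a perturbation of [- l] small enough for
    [perturb_lift]. *)
Lemma spectrum_bounded Y (T : 'L(Y)) :
  exists M : R, forall l, spectrum T l -> nrm l <= M.
Proof.
have [M M0 TM] := (continuousP_nrm T).1 (@bop_continuous _ _ T).
exists (2 * M) => l; apply: contra_notT; rewrite -ltNge => lM.
have nl0 : 0 < nrm l by apply: lt_trans lM; rewrite mulr_gt0.
have l0 : l != 0 by apply: contraTneq nl0 => ->; rewrite nrm0 ltxx.
have fl : linear (fun x : Y => - l *: x).
  by move=> a x y; rewrite scalerDr !scalerA mulrC.
have fc : continuous (mklin fl).
  by apply/continuousP_nrm; exists (nrm l) => // x; rewrite /= nrmZ nrmN.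
have ff y : exists2 x, mklin fl x = y & nrm x <= (nrm l)^-1 * nrm y.
  exists (- l^-1 *: y); first by rewrite /= scalerA mulrNN mulfV // scale1r.
  by rewrite nrmZ nrmN nrmV.
have cM : (nrm l)^-1 * M <= 2^-1.
  by rewrite mulrC ler_pdivrMr // mulrC -ler_pdivrMr ?invr_gt0 // invrK mulrC ltW.
have lift := perturb_lift fc (@bop_continuous _ _ T) _ (ltW M0) cM ff TM.
have Rs : range (shift T l) = setT.
  apply/seteqP; split=> // y _; have [|x xy _] := lift _ y.
    by rewrite invr_ge0 ltW.
  by exists x => //; rewrite -xy /= /shift_fun scaleNr addrC.
apply/invertibleP; split; [by rewrite Rs; exact: closedT| |exact/beta0].
apply/alpha0 => x; rewrite /= /shift_fun => /eqP; rewrite subr_eq0 => /eqP Tx.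
apply: nrm_eq0; apply/eqP; rewrite eq_le nrm_ge0 andbT leNgt; apply/negP => x0.
have := TM x; rewrite Tx nrmZ ler_pM2r //; lra.
Qed.

End Decompositions.

(** * Boundaries, holes, hulls and countable sets in the plane *)

Section PlaneTopology.
Context {R : realType}.
Local Notation C := (R[i]).
Implicit Types A B : set C.

Lemma nbhsC (z : C) A :
  nbhs z A <-> exists2 e : R, 0 < e & forall w, nrm (z - w) < e -> A w.
Proof. exact: (@nbhs_nrm R R[i]^o). Qed.

(** For closed [A] the last hypothesis says that the boundary of [A] lies in [B]. It recurs in this
    form throughout the section. *)
Lemma boundary_sub A B : closed A -> B `<=` A ->
  (forall z, A z -> ~ A° z -> B z) -> boundary A `<=` boundary B.
Proof.
move=> Acl BA AB z [Az nAz]; have {}Az : A z by exact: Acl.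
split; first by apply: subset_closure; exact: AB.
by move=> Bz; apply: nAz; apply: filterS Bz.
Qed.

Lemma boundedP A (M : R) : (forall z, A z -> nrm z <= M) -> [bounded z | z in A].
Proof.
move=> AM; exists (M%:C)%C; split; first by rewrite complex_real.
move=> N MN z Az; apply: le_trans (ltW MN).
by rewrite nrmE lecR; exact: AM.
Qed.

Lemma sub_bounded A B : A `<=` B -> [bounded z | z in B] -> [bounded z | z in A].
Proof. by move=> AB; apply: filterS => M h z /AB; exact: h. Qed.

(** Off [B] the set [A] coincides with its interior, so its trace on a component of the complement
    of [B] is clopen. *)
Lemma component_in A B z : closed A -> (forall z, A z -> ~ A° z -> B z) ->
  connected_component (~` B) z `&` A !=set0 ->
  connected_component (~` B) z `<=` A.
Proof.
move=> Acl AB HA; set H := connected_component (~` B) z in HA *.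
suff <- : H `&` A = H by exact: subIsetr.
have HB : H `<=` ~` B by exact: connected_component_sub.
apply: (@component_connected _ (~` B) z) => //; last by exists A.
exists A°; first exact: open_interior.
apply/seteqP; split=> w [Hw Aw]; split=> //; last exact: interior_subset Aw.
by apply: contrapT => nAw; exact: HB Hw (AB w Aw nAw).
Qed.

(** A point of [A] outside [B] lies in a component of the complement of [B] that stays inside [A]
    and so is bounded, that is, a hole of [B]. *)
Lemma with_some_holes_sub A B : closed A -> [bounded z | z in A] -> B `<=` A ->
  (forall z, A z -> ~ A° z -> B z) -> with_some_holes B A.
Proof.
move=> Acl Abd BA AB; exists [set H | hole B H /\ H `<=` A]; first by move=> H [].
apply/seteqP; split=> [z Az|z [/BA //|[H [_ HA] /HA //]]].
have [Bz|nBz] := pselect (B z); [by left|right].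
have zH : connected_component (~` B) z z by exact: connected_component_refl.
have HA : connected_component (~` B) z `<=` A.
  by apply: component_in => //; exists z.
exists (connected_component (~` B) z) => //; split => //; split; first by exists z.
exact: sub_bounded HA Abd.
Qed.

(** An unbounded component of the complement of [B] cannot meet [A], since it would then be
    contained in [A]; so it is a connected part of the complement of [A]. *)
Lemma connected_hull_eq A B : closed A -> [bounded z | z in A] -> B `<=` A ->
  (forall z, A z -> ~ A° z -> B z) -> connected_hull A = connected_hull B.
Proof.
move=> Acl Abd BA AB; congr (~` _).
apply/seteqP; split=> z [nz unb].
  have nB : ~ B z by move=> /BA.
  split=> // /(sub_bounded _) h; apply: unb; apply: h.
  apply: connected_component_max.
  - exact: connected_component_refl.
  - by move=> w /connected_component_sub nAw /BA.
  - exact: component_connected.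
have zH : connected_component (~` B) z z by exact: connected_component_refl.
have HA w : connected_component (~` B) z w -> ~ A w.
  move=> Hw Aw; apply: unb; apply: sub_bounded Abd.
  by apply: component_in => //; exists w.
split; first exact: HA zH.
move=> /(sub_bounded _) h; apply: unb; apply: h.
apply: connected_component_max => //; exact: component_connected.
Qed.

(* From an interior point every ray [z + s (1 + i t)], [s >= 0], leaves the
   bounded set [A] through a boundary point, and these points are distinct. *)
Lemma countable_boundary A B (M : R) : closed A -> (forall z, A z -> nrm z <= M) ->
  B `<=` A -> (forall z, A z -> ~ A° z -> B z) -> countable B -> A = B.
Proof.
move=> /(@closed_nrm R R[i]^o) Acl AM BA AB Bc.
apply/seteqP; split=> // z Az; apply: contrapT => nBz.
(* The directions have norm at least 1, so that the parameters staying in [A] are bounded, and no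
   two of them are proportional. *)
pose g (t s : R) : C := z + ((s%:C)%C * (1 +i* t)%C).
have gB t s s' : nrm (g t s - g t s') = `|s - s'| * nrm (1 +i* t)%C.
  rewrite /g opprD addrACA subrr add0r -mulrBl nrmM -rmorphB.
  by rewrite nrm_real.
have d1 t : 1 <= nrm (1 +i* t : C)%C.
  rewrite -lecR -nrmE; apply: le_trans (normc_ge_Re _) => /=.
  by rewrite normr1.
have exit t : exists s, s != 0 /\ B (g t s).
  pose S := [set s | 0 <= s /\ A (g t s)].
  have S0 : S 0 by split=> //; rewrite /g rmorph0 mul0r addr0.
  have nd0 : 0 < nrm (1 +i* t : C)%C by apply: lt_le_trans (d1 t).
  have hS : has_sup S.
    split; first by exists 0.
    exists (M + nrm z) => s [s0 /AM gM].
    have : nrm (g t s - g t 0) <= nrm (g t s) + nrm (g t 0) by exact: nrmB.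
    rewrite gB subr0 ger0_norm //.
    have -> : g t 0 = z by rewrite /g rmorph0 mul0r addr0.
    by move=> h; have := d1 t; nra.
  pose s := sup S.
  have s0 : 0 <= s by apply: ub_le_sup S0; exact: hS.2.
  have As : A (g t s).
    apply: Acl => e e0.
    have [|u [u0 Au] us] := sup_adherent (eps := e / nrm (1 +i* t : C)%C) _ hS.
      by rewrite divr_gt0.
    exists (g t u) => //; rewrite gB.
    have us' : u <= s by apply: ub_le_sup => //; exact: hS.2.
    rewrite -ltr_pdivlMr // ger0_norm ?subr_ge0 //; move: us; rewrite -/s; lra.
  have nAs : ~ A° (g t s).
    move=> /nbhsC[e e0 eA].
    pose h := e / (2 * nrm (1 +i* t : C)%C).
    have h0 : 0 < h by rewrite divr_gt0 ?mulr_gt0.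
    have : S (s + h).
      split; first by rewrite addr_ge0 // ltW.
      apply: eA; rewrite gB opprD addrA subrr add0r normrN gtr0_norm //.
      have -> : h * nrm (1 +i* t : C)%C = e / 2 by rewrite /h; field; rewrite gt_eqF.
      lra.
    by move=> /(ub_le_sup hS.2); rewrite -/s; lra.
  exists s; split; last exact: AB.
  apply/eqP => sE; apply: nBz.
  by have := AB _ As nAs; rewrite sE /g rmorph0 mul0r addr0.
have /choice[s sP] := exit.
pose f t := g t (s t).
have finj : injective f.
  have gE a b : (a%:C)%C * (1 +i* b)%C = (a +i* (a * b))%C :> C.
    by apply/eqP; rewrite eq_complex /=; apply/andP; split; apply/eqP; ring.
  move=> t u; rewrite /f /g => /addrI; rewrite !gE => -[st].
  by rewrite st => /(mulfI (sP u).1).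
have : countable [set: R].
  apply: (@sub_countable _ _ _ B) => //.
  apply: (@card_le_trans _ _ _ (f @` setT)).
    have /card_eqPle[] : (f @` setT #= [set: R])%card by apply: inj_card_eq => ? ? _ _ /finj.
    by [].
  by apply: subset_card_le => _ [t _ <-]; exact: (sP t).2.
move=> /countable_lebesgue_measure0.
have : (0 < lebesgue_measure [set: R])%E.
  apply: (@lt_le_trans _ _ (lebesgue_measure `[0, 1]%classic)).
    by rewrite lebesgue_measure_itv /= lte_fin ltr01 sube0 lte_fin ltr01.
  exact: le_outer_measure.
by move=> /[swap] ->; rewrite ltxx.
Qed.

End PlaneTopology.

(** * The spectra and the theorem *)

Section Spectra.
Context {R : realType}.
Local Notation C := (R[i]).
Variables (X : completeNormedModType C) (T : 'L(X)).

Lemma sigma_gDMC_closed c : closed (sigma_gDMC c T).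
Proof.
apply/(@closed_nrm R R[i]^o) => l lE; apply: contrapT => /gDP/gD_open[e e0 eP].
have [w wE lw] := lE e e0; apply: (_ : ~ sigma_gDMC c T w) wE; apply/gDP.
by apply: gD_sim (sim_shift_shift T l w) _; apply: eP; rewrite nrmBC.
Qed.

Lemma sigma_gDMC_le c c' : @class_le R c c' -> sigma_gDMC c' T `<=` sigma_gDMC c T.
Proof.
by move=> cc l sl; apply: contrapT => /gDP/(gD_le cc)/gDP.
Qed.

Lemma sigma_gKM_sub c : sigma_gKM T `<=` sigma_gDMC c T.
Proof. by move=> l sl; apply: contrapT => /gDP/gD_gK/gKP. Qed.

Lemma sigma_gDMC_boundary c l : sigma_gDMC c T l -> ~ (sigma_gDMC c T)° l ->
  sigma_gKM T l.
Proof.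
move=> sl nint; apply: contrapT => /gKP gK; move: sl; apply/gDP.
apply: gK_gD gK _ => e e0; apply: contrapT => ne; apply: nint.
apply/nbhsC; exists e => // w lw; apply: contrapT => /gDP gw; apply: ne.
exists (w - l); first by rewrite nrmBC.
exact: gD_sim (sim_sym (sim_shift_shift T l w)) gw.
Qed.

Lemma boundary_gDMC c c' : @class_le R c c' ->
  boundary (sigma_gDMC c T) `<=` boundary (sigma_gDMC c' T).
Proof.
move=> cc; apply: boundary_sub; first exact: sigma_gDMC_closed.
  exact: sigma_gDMC_le.
by move=> l sl /(sigma_gDMC_boundary sl)/sigma_gKM_sub.
Qed.

Lemma boundary_gKM c : boundary (sigma_gDMC c T) `<=` boundary (sigma_gKM T).
Proof.
apply: boundary_sub; first exact: sigma_gDMC_closed.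
  exact: sigma_gKM_sub.
by move=> l; exact: sigma_gDMC_boundary.
Qed.

Lemma class_le_inv c : @class_le R CInv c.
Proof.
by move=> a b _ _ [-> ->]; case: c => //=; rewrite ?sube0; split.
Qed.

Lemma sigma_gDM_bounded : exists M : R, forall l, sigma_gDM T l -> nrm l <= M.
Proof.
have [M MP] := spectrum_bounded T; exists M => l sl; apply: MP => iT.
by apply: (_ : ~ sigma_gDM T l) sl; apply/gDP/gD_class.
Qed.

End Spectra.

Theorem theorem3p2 (R : realType) (X : completeNormedModType R[i])
    (infinite_dim : edim [set: X] = +oo%E) (T : 'L(X)) :
  (* (i) *)
  ([/\ boundary (sigma_gDM T) `<=` boundary (sigma_gDMC CJ T),
       boundary (sigma_gDMC CJ T) `<=` boundary (sigma_gDMC CWPlus T),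
       boundary (sigma_gDMC CWPlus T) `<=` boundary (sigma_gDMC CPhiPlus T) &
       boundary (sigma_gDMC CPhiPlus T) `<=` boundary (sigma_gKM T)] /\
   [/\ boundary (sigma_gDM T) `<=` boundary (sigma_gDMC CW T),
       boundary (sigma_gDMC CW T) `<=` boundary (sigma_gDMC CPhi T) &
       boundary (sigma_gDMC CPhi T) `<=` boundary (sigma_gKM T)] /\
   [/\ boundary (sigma_gDM T) `<=` boundary (sigma_gDMC CS T),
       boundary (sigma_gDMC CS T) `<=` boundary (sigma_gDMC CWMinus T),
       boundary (sigma_gDMC CWMinus T) `<=` boundary (sigma_gDMC CPhiMinus T) &
       boundary (sigma_gDMC CPhiMinus T) `<=` boundary (sigma_gKM T)] /\
   [/\ boundary (sigma_gDMC CW T) `<=` boundary (sigma_gDMC CWPlus T),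
       boundary (sigma_gDMC CW T) `<=` boundary (sigma_gDMC CWMinus T),
       boundary (sigma_gDMC CPhi T) `<=` boundary (sigma_gDMC CPhiPlus T) &
       boundary (sigma_gDMC CPhi T) `<=` boundary (sigma_gDMC CPhiMinus T)]) /\
  (* (ii) *)
  (forall c : opclass,
     connected_hull (sigma_gDM T) = connected_hull (sigma_gDMC c T)) /\
  (* (iii) *)
  (with_some_holes (sigma_gKM T) (sigma_gDM T) /\
   forall c : opclass, c <> CInv ->
     with_some_holes (sigma_gDMC c T) (sigma_gDM T)) /\
  (* (iv) *)
  (let spectra := sigma_gKM T |` [set sigma_gDMC c T | c in [set: opclass]] in
   ((exists2 A, spectra A & finite_set A) ->
      (forall A B, spectra A -> spectra B -> A = B) /\
      (forall A, spectra A -> finite_set A)) /\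
   ((exists2 A, spectra A & countable A) ->
      (forall A B, spectra A -> spectra B -> A = B) /\
      (forall A, spectra A -> countable A))).
Proof.
have Acl : closed (sigma_gDM T) by exact: sigma_gDMC_closed.
have [M AM] := sigma_gDM_bounded T.
have Abd := boundedP AM.
have leA c : sigma_gDMC c T `<=` sigma_gDM T.
  exact: sigma_gDMC_le (@class_le_inv R c).
have bdA c l : sigma_gDM T l -> ~ (sigma_gDM T)° l -> sigma_gDMC c T l.
  by move=> sl /(sigma_gDMC_boundary sl)/sigma_gKM_sub.
have noo (x : \bar R) : (0 <= x)%E -> (0 - x <= 0)%E by move=> x0; rewrite sub0e oppe_le0.
split; [|split; [|split]].
(* By [boundary_gDMC] only implications between conditions on nullity and defect remain. *)
- split; [|split; [|split]]; split; try exact: boundary_gKM; apply: boundary_gDMC;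
    try exact: class_le_inv; move=> a b a0 b0 /=.
  + by move=> ->; split => //; exact: noo.
  + by case.
  + by case.
  + by move=> ->; rewrite sube0.
  + by case.
  + by move=> [? _ ->].
  + by move=> [_ ? ->].
  + by case.
  + by case.
- by move=> c; exact: connected_hull_eq Acl Abd (leA c) (bdA c).
- split; last by move=> c _; exact: with_some_holes_sub Acl Abd (leA c) (bdA c).
  apply: with_some_holes_sub Acl Abd (@sigma_gKM_sub _ _ _ _) _ => l.
  exact: sigma_gDMC_boundary.
have sub S : (sigma_gKM T |` [set sigma_gDMC c T | c in [set: opclass]]) S ->
    S `<=` sigma_gDM T.
  by case=> [->|[c _ <-]]; [exact: sigma_gKM_sub|exact: leA].
have eqA S : (sigma_gKM T |` [set sigma_gDMC c T | c in [set: opclass]]) S ->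
    countable S -> sigma_gDM T = S.
  move=> sS cS; apply: countable_boundary Acl AM (sub S sS) _ cS => l sl nl.
  case: sS => [->|[c _ <-]]; last exact: bdA.
  exact: sigma_gDMC_boundary sl nl.
move=> spectra.
(* [eqA] identifies the countable [S] with [sigma_gDM T]; every other spectrum is a subset of it,
   hence countable, and [eqA] applies again. *)
have all_eq S : spectra S -> countable S -> forall A, spectra A -> A = S.
  move=> sS cS A sA; have AE := eqA S sS cS.
  rewrite -AE; apply/esym/eqA => //.
  by apply: sub_countable cS; rewrite -AE; apply: subset_card_le; exact: sub.
split=> -[S sS].
  move=> fS; have h := all_eq S sS (finite_set_countable fS).
  by split=> [A B /h -> /h ->|A /h ->].
move=> cS; have h := all_eq S sS cS.
by split=> [A B /h -> /h ->|A /h ->].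
Qed.
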